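(* There exist finite Coxeter groups $C, A_1, B_1, A_2, B_2$, where $C$ is (identified with) a special subgroup of each of $A_1,B_1,A_2,B_2$, such that the amalgamated products $W=A_1\ast_C B_1$ and $W'=A_2\ast_C B_2$ (amalgamated along these identifications) are Coxeter groups that are $\mathrm{AE}$-equivalent but not isomorphic.
   Context: A Coxeter group is a group with a presentation $\langle S\mid (ss')^{m(s,s')}=1\rangle$, $m(s,s')=m(s',s)\in\{1,\dots,\infty\}$, $m(s,s')=1$ iff $s=s'$. A special subgroup of a Coxeter system $(W,S)$ is a subgroup generated by a subset of $S$. Two groups are $\mathrm{AE}$-equivalent if they satisfy the same first-order sentences of the form $\forall\bar x\exists\bar y\,\theta(\bar x,\bar y)$ with $\theta$ quantifier-free. *)

(* Defs.v *)
From Stdlib Require Import List Arith.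

Record group := Group {
  carrier :> Type;
  gmul : carrier -> carrier -> carrier;
  ginv : carrier -> carrier;
  gone : carrier;
  gmulA : forall x y z, gmul x (gmul y z) = gmul (gmul x y) z;
  gmul1 : forall x, gmul gone x = x;
  gmulV : forall x, gmul (ginv x) x = gone
}.

Arguments gmul {g} _ _.
Arguments ginv {g} _.
Arguments gone {g}.

Fixpoint gpow {G : group} (x : G) (n : nat) : G :=
  match n with 0 => gone | S k => gmul x (gpow x k) end.

Definition is_hom {G H : group} (f : G -> H) : Prop :=
  forall x y, f (gmul x y) = gmul (f x) (f y).

Definition finite_group (G : group) : Prop :=
  exists l : list G, forall x : G, In x l.

Definition isomorphic (G H : group) : Prop :=
  exists (f : G -> H) (g : H -> G),
    is_hom f /\ is_hom g /\ (forall x, g (f x) = x) /\ (forall y, f (g y) = y).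

Inductive generated {G : group} (P : G -> Prop) : G -> Prop :=
  | gen_in : forall x, P x -> generated P x
  | gen_one : generated P gone
  | gen_mul : forall x y, generated P x -> generated P y -> generated P (gmul x y)
  | gen_inv : forall x, generated P x -> generated P (ginv x).

(* (G, s(I)) is a Coxeter system with Coxeter matrix m (None = infinity):
   G has the presentation < s_i (i in I) | (s_i s_j)^(m i j) = 1 >,
   expressed through the universal property of the presentation. *)
Definition coxeter_system (G : group) (I : Type) (s : I -> G)
    (m : I -> I -> option nat) : Prop :=
  (forall i j, m i j = m j i) /\
  (forall i j, m i j = Some 1 <-> i = j) /\
  (forall i j, m i j <> Some 0) /\
  (forall i j n, m i j = Some n -> gpow (gmul (s i) (s j)) n = gone) /\
  (forall (H : group) (f : I -> H),
     (forall i j n, m i j = Some n -> gpow (gmul (f i) (f j)) n = gone) ->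
     exists phi : G -> H, is_hom phi /\ (forall i, phi (s i) = f i) /\
       forall psi : G -> H, is_hom psi -> (forall i, psi (s i) = f i) ->
         forall x, psi x = phi x).

Definition is_coxeter (G : group) : Prop :=
  exists (I : Type) (s : I -> G) (m : I -> I -> option nat), coxeter_system G I s m.

Definition special_embedding (C A : group) (iota : C -> A) : Prop :=
  is_hom iota /\ (forall c c', iota c = iota c' -> c = c') /\
  exists (I : Type) (s : I -> A) (m : I -> I -> option nat),
    coxeter_system A I s m /\
    exists J : I -> Prop,
      forall a : A, (exists c, iota c = a) <->
                    generated (fun g => exists i, J i /\ s i = g) a.

Definition is_amalgam (C A B W : group) (iA : C -> A) (iB : C -> B)
    (jA : A -> W) (jB : B -> W) : Prop :=
  is_hom jA /\ is_hom jB /\ (forall c, jA (iA c) = jB (iB c)) /\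
  (forall (H : group) (fA : A -> H) (fB : B -> H),
     is_hom fA -> is_hom fB -> (forall c, fA (iA c) = fB (iB c)) ->
     exists phi : W -> H, is_hom phi /\ (forall a, phi (jA a) = fA a) /\
       (forall b, phi (jB b) = fB b) /\
       forall psi : W -> H, is_hom psi -> (forall a, psi (jA a) = fA a) ->
         (forall b, psi (jB b) = fB b) -> forall x, psi x = phi x).

Inductive term : Type :=
  | tvar : nat -> term
  | tone : term
  | tmul : term -> term -> term
  | tinv : term -> term.

Inductive qf_formula : Type :=
  | feq : term -> term -> qf_formula
  | fnot : qf_formula -> qf_formula
  | fand : qf_formula -> qf_formula -> qf_formula
  | f_or : qf_formula -> qf_formula -> qf_formula.

Fixpoint eval_term {G : group} (env : nat -> G) (t : term) : G :=
  match t with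
  | tvar k => env k
  | tone => gone
  | tmul a b => gmul (eval_term env a) (eval_term env b)
  | tinv a => ginv (eval_term env a)
  end.

Fixpoint qf_sat {G : group} (env : nat -> G) (f : qf_formula) : Prop :=
  match f with
  | feq a b => eval_term env a = eval_term env b
  | fnot g => ~ qf_sat env g
  | fand g h => qf_sat env g /\ qf_sat env h
  | f_or g h => qf_sat env g \/ qf_sat env h
  end.

(* The AE-sentence  forall x_0..x_{n-1}, exists y_0 y_1 ..., theta  where
   variable k < n denotes x_k and variable n + k denotes y_k.  (theta mentions
   only finitely many variables, so this ranges over all AE sentences.) *)
Definition AE_holds (G : group) (n : nat) (theta : qf_formula) : Prop :=
  forall xs : nat -> G, exists ys : nat -> G,
    qf_sat (fun k => if k <? n then xs k else ys (k - n)) theta.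

Definition AE_equivalent (G H : group) : Prop :=
  forall (n : nat) (theta : qf_formula), AE_holds G n theta <-> AE_holds H n theta.

(* Main.v *)
(* Adjoin to an amalgam W = A *_C B an element v that centralizes C. If enough involutions of A and B outside C commute with C, the extension W_v is AE-equivalent to W. A sentence passes from W_v to W because, by ping-pong, W_v is discriminated by the retractions onto W that send v to long elements centralizing C. It passes from W to W_v because a long element t of this kind contains many patterns x2 y (x1 y)^j x3 with distinct j: one of them is cut by none of the finitely many products in the formula, so if t = a b is split inside it, inserting a^-1 v b^-1 at the occurrences of that pattern respects these products. The insertion turns t into v, and the substitution of t for v undoes it, so it is injective.

Now twist one of the embeddings of C by an automorphism tau that is induced by conjugation in both amalgams W and W'. Using v one can correct the twist, hence W_v is isomorphic to W'_v. Here C = <c_1> x ... x <c_4> has order 16, a factor S_4 of A or B exchanges c_2 with c_3 or c_1 with c_2, a factor S_5 of B exchanges c_3 with c_4, and tau exchanges c_1 with c_4.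

The finite subgroups of an amalgam are conjugate into A or B, and generation forces the images of A and B under an isomorphism W -> W' to be conjugate to the vertex groups by a common element. Such an isomorphism would send c_1, which is central in A and commutes with an element of order five of B, to c_4, which commutes with no element of order five of B. *)

(* In the passage from [W] to the extension, the witnesses found in [W] depend on the element [t]
   substituted for [v], and the products to be respected depend on the witnesses. So [t] must be
   chosen knowing only how many products there will be. Forming one product cuts normal forms at no
   more than six places, and a cut disturbs the pattern for at most one [j]; hence [6 N + 1]
   patterns in [t] leave one intact for [N] products.

   The letters [x1], [x2], [x3] are the involutions of a Klein four-group: one fills the runs, two
   mark their ends. They and [y] commute with [C] and can be recognised modulo [C] in any normal
   form. This is why [A] ends with two factors of order two and [B] with one.

   Other factors serve to exclude isomorphism. Elements of order five occur in [S_5] only, so [A],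
   of exponent twelve, is not carried to [B]. A factor [S_3] of [A] containing [c_4] leaves [c_1] as
   the only non-trivial element of [C] that is central in [A]. The exchanges in one vertex group
   never move [c_1] to [c_4], while those of both together give all permutations of the four
   generators. *)
From Corelib Require Import ssreflect.
From Stdlib Require Import List Lia ZArith Bool.
From Stdlib Require Import FunctionalExtensionality PropExtensionality ProofIrrelevance.
From Stdlib Require Import ClassicalEpsilon FinFun.
Require Import Defs.
Import ListNotations.

Set Implicit Arguments.
Unset Strict Implicit.
Set Bullet Behavior "None".

Declare Scope grp_scope.
Delimit Scope grp_scope with grp.
Local Open Scope grp_scope.
Notation "x * y" := (gmul x y) : grp_scope.
Notation "x ^-1" := (ginv x) (at level 3, left associativity, format "x ^-1") : grp_scope.
Notation "1" := gone : grp_scope.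

(** * Groups *)

Section GroupTheory.
Variable G : group.
Implicit Types x y z : G.

Lemma gmulAr x y z : (x * y) * z = x * (y * z).
Proof. by rewrite gmulA. Qed.

Lemma gmulKg x y : x^-1 * (x * y) = y.
Proof. by rewrite gmulA gmulV gmul1. Qed.

Lemma gmulI x y z : x * y = x * z -> y = z.
Proof. by move=> e; rewrite -(gmulKg x y) e gmulKg. Qed.

Lemma gmulVr x : x * x^-1 = 1.
Proof.
rewrite -(gmul1 _ (x * x^-1)) -{1}(gmulV _ x^-1) gmulAr (gmulA _ x^-1 x) gmulV gmul1.
exact: gmulV.
Qed.

Lemma gmul1r x : x * 1 = x.
Proof. by rewrite -(gmulV _ x) gmulA gmulVr gmul1. Qed.

Lemma gmulKVg x y : x * (x^-1 * y) = y.
Proof. by rewrite gmulA gmulVr gmul1. Qed.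

Lemma ginvK x : x^-1^-1 = x.
Proof. by apply: (@gmulI x^-1); rewrite gmulVr gmulV. Qed.

Lemma ginv1 : (1 : G)^-1 = 1.
Proof. by rewrite -[LHS]gmul1 gmulVr. Qed.

Lemma ginvM x y : (x * y)^-1 = y^-1 * x^-1.
Proof. by apply: (@gmulI (x * y)); rewrite gmulVr gmulAr gmulKVg gmulVr. Qed.

Lemma gmulIr x y z : y * x = z * x -> y = z.
Proof. by move=> e; rewrite -(gmul1r y) -(gmulVr x) gmulA e gmulAr gmulVr gmul1r. Qed.

Lemma ginv_uniq x y : x * y = 1 -> y = x^-1.
Proof. by move=> e; apply: (@gmulI x); rewrite e gmulVr. Qed.

End GroupTheory.

Definition grpE := (gmulAr, gmul1, gmul1r, gmulV, gmulVr, gmulKg, gmulKVg, ginvM, ginvK, ginv1).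
Ltac grp := rewrite ?grpE //.

Section Homs.
Variables (G H : group) (f : G -> H).
Hypothesis fM : is_hom f.

Lemma hom1 : f 1 = 1.
Proof. by apply: (@gmulI _ (f 1)); rewrite -fM !grpE. Qed.

Lemma homV x : f x^-1 = (f x)^-1.
Proof. by apply: ginv_uniq; rewrite -fM gmulVr hom1. Qed.

Lemma homX x n : f (gpow x n) = gpow (f x) n.
Proof. by elim: n => [|n IH] /=; rewrite ?hom1 // fM IH. Qed.

Lemma hom_inj : (forall x, f x = 1 -> x = 1) -> forall x y, f x = f y -> x = y.
Proof.
move=> h x y e; apply: (@gmulIr _ y^-1); rewrite gmulVr; apply: h.
by rewrite fM homV e gmulVr.
Qed.
End Homs.

Lemma hom_id (G : group) : is_hom (fun x : G => x).
Proof. by []. Qed.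

Lemma hom_comp (G H K : group) (f : G -> H) (g : H -> K) :
  is_hom f -> is_hom g -> is_hom (fun x => g (f x)).
Proof. by move=> hf hg x y; rewrite hf hg. Qed.

Lemma gpow_comm (G : group) (x : G) n : gpow x n * x = x * gpow x n.
Proof. by elim: n => [|n IH] /=; [grp | rewrite gmulAr IH; grp]. Qed.

Definition is_subgroup (G : group) (P : G -> Prop) : Prop :=
  P 1 /\ (forall x y, P x -> P y -> P (x * y)) /\ (forall x, P x -> P x^-1).

Section Subgroups.
Variables (G : group) (P : G -> Prop).
Hypothesis sP : is_subgroup P.

Lemma sub1 : P 1. Proof. exact: (proj1 sP). Qed.
Lemma subM x y : P x -> P y -> P (x * y). Proof. exact: (proj1 (proj2 sP)). Qed.
Lemma subV x : P x -> P x^-1. Proof. exact: (proj2 (proj2 sP)). Qed.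
Lemma subVE x : P x^-1 -> P x. Proof. by move=> /subV; rewrite ginvK. Qed.
Lemma subMl x y : P x -> P (x * y) -> P y.
Proof. by move=> /subV hx h; rewrite -(gmulKg x y); apply: subM. Qed.
Lemma subMr x y : P y -> P (x * y) -> P x.
Proof. by move=> /subV hy h; have := subM h hy; grp. Qed.

Definition subgroup_group : group.
Proof.
refine (@Group {x : G | P x}
  (fun x y => exist _ (proj1_sig x * proj1_sig y) (subM (proj2_sig x) (proj2_sig y)))
  (fun x => exist _ (proj1_sig x)^-1 (subV (proj2_sig x)))
  (exist _ 1 sub1) _ _ _).
- by move=> [x hx] [y hy] [z hz]; apply: subset_eq_compat => /=; grp.
- by move=> [x hx]; apply: subset_eq_compat => /=; grp.
- by move=> [x hx]; apply: subset_eq_compat => /=; grp.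
Defined.

End Subgroups.

Lemma generated_subgroup (G : group) (P : G -> Prop) : is_subgroup (generated P).
Proof.
split; [exact: gen_one | split]; [exact: gen_mul | exact: gen_inv].
Qed.

Lemma generated_min (G : group) (P Q : G -> Prop) :
  is_subgroup Q -> (forall x, P x -> Q x) -> forall x, generated P x -> Q x.
Proof.
move=> sQ PQ x; elim=> [y /PQ //| | y z _ hy _ hz | y _ hy].
- exact: sub1.
- exact: subM.
- exact: subV.
Qed.

Lemma hom_ext (G H : group) (f g : G -> H) (P : G -> Prop) :
  is_hom f -> is_hom g -> (forall x, P x -> f x = g x) ->
  forall x, generated P x -> f x = g x.
Proof.
move=> fM gM e x; apply: generated_min e x; split; [|split].
- by rewrite !hom1.
- by move=> x y ex ey; rewrite fM gM ex ey.
- by move=> x ex; rewrite !homV // ex.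
Qed.

Lemma image_subgroup (G H : group) (f : G -> H) (P : G -> Prop) :
  is_hom f -> is_subgroup P -> is_subgroup (fun y => exists x, P x /\ f x = y).
Proof.
move=> fM sP; split; [|split].
- by exists 1; split; [exact: sub1 | exact: hom1].
- by move=> _ _ [x [hx <-]] [y [hy <-]]; exists (x * y); split; [exact: subM | exact: fM].
- by move=> _ [x [hx <-]]; exists x^-1; split; [exact: subV | exact: homV].
Qed.

Definition prod_group (G H : group) : group.
Proof.
refine (@Group (G * H)%type (fun x y => (fst x * fst y, snd x * snd y))
  (fun x => ((fst x)^-1, (snd x)^-1)) (1, 1) _ _ _).
- by move=> [? ?] [? ?] [? ?] /=; grp.
- by move=> [? ?] /=; grp.
- by move=> [? ?] /=; grp.
Defined.

Fixpoint gprod (G : group) (l : list G) : G :=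
  match l with [] => 1 | x :: r => x * gprod r end.


Lemma gprod_app (G : group) (l r : list G) : gprod (l ++ r) = gprod l * gprod r.
Proof. by elim: l => [|x l IH] /=; [grp | rewrite IH; grp]. Qed.

(** * Groups generated by permutations of a set of normal forms *)

Section ActionGroup.
Variables (T S : Type) (act : S -> T -> T) (sinv : S -> S).
Hypothesis actK : forall s t, act (sinv s) (act s t) = t.
Hypothesis actVK : forall s t, act s (act (sinv s) t) = t.

(** A permutation is generated together with its inverse, so that inversion in [perm_group] only
    swaps the two functions. *)
Inductive gen_perm : (T -> T) -> (T -> T) -> Prop :=
  | gp_one : gen_perm (fun t => t) (fun t => t)
  | gp_act : forall s, gen_perm (act s) (act (sinv s))
  | gp_mul : forall f f' g g', gen_perm f f' -> gen_perm g g' ->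
      gen_perm (fun t => f (g t)) (fun t => g' (f' t))
  | gp_inv : forall f f', gen_perm f f' -> gen_perm f' f.

Lemma gen_permK f f' : gen_perm f f' -> (forall t, f' (f t) = t) /\ (forall t, f (f' t) = t).
Proof.
elim=> [|s|{}f {}f' g g' _ [h1 h2] _ [h3 h4]|{}f {}f' _ [h1 h2]] //.
- by split=> t; rewrite ?h1 ?h3 ?h4 ?h2.
Qed.

Definition perm_elt := {p : (T -> T) * (T -> T) | gen_perm (fst p) (snd p)}.
Definition pfun (x : perm_elt) : T -> T := fst (proj1_sig x).

Lemma perm_elt_eq (x y : perm_elt) : (forall t, pfun x t = pfun y t) -> x = y.
Proof.
case: x y => [[f f'] hf] [[g g'] hg]; rewrite /pfun /= => e.
apply: subset_eq_compat; have -> : f = g by apply: functional_extensionality.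
congr (_, _); apply: functional_extensionality => t.
have [/= h1 h2] := gen_permK hf; have [/= h3 h4] := gen_permK hg.
by rewrite -{1}(h4 t) -e h1.
Qed.

Definition perm_group : group.
Proof.
refine (@Group perm_elt
  (fun x y => exist _ (fun t => fst (proj1_sig x) (fst (proj1_sig y) t),
                       fun t => snd (proj1_sig y) (snd (proj1_sig x) t)) _)
  (fun x => exist _ (snd (proj1_sig x), fst (proj1_sig x)) (gp_inv (proj2_sig x)))
  (exist _ (fun t => t, fun t => t) gp_one) _ _ _).
- by move=> x y z; apply: perm_elt_eq.
- by move=> x; apply: perm_elt_eq.
- move=> x; apply: perm_elt_eq => t; rewrite /pfun /=.
  exact: (proj1 (gen_permK (proj2_sig x))).
Unshelve.
exact: (gp_mul (proj2_sig x) (proj2_sig y)).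
Defined.

Definition perm_gen (s : S) : perm_group := exist _ (act s, act (sinv s)) (gp_act s).

Lemma pfunM (x y : perm_group) t : pfun (x * y) t = pfun x (pfun y t).
Proof. by []. Qed.

Lemma perm_group_generated (x : perm_group) : generated (fun y => exists s, perm_gen s = y) x.
Proof.
case: x => [[f f'] /= hf].
elim: hf (hf) => [|s|{}f {}f' g g' h1 IH1 h2 IH2|{}f {}f' h1 IH1] hf.
- have -> : exist _ (fun t => t, fun t => t) hf = (1 : perm_group) by apply: perm_elt_eq.
  exact: gen_one.
- by apply: gen_in; exists s; apply: perm_elt_eq.
- have -> : exist _ (fun t => f (g t), fun t => g' (f' t)) hf =
    (exist _ (f, f') h1 : perm_group) * (exist _ (g, g') h2 : perm_group).
    exact: perm_elt_eq.
  by apply: gen_mul.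
- have -> : exist _ (f', f) hf = (exist _ (f, f') h1 : perm_group)^-1 by apply: perm_elt_eq.
  by apply: gen_inv.
Qed.

Section Extension.
Variables (t0 : T) (H : group) (h : S -> H) (ev : T -> H).
Hypothesis ev0 : ev t0 = 1.
Hypothesis ev_act : forall s t, ev (act s t) = h s * ev t.

Definition perm_ext (x : perm_group) : H := ev (pfun x t0).

(** Every group element multiplies all values of [ev] by one fixed factor, which is read off at [t0]
    because [ev t0] is 1. When [ev] evaluates normal forms in a target group, this yields the
    universal property. *)
Lemma perm_extE (x : perm_group) t : ev (pfun x t) = perm_ext x * ev t.
Proof.
have E f f' : gen_perm f f' ->
  exists g, forall t, ev (f t) = g * ev t /\ ev (f' t) = g^-1 * ev t.
  elim=> [|s|{}f {}f' g g' _ [k IH1] _ [k' IH2]|{}f {}f' _ [k IH]].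
  - by exists 1 => u; rewrite !grpE.
  - exists (h s) => u; rewrite ev_act; split=> //.
    by rewrite -[in RHS](actVK s u) (ev_act s); grp.
  - exists (k * k') => u; rewrite (proj1 (IH1 _)) (proj1 (IH2 _)).
    by rewrite (proj2 (IH2 _)) (proj2 (IH1 _)); grp.
  - by exists k^-1 => u; rewrite ginvK; case: (IH u).
have [g eg] := E _ _ (proj2_sig x).
by rewrite /perm_ext /pfun !(proj1 (eg _)) ev0; grp.
Qed.

Lemma perm_ext_hom : is_hom perm_ext.
Proof. by move=> x y; rewrite {1}/perm_ext pfunM perm_extE. Qed.

Lemma perm_ext_gen s : perm_ext (perm_gen s) = h s.
Proof. by rewrite /perm_ext /pfun /= ev_act ev0; grp. Qed.

End Extension.
End ActionGroup.

(** * Normal forms in amalgamated products *)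

Definition head_not (X : Type) (b : bool) (l : list (bool * X)) : Prop :=
  match l with [] => True | p :: _ => fst p <> b end.

(* The side of each letter is recorded although it is determined by the letter. *)
Fixpoint reduced (W : group) (S : bool -> W -> Prop) (C : W -> Prop) (l : list (bool * W)) : Prop :=
  match l with
  | [] => True
  | p :: r => S (fst p) (snd p) /\ ~ C (snd p) /\ head_not (fst p) r /\ reduced S C r
  end.

Definition word (W : group) (l : list (bool * W)) : W := gprod (map snd l).

Definition amalgam_structure (W : group) (S : bool -> W -> Prop) (C : W -> Prop) : Prop :=
  (forall b, is_subgroup (S b)) /\ is_subgroup C /\ (forall b x, C x -> S b x) /\
  (forall x, generated (fun y => exists b, S b y) x) /\
  (forall l, reduced S C l -> l <> [] -> ~ C (word l)).

Section Construction.
Variables (C : group) (G : bool -> group) (i : forall b, C -> G b).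
Hypothesis iM : forall b, is_hom (i b).
Hypothesis iI : forall b c c', i b c = i b c' -> c = c'.
Arguments i : clear implicits.

Definition in_C b (a : G b) : Prop := exists c, i b c = a.

Definition rep b (a : G b) : G b := epsilon (inhabits a) (fun a' => exists c, a' = i b c * a).

Lemma rep_ex b (a : G b) : exists c, rep a = i b c * a.
Proof.
apply: (epsilon_spec (inhabits a) (fun a' => exists c, a' = i b c * a)).
by exists a, 1; rewrite hom1 // gmul1.
Qed.

(** The two elements define extensionally equal predicates, and [epsilon] depends only on the
    predicate. So [rep] picks one representative in each coset of [C]. *)
Lemma repM b c (a : G b) : rep (i b c * a) = rep a.
Proof.
have E : (fun a' => exists d, a' = i b d * (i b c * a)) = (fun a' => exists d, a' = i b d * a).
  apply: functional_extensionality => a'; apply: propositional_extensionality.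
  split=> [[d ->]|[d ->]]; first by exists (d * c); rewrite iM; grp.
  by exists (d * c^-1); rewrite iM homV //; grp.
have E' a1 a2 (P : G b -> Prop) : (exists a, P a) -> epsilon (inhabits a1) P = epsilon (inhabits a2) P.
  by move=> _; congr epsilon; exact: proof_irrelevance.
by rewrite /rep E; apply: E'; exists a, 1; rewrite hom1 // gmul1.
Qed.

Lemma ccomp_ex b (a : G b) : {c | a = i b c * rep a}.
Proof.
apply: constructive_indefinite_description; have [c ->] := rep_ex a.
by exists c^-1; rewrite homV //; grp.
Qed.

Definition ccomp b (a : G b) : C := proj1_sig (ccomp_ex a).
Lemma ccompE b (a : G b) : a = i b (ccomp a) * rep a.
Proof. exact: (proj2_sig (ccomp_ex a)). Qed.

Lemma rep_rep b (a : G b) : rep (rep a) = rep a.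
Proof. by rewrite {2}(ccompE a) repM. Qed.

Lemma in_CM b c (a : G b) : in_C (i b c * a) -> in_C a.
Proof. by move=> [d e]; exists (c^-1 * d); rewrite iM homV // e; grp. Qed.

Lemma in_C_rep b (a : G b) : in_C (rep a) -> in_C a.
Proof. by move=> [d e]; exists (ccomp a * d); rewrite iM e -ccompE. Qed.

Lemma ccomp_rep b c (s : G b) : rep s = s -> ccomp (i b c * s) = c.
Proof.
move=> e; apply: (@iI b); apply: (@gmulIr _ s).
by rewrite {2}(ccompE (i b c * s)) repM e.
Qed.

Definition letter := {b : bool & G b}.

Definition lhead_not b (l : list letter) : Prop :=
  match l with [] => True | s :: _ => projT1 s <> b end.

Fixpoint valid (l : list letter) : Prop :=
  match l with
  | [] => True
  | s :: r => rep (projT2 s) = projT2 s /\ ~ in_C (projT2 s) /\ lhead_not (projT1 s) r /\ valid r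
  end.

(** Van der Waerden's device: [put] and [join b] identify valid normal forms with pairs of an
    element of [G b] and a form not headed on side [b]. Left multiplication on the first component
    is then visibly an action of [G b]. *)
Definition put b (p : G b * list letter) : C * list letter :=
  match excluded_middle_informative (in_C (fst p)) with
  | left h => (proj1_sig (constructive_indefinite_description _ h), snd p)
  | right _ => (ccomp (fst p), existT _ b (rep (fst p)) :: snd p)
  end.

Definition join b (p : C * list letter) : G b * list letter :=
  match snd p with
  | [] => (i b (fst p), [])
  | existT _ b' s :: r =>
      match bool_dec b' b with
      | left e => (i b (fst p) * eq_rect b' (fun b => carrier (G b)) s b e, r)
      | right _ => (i b (fst p), snd p)
      end
  end.

Lemma join_same b c s r : join b (c, existT _ b s :: r) = (i b c * s, r).
Proof.
rewrite /join /=; case: (bool_dec b b) => // e.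
by rewrite (proof_irrelevance _ e eq_refl).
Qed.

Lemma join_other b c l : lhead_not b l -> join b (c, l) = (i b c, l).
Proof.
by case: l => [|[b' s] r] //= ne; rewrite /join /=; case: (bool_dec b' b).
Qed.

Lemma lhead_cases b (l : list letter) : lhead_not b l \/ exists s r, l = existT _ b s :: r.
Proof.
case: l => [|[b' s] r]; first by left.
by case: (bool_dec b' b) => [<-|]; [right; exists s, r | left].
Qed.

Lemma put_in b c l : put (i b c, l) = (c, l).
Proof.
rewrite /put /=; case: excluded_middle_informative => [h|[]]; last by exists c.
by case: constructive_indefinite_description => c' /= /iI ->.
Qed.

Lemma put_out b (a : G b) l : ~ in_C a -> put (a, l) = (ccomp a, existT _ b (rep a) :: l).
Proof. by rewrite /put /=; case: excluded_middle_informative. Qed.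

Lemma put_valid b (a : G b) l : valid l -> lhead_not b l -> valid (snd (put (a, l))).
Proof.
move=> vl hl; case: (excluded_middle_informative (in_C a)) => [[c <-]|h].
  by rewrite put_in.
rewrite put_out //=; split; [exact: rep_rep | split; last by []].
by move=> /in_C_rep.
Qed.

Lemma put_join b p : valid (snd p) -> put (join b p) = p.
Proof.
case: p => c l /= v; case: (lhead_cases b l) => [h|[s [r e]]].
  by rewrite join_other // put_in.
move: v; rewrite e /= => -[e1 [e2 _]]; rewrite join_same put_out; first by move=> /in_CM.
by rewrite ccomp_rep // repM e1.
Qed.

Lemma join_put b (a : G b) l : lhead_not b l -> join b (put (a, l)) = (a, l).
Proof.
move=> hl; case: (excluded_middle_informative (in_C a)) => [[c <-]|h].
  by rewrite put_in join_other.
by rewrite put_out // join_same -ccompE.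
Qed.

Lemma join_valid b p : valid (snd p) -> valid (snd (join b p)) /\ lhead_not b (snd (join b p)).
Proof.
case: p => c l /= v; case: (lhead_cases b l) => [h|[s [r e]]].
  by rewrite join_other.
by move: v; rewrite e /= join_same /= => -[e1 [e2 []]].
Qed.

Definition act b (a : G b) (p : C * list letter) : C * list letter :=
  put (a * fst (join b p), snd (join b p)).

Lemma act_valid b (a : G b) p : valid (snd p) -> valid (snd (act a p)).
Proof. by move=> /(@join_valid b) [v h]; apply: put_valid. Qed.

Lemma actM b (a a' : G b) p : valid (snd p) -> act (a * a') p = act a (act a' p).
Proof.
move=> /(@join_valid b) [v h]; rewrite /act (@join_put b (a' * _)) //=; grp.
Qed.

Lemma act1 b p : valid (snd p) -> act (1 : G b) p = p.
Proof. by move=> v; rewrite /act gmul1 -surjective_pairing put_join. Qed.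

Lemma act_C b c p : valid (snd p) -> act (i b c) p = (c * fst p, snd p).
Proof.
case: p => d l /= v; rewrite /act; case: (lhead_cases b l) => [h|[s [r e]]].
  by rewrite join_other //= -iM put_in.
move: v; rewrite e /= => -[e1 [e2 _]]; rewrite join_same /= gmulA -iM put_out.
  by move=> /in_CM.
by rewrite ccomp_rep // repM e1.
Qed.

Definition nform := {p : C * list letter | valid (snd p)}.
Definition nact (s : letter) (t : nform) : nform :=
  exist _ (act (projT2 s) (proj1_sig t)) (act_valid (projT2 s) (proj2_sig t)).
Definition linv (s : letter) : letter := existT _ (projT1 s) (projT2 s)^-1.
Definition nbase : nform := exist (fun p => valid (snd p)) (1, []) I.

Lemma nform_eq (t t' : nform) : proj1_sig t = proj1_sig t' -> t = t'.
Proof. by case: t t' => [p v] [p' v'] /= e; apply: subset_eq_compat. Qed.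

Lemma nactK s t : nact (linv s) (nact s t) = t.
Proof.
apply: nform_eq; case: t => p v /=; rewrite -actM // gmulV; exact: act1.
Qed.

Lemma nactVK s t : nact s (nact (linv s) t) = t.
Proof.
apply: nform_eq; case: t => p v /=; rewrite -actM // gmulVr; exact: act1.
Qed.

Definition amalgam : group := perm_group nactK nactVK.
Definition amalgam_in b (a : G b) : amalgam := perm_gen nactK nactVK (existT _ b a).

Lemma amalgam_in_hom b : is_hom (@amalgam_in b).
Proof.
move=> a a'; apply: (perm_elt_eq nactK nactVK) => t; apply: nform_eq; rewrite /pfun /=.
by rewrite actM //; case: t.
Qed.

Lemma amalgam_in_C c : amalgam_in (i true c) = amalgam_in (i false c).
Proof.
apply: (perm_elt_eq nactK nactVK) => t; apply: nform_eq; rewrite /pfun /=.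
by rewrite !act_C //; case: t.
Qed.

Lemma amalgam_in_C' b b' c : amalgam_in (i b c) = amalgam_in (i b' c).
Proof. by case: b b' => [] []; rewrite // amalgam_in_C. Qed.

Lemma amalgam_generated (x : amalgam) :
  generated (fun y => exists b (a : G b), amalgam_in a = y) x.
Proof.
apply: generated_min (perm_group_generated x); first exact: generated_subgroup.
by move=> y [[b a] <-]; apply: gen_in; exists b, a.
Qed.

Section Universal.
Variables (H : group) (f : forall b, G b -> H).
Arguments f : clear implicits.
Hypothesis fM : forall b, is_hom (f b).
Hypothesis fC : forall c, f true (i true c) = f false (i false c).

Definition lprod (l : list letter) : H := gprod (map (fun s => f (projT1 s) (projT2 s)) l).
Definition nev (t : nform) : H := f true (i true (fst (proj1_sig t))) * lprod (snd (proj1_sig t)).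

Lemma fC' b c : f b (i b c) = f true (i true c).
Proof. by case: b => //; rewrite fC. Qed.

Lemma nev_put b (a : G b) l :
  f true (i true (fst (put (a, l)))) * lprod (snd (put (a, l))) = f b a * lprod l.
Proof.
case: (excluded_middle_informative (in_C a)) => [[c <-]|h].
  by rewrite put_in /= fC'.
by rewrite put_out //= [in RHS](ccompE a) -(fC' b) fM /lprod /=; grp.
Qed.

Lemma nev_join b p :
  f true (i true (fst p)) * lprod (snd p) = f b (fst (join b p)) * lprod (snd (join b p)).
Proof.
case: p => c l /=; case: (lhead_cases b l) => [h|[s [r ->]]].
  by rewrite join_other //= fC'.
by rewrite join_same /= fM fC' /lprod /=; grp.
Qed.

Lemma nev_act s t : nev (nact s t) = f (projT1 s) (projT2 s) * nev t.
Proof.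
by rewrite /nev /= /act nev_put fM (@nev_join (projT1 s) (proj1_sig t)); grp.
Qed.

Definition amalgam_ext (x : amalgam) : H := perm_ext nbase nev x.

Lemma nev_base : nev nbase = 1.
Proof. by rewrite /nev /lprod /= (hom1 (@iM true)) (hom1 (@fM true)); grp. Qed.

Lemma amalgam_ext_hom : is_hom amalgam_ext.
Proof. exact: (perm_ext_hom nev_base nev_act). Qed.

Lemma amalgam_ext_in b (a : G b) : amalgam_ext (amalgam_in a) = f b a.
Proof. exact: (@perm_ext_gen _ _ _ _ nactK nactVK nbase H _ nev nev_base nev_act (existT _ b a)). Qed.

End Universal.

(** The element can be read back by acting on the empty normal form and applying [join b]. *)
Lemma amalgam_in_inj b (a : G b) : amalgam_in a = 1 -> a = 1.
Proof.
move=> e; have : proj1_sig (pfun (amalgam_in a) nbase) = proj1_sig nbase by rewrite e.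
rewrite /pfun /= => e'.
have : join b (act a (1, [])) = join b (1, []) by rewrite e'.
by rewrite /act !join_other //= hom1 // gmul1r join_put // => -[].
Qed.

Definition side b (w : amalgam) : Prop := exists a : G b, amalgam_in a = w.
Definition core (w : amalgam) : Prop := exists c, amalgam_in (i true c) = w.

Lemma core_in b (a : G b) : core (amalgam_in a) <-> in_C a.
Proof.
split=> [[c]|[c <-]]; last by exists c; exact: amalgam_in_C'.
rewrite (amalgam_in_C' true b) => e; exists c; apply: (hom_inj (f := @amalgam_in b)) e.
  exact: amalgam_in_hom.
exact: amalgam_in_inj.
Qed.

(** Sides alternate, so every letter meets a form headed on the other side and is added to it
    without merging. Hence a non-empty reduced word acts unlike any element of [C]. *)
Lemma word_nform (l : list (bool * amalgam)) : reduced side core l ->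
  length (snd (proj1_sig (pfun (word l) nbase))) = length l /\
  (forall b, head_not b l -> lhead_not b (snd (proj1_sig (pfun (word l) nbase)))).
Proof.
elim: l => [|[b w] l IH] //= [[a ea] [nc [hl rl]]].
have [IH1 IH2] := IH rl; rewrite pfunM; move: nc; rewrite -ea core_in /pfun /= => nc.
move: IH1 (IH2 _ hl); rewrite /pfun; case: (fst _ nbase) => [[c m] v] /= em hm.
rewrite /act join_other //= put_out /=; first by move: nc; rewrite /in_C => nc [d e]; apply: nc;
  exists (d * c^-1); rewrite iM e homV //; grp.
by rewrite em.
Qed.

Lemma amalgam_amalgam_structure : amalgam_structure side core.
Proof.
have sS b : is_subgroup (side b).
  split; [|split].
  - by exists 1; rewrite hom1 //; exact: amalgam_in_hom.
  - by move=> _ _ [a <-] [a' <-]; exists (a * a'); rewrite amalgam_in_hom.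
  - by move=> _ [a <-]; exists a^-1; rewrite homV //; exact: amalgam_in_hom.
split=> //; split; last split; last split.
- split; [|split].
  + by exists 1; rewrite !hom1 //; exact: amalgam_in_hom.
  + by move=> _ _ [a <-] [a' <-]; exists (a * a'); rewrite iM amalgam_in_hom.
  + by move=> _ [a <-]; exists a^-1; rewrite homV // homV //; exact: amalgam_in_hom.
- by move=> b _ [c <-]; rewrite (amalgam_in_C' true b); exists (i b c).
- move=> x; apply: generated_min (amalgam_generated x); first exact: generated_subgroup.
  by move=> y [b [a <-]]; apply: gen_in; exists b, a.
- move=> l rl ne [c ec]; apply: ne.
  have [] := word_nform rl; rewrite -ec /pfun /= act_C //=.
  by case: l {rl ec}.
Qed.

End Construction.

Theorem amalgam_exists (C A B : group) (iA : C -> A) (iB : C -> B) :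
  is_hom iA -> is_hom iB -> (forall c c', iA c = iA c' -> c = c') ->
  (forall c c', iB c = iB c' -> c = c') ->
  exists (W : group) (jA : A -> W) (jB : B -> W),
    is_amalgam C A B W iA iB jA jB /\
    (forall a, jA a = 1 -> a = 1) /\ (forall b, jB b = 1 -> b = 1) /\
    amalgam_structure
      (fun s w => if s : bool then exists a, jA a = w else exists b, jB b = w)
      (fun w => exists c, jA (iA c) = w).
Proof.
move=> hA hB nA nB.
pose G (b : bool) := if b then A else B.
pose i (b : bool) : C -> G b := if b return C -> G b then iA else iB.
have iM b : is_hom (i b) by case: b.
have iI b c c' : i b c = i b c' -> c = c' by case: b; [exact: nA | exact: nB].
pose W := amalgam iM iI.
pose j b : G b -> W := amalgam_in iM iI (b := b).
have jM b : is_hom (j b) by apply: amalgam_in_hom.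
exists W, (j true), (j false); split; last split; last split.
- split; [exact: (jM true) | split; [exact: (jM false) | split; [exact: amalgam_in_C|]]].
  move=> H fA fB fAM fBM fC.
  pose f (b : bool) : G b -> H := if b return G b -> H then fA else fB.
  have fM b : is_hom (f b) by case: b.
  have extM : is_hom (@amalgam_ext _ _ _ iM iI H f) by apply: amalgam_ext_hom.
  exists (@amalgam_ext _ _ _ iM iI H f); split=> //.
  have E b a : amalgam_ext f (j b a) = f b a by apply: amalgam_ext_in.
  split; [exact: (E true) | split; first exact: (E false)].
  move=> psi psiM eA eB x.
  apply: (hom_ext psiM extM _ (amalgam_generated (iM := iM) (iI := iI) x)).
  by move=> _ [[] [a <-]]; rewrite -/(j _ _) E //= ?eA ?eB.
- by move=> a; apply: amalgam_in_inj.
- by move=> a; apply: amalgam_in_inj.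
- have := amalgam_amalgam_structure iM iI; rewrite /core.
  have -> : side (iM := iM) (iI := iI) = (fun s w => if s : bool then exists a, j true a = w else exists b, j false b = w).
    by apply: functional_extensionality => -[].
  by [].
Qed.

(** * Combinatorics of reduced words *)

Definition dec (P : Prop) : {P} + {~ P} := excluded_middle_informative P.

Definition winv (W : group) (l : list (bool * W)) : list (bool * W) :=
  rev (map (fun p => (fst p, (snd p)^-1)) l).

Section Words.
Variables (W : group) (S : bool -> W -> Prop) (C : W -> Prop).
Hypothesis str : amalgam_structure S C.
Let red := reduced S C.
Implicit Types (l m r : list (bool * W)) (p q : bool * W) (c w : W).

Lemma sideG b : is_subgroup (S b). Proof. exact: (proj1 str). Qed.
Lemma coreG : is_subgroup C. Proof. exact: (proj1 (proj2 str)). Qed.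
Lemma core_side b x : C x -> S b x. Proof. exact: (proj1 (proj2 (proj2 str))). Qed.
Lemma normal_form l : reduced S C l -> C (word l) -> l = [].
Proof.
move=> rl cl; case: l rl cl => // p l rl cl.
by case: (proj2 (proj2 (proj2 (proj2 str))) _ rl).
Qed.

Let C1 : C 1 := sub1 coreG.
Let CV c : C c -> C c^-1 := subV coreG (x := c).

Lemma word_app l m : word (l ++ m) = word l * word m.
Proof. by rewrite /word map_app gprod_app. Qed.

Lemma word_cons p l : word (p :: l) = snd p * word l.
Proof. by []. Qed.

Lemma word_winv l : word (winv l) = (word l)^-1.
Proof.
elim: l => [|p l IH]; rewrite /winv /= ?word_app; first by rewrite /word /= ginv1.
by move: IH; rewrite /winv => ->; rewrite /word /=; grp.
Qed.

Lemma winv_app l m : winv (l ++ m) = winv m ++ winv l.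
Proof. by rewrite /winv map_app rev_app_distr. Qed.

Lemma winv_length l : length (winv l) = length l.
Proof. by rewrite /winv length_rev length_map. Qed.

Lemma red_r l m : red (l ++ m) -> red m.
Proof. by elim: l => [//|p l IH] /= [_ [_ [_ /IH]]]. Qed.

Lemma red_l l m : red (l ++ m) -> red l.
Proof.
elim: l => [//|p l IH] /= [h1 [h2 [h3 /IH h4]]]; split=> //; split=> //; split=> //.
by case: l h3 {IH h4}.
Qed.

Lemma red_cat l p m : red (l ++ [p]) -> red (p :: m) -> red (l ++ p :: m).
Proof.
elim: l => [//|q l IH] /= [h1 [h2 [h3 h4]]] h5; split=> //; split=> //; split; last exact: IH.
by case: l h3 {IH h4}.
Qed.

Lemma red_letter l p m : red (l ++ p :: m) -> S (fst p) (snd p) /\ ~ C (snd p).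
Proof. by move=> /red_r [? [? _]]. Qed.

Lemma red_adj l p q m : red (l ++ p :: q :: m) -> fst q <> fst p.
Proof. by move=> /red_r [_ [_ []]]. Qed.

Lemma red_winv l : red l -> red (winv l).
Proof.
elim: l => [//|p l IH] h.
have [h1 [h2 [h3 h4]]] := h.
have hp : red [(fst p, (snd p)^-1)].
  by split; [exact: (subV (sideG _)) | split=> // /(subVE coreG)].
case: l IH h h3 h4 => [//|q l] IH _ /= ne /IH.
rewrite /winv /= => r1; rewrite -app_assoc /=; apply: red_cat => //.
have [] := red_letter (m := []) r1 => /= s1 s2.
by split=> //; split=> //; split=> // /= e; apply: ne; rewrite e.
Qed.

(** Reduced words for the same element differ by moving elements of [C] between adjacent letters. *)
Fixpoint ceq c l m : Prop :=
  match l, m with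
  | [], [] => c = 1
  | p :: l', q :: m' => fst p = fst q /\ exists c', C c' /\ c * snd p = snd q * c' /\ ceq c' l' m'
  | _, _ => False
  end.

Lemma red_head p l c : red (p :: l) -> C c -> red ((fst p, c * snd p) :: l).
Proof.
move=> [h1 [h2 h3]] hc; split; first by apply: (subM (sideG _)) => //; apply: core_side.
by split=> //= h; apply: h2; apply: (subMl coreG) h.
Qed.

(** If the leading letters lay on different sides or differed by more than [C], the inverse of the
    second word could be joined to the first one, with at most these two letters merged, to a
    non-empty reduced word equal to 1. *)
Lemma nf_uniq c l m : red l -> red m -> C c -> c * word l = word m -> ceq c l m.
Proof.
elim: l c m => [|p l IH] c [|q m] rl rm hc e.
- by move: e; rewrite /word /=; grp.
- have : C (word (q :: m)) by rewrite -e /word /= gmul1r.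
  by move/(normal_form rm).
- have ew : word (p :: l) = c^-1 by apply: ginv_uniq.
  have : C (word (p :: l)) by rewrite ew; apply: CV.
  by move/(normal_form rl).
have rp := red_head rl hc; have rq := red_winv rm.
have e' : word (winv (q :: m)) * (c * word (p :: l)) = 1 by rewrite e word_winv; grp.
have rq' : red (winv m ++ [(fst q, (snd q)^-1)]) by exact: rq.
case: (bool_dec (fst p) (fst q)) => [es|ne]; last first.
  exfalso; have r' : red (winv m ++ (fst q, (snd q)^-1) :: (fst p, c * snd p) :: l).
    apply: red_cat => //; have [s1 s2] := red_letter (m := []) rq'.
    by split=> //; split.
  have : C (word (winv m ++ (fst q, (snd q)^-1) :: (fst p, c * snd p) :: l)).
    suff -> : word (winv m ++ (fst q, (snd q)^-1) :: (fst p, c * snd p) :: l) = 1 by [].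
    rewrite -e' word_app /= !word_cons /= !word_winv !word_cons; grp.
  by move/(normal_form r'); case: (winv m).
split=> //; exists ((snd q)^-1 * (c * snd p)).
have ew : (snd q)^-1 * (c * snd p) * word l = word m.
  by move: e; rewrite !word_cons => e2; rewrite !gmulAr e2 gmulKg.
case: (dec (C ((snd q)^-1 * (c * snd p)))) => [hc'|nc].
  split=> //; split; first by grp.
  by apply: IH => //; [case: rl => [_ [_ [_]]] | case: rm => [_ [_ [_]]]].
exfalso; set d := (snd q)^-1 * (c * snd p) in ew nc.
have r' : red (winv m ++ (fst q, d) :: l).
  apply: red_cat.
    case: m rm {e e' rq rq' ew} => [|q' m] rm; [|have /= ne := red_adj (l := []) rm].
      split=> //; rewrite /d; apply: (subM (sideG _)); first by apply: (subV (sideG _)); case: rm.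
      by rewrite -es; case: rp.
    have := @red_winv (q' :: m) (proj2 (proj2 (proj2 rm))); rewrite /winv /= => r0.
    rewrite -app_assoc; apply: red_cat => //; have [s1 s2] := red_letter (m := []) r0.
    split=> //; split=> //; split; first by move=> /= eq; apply: ne.
    split=> //=; apply: (subM (sideG _)); first by apply: (subV (sideG _)); case: rm.
    by rewrite -es; case: rp.
  split; [|split=> //].
    rewrite /d; apply: (subM (sideG _)); first by apply: (subV (sideG _)); case: rm.
    by rewrite -es; case: rp.
  by case: rl => _ [_ [h1 h2]]; rewrite /= -es.
have : C (word (winv m ++ (fst q, d) :: l)).
  suff -> : word (winv m ++ (fst q, d) :: l) = 1 by [].
  by rewrite word_app word_cons /= ew word_winv gmulV.
by move/(normal_form r'); case: (winv m).
Qed.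

Lemma ceq_length c l m : ceq c l m -> length l = length m.
Proof. by elim: l c m => [|p l IH] c [|q m] //= [_ [c' [_ [_ /IH ->]]]]. Qed.

Lemma mul_letter b a c l : S b a -> C c -> red l ->
  exists c' l', C c' /\ red l' /\ a * (c * word l) = c' * word l'.
Proof.
move=> ha hc rl.
have hac : S b (a * c) by apply: (subM (sideG _)) => //; apply: core_side.
case: (dec (C (a * c))) => h1; first by exists (a * c), l; grp.
case: l rl => [|[b' s] l] rl.
  by exists 1, [(b, a * c)]; split=> //; split=> //; rewrite /word /=; grp.
case: (bool_dec b' b) => [e|ne]; last first.
  exists 1, ((b, a * c) :: (b', s) :: l); split=> //; split=> //.
  by rewrite [in RHS]word_cons /=; grp.
move: rl; rewrite e => -[h2 [h3 [h4 h5]]].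
case: (dec (C (a * c * s))) => h6.
  by exists (a * c * s), l; split=> //; split=> //; rewrite word_cons /=; grp.
exists 1, ((b, a * c * s) :: l); split=> //; split; last by rewrite !word_cons /=; grp.
by split=> //; apply: (subM (sideG _)).
Qed.

Lemma nf_exists w : exists c l, C c /\ red l /\ w = c * word l.
Proof.
pose Q w := exists c l, C c /\ red l /\ w = c * word l.
have QS b a u : S b a -> Q u -> Q (a * u).
  by move=> ha [c [l [hc [rl ->]]]]; apply: mul_letter ha hc rl.
(* Translation by the inverse is included to make the set closed under inversion. *)
have sQ : is_subgroup (fun x => forall u, Q u -> Q (x * u) /\ Q (x^-1 * u)).
  split; [|split].
  - by move=> u hu; rewrite ginv1 gmul1.
  - move=> x y hx hy u hu; rewrite ginvM !gmulAr.
    by split; [apply: (proj1 (hx _ _)); case: (hy u hu) | apply: (proj2 (hy _ _)); case: (hx u hu)].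
  - by move=> x hx u hu; rewrite ginvK; case: (hx u hu).
have gQ x : (exists b, S b x) -> forall u, Q u -> Q (x * u) /\ Q (x^-1 * u).
  by move=> [b hb] u hu; split; apply: QS hu; [exact: hb | exact: (subV (sideG b))].
have Q1 : Q 1 by exists 1, []; split=> //; split=> //; rewrite /word /=; grp.
have := generated_min sQ gQ (proj1 (proj2 (proj2 (proj2 str))) w).
by move=> /(_ _ Q1) [h _]; rewrite -(gmul1r w).
Qed.

Definition cmul c l := match l with [] => [] | p :: r => (fst p, c * snd p) :: r end.

Lemma word_cmul c l : l <> [] -> word (cmul c l) = c * word l.
Proof. by case: l => //= p l _; rewrite !word_cons /=; grp. Qed.

Lemma red_cmul c l : C c -> red l -> red (cmul c l).
Proof. by case: l => // p l hc h; apply: red_head. Qed.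

(** In a product of two reduced words, [m1] and [m2] cancel up to an element of [C] and nothing more cancels between [l] and [r]. *)
Definition stuck c l r :=
  l = [] \/ r = [] \/ exists l' a b' a' r' b, l = l' ++ [(b, a)] /\ r = (b', a') :: r' /\
    (b <> b' \/ (b = b' /\ ~ C (a * c * a'))).

(** Letters are moved one by one from the end of [l1] and the front of [l2] into [m1] and [m2], as
    long as the product in the middle stays in [C]. *)
Lemma cancellation c l1 l2 : C c -> red l1 -> red l2 ->
  exists l m1 m2 r, l1 = l ++ m1 /\ l2 = m2 ++ r /\ length m1 = length m2 /\
    C (word m1 * c * word m2) /\ stuck (word m1 * c * word m2) l r.
Proof.
move=> hc r1 r2.
suff H l : forall m1 m2 r, l1 = l ++ m1 -> l2 = m2 ++ r -> length m1 = length m2 ->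
    C (word m1 * c * word m2) -> exists l m1 m2 r, l1 = l ++ m1 /\ l2 = m2 ++ r /\
    length m1 = length m2 /\ C (word m1 * c * word m2) /\ stuck (word m1 * c * word m2) l r.
  apply: (H l1 [] [] l2) => //; first by rewrite app_nil_r.
  by rewrite /word /=; grp.
elim/rev_ind: l => [|[b a] l IH] m1 m2 r e1 e2 el hm.
  by exists [], m1, m2, r; do !split=> //; left.
case: r e2 => [|[b' a'] r] e2.
  by exists (l ++ [(b, a)]), m1, m2, []; do !split=> //; right; left.
case: (dec (b = b' /\ C (a * (word m1 * c * word m2) * a'))) => [[eb h]|h].
  apply: (IH ((b, a) :: m1) (m2 ++ [(b', a')]) r).
  - by rewrite e1 -app_assoc.
  - by rewrite e2 -app_assoc.
  - by rewrite length_app /= el; lia.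
  - by move: h; rewrite word_cons word_app /= !grpE /word /= gmul1r; grp.
exists (l ++ [(b, a)]), m1, m2, ((b', a') :: r); do !split=> //.
right; right; exists l, a, b', a', r, b; do !split=> //.
case: (bool_dec b b') => [eb|]; [right; split=> // h' | by left].
by apply: h.
Qed.

End Words.

Local Open Scope general_if_scope.

(** * Insertion of an element centralizing [C] into reduced words *)

Inductive mark := K1 | K2 | K3 | KY | KO.

(* Letters that commute with [C], so that their classes modulo [C] can be read off any reduced word. *)
Record central_letters (W : group) (S : bool -> W -> Prop) (C : W -> Prop) (x1 x2 x3 y : W) : Prop := {
  cl_x1 : S true x1; cl_x2 : S true x2; cl_x3 : S true x3; cl_y : S false y;
  cl_n1 : ~ C x1; cl_n2 : ~ C x2; cl_n3 : ~ C x3; cl_ny : ~ C y;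
  cl_11 : x1 * x1 = 1; cl_22 : x2 * x2 = 1; cl_33 : x3 * x3 = 1; cl_yy : y * y = 1;
  cl_12 : x1 * x2 = x3;
  cl_c1 : forall c, C c -> x1 * c = c * x1; cl_c2 : forall c, C c -> x2 * c = c * x2;
  cl_c3 : forall c, C c -> x3 * c = c * x3; cl_cy : forall c, C c -> y * c = c * y }.

Section Marks.
Variables (W : group) (S : bool -> W -> Prop) (C : W -> Prop) (x1 x2 x3 y : W).
Hypothesis str : amalgam_structure S C.
Hypothesis cl : central_letters S C x1 x2 x3 y.
Let red := reduced S C.
Implicit Types (l m r : list (bool * W)) (p q : bool * W) (c w : W) (k : mark).

Let CG : is_subgroup C := coreG str.

(** The value at [KO] is a dummy that keeps [lett_comm] and [lett_sq] valid for every mark. *)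
Definition lett k : W := match k with K1 => x1 | K2 => x2 | K3 => x3 | KY => y | KO => 1 end.
Definition mletter k : bool * W := (match k with KY => false | _ => true end, lett k).

(** The special letters are involutions, so lying in the coset of [x1] is tested by multiplying with
    [x1]. All other letters are marked [KO]. *)
Definition mark_of p : mark :=
  if fst p then
    if dec (C (snd p * x1)) then K1 else if dec (C (snd p * x2)) then K2 else
    if dec (C (snd p * x3)) then K3 else KO
  else if dec (C (snd p * y)) then KY else KO.

Definition marks l := map mark_of l.

Lemma lett_comm k c : C c -> lett k * c = c * lett k.
Proof.
move=> h; case: k => /=; [exact: (cl_c1 cl) | exact: (cl_c2 cl) | exact: (cl_c3 cl) | exact: (cl_cy cl) |].
by grp.
Qed.

Lemma lett_sq k : lett k * lett k = 1.
Proof.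
by case: k => /=; rewrite ?(cl_11 cl) ?(cl_22 cl) ?(cl_33 cl) ?(cl_yy cl) ?gmul1.
Qed.

Lemma lettV k : (lett k)^-1 = lett k.
Proof. by symmetry; apply: ginv_uniq; exact: lett_sq. Qed.

Lemma mark_ofE p k : mark_of p = k -> k <> KO -> C (snd p * lett k).
Proof.
rewrite /mark_of; case: p => -[] a /=; repeat case: dec => //; by move=> *; subst k.
Qed.

Lemma mark_of_mletter k : k <> KO -> mark_of (mletter k) = k.
Proof.
have e21 : x2 * x1 = x3.
  have v1 : x1^-1 = x1 := lettV K1; have v2 : x2^-1 = x2 := lettV K2.
  have v3 : x3^-1 = x3 := lettV K3.
  by rewrite -[in RHS]v3 -(cl_12 cl) ginvM v1 v2.
have e31 : x3 * x1 = x2 by rewrite -e21 gmulAr (cl_11 cl) gmul1r.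
have e32 : x3 * x2 = x1 by rewrite -(cl_12 cl) gmulAr (cl_22 cl) gmul1r.
have C1 : C 1 := sub1 CG.
case: k => // _; rewrite /mark_of /= ?(cl_11 cl) ?(cl_22 cl) ?(cl_33 cl) ?(cl_yy cl) ?e21 ?e31 ?e32.
- by case: dec.
- by case: dec => [/(cl_n3 cl)|_] //; case: dec.
- by case: dec => [/(cl_n2 cl)|_] //; case: dec => [/(cl_n1 cl)|_] //; case: dec.
- by case: dec.
Qed.

Lemma dec_ext (A : Type) (P Q : Prop) (a b : A) : (P <-> Q) ->
  (if dec P then a else b) = (if dec Q then a else b).
Proof. by move=> [h1 h2]; case: dec => hp; case: dec => hq //; [case: hq | case: hp]; auto. Qed.

Lemma mark_ext b a a' : (forall k, C (a * lett k) <-> C (a' * lett k)) ->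
  mark_of (b, a) = mark_of (b, a').
Proof.
move=> h; have h1 := h K1; have h2 := h K2; have h3 := h K3; have hy := h KY.
rewrite /mark_of /=; case: b; last exact: dec_ext.
by rewrite (dec_ext _ _ h1) (dec_ext _ _ h2) (dec_ext _ _ h3).
Qed.

(** Special letters commute with [C], so factors from [C] can be pulled out of the test. Marks
    therefore survive the exchange of elements of [C] between neighbouring letters and depend on the
    group element only. *)
Lemma mark_ofC b a a' c c' : C c -> C c' -> c * a = a' * c' -> mark_of (b, a) = mark_of (b, a').
Proof.
move=> hc hc' e; apply: mark_ext => k.
have E : c * (a * lett k) = a' * lett k * c'.
  by rewrite gmulA e !gmulAr (lett_comm k hc').
split=> h.
  apply: (subMr CG (y := c')) => //; rewrite -E; exact: (subM CG).
by apply: (subMl CG (x := c)) => //; rewrite E; exact: (subM CG).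
Qed.

Lemma mark_ofV b a : mark_of (b, a^-1) = mark_of (b, a).
Proof.
apply: mark_ext => k.
have E u : C (u * lett k) -> C (u^-1 * lett k).
  move=> h; have := subV CG h; rewrite ginvM lettV => h'.
  have := lett_comm k h'; rewrite gmulA lett_sq gmul1 => e.
  by rewrite e gmulAr lett_sq gmul1r.
by split=> /E; rewrite ?ginvK.
Qed.

Lemma marks_app l m : marks (l ++ m) = marks l ++ marks m.
Proof. exact: map_app. Qed.

Lemma marks_winv l : marks (winv l) = rev (marks l).
Proof.
rewrite /marks /winv map_rev map_map; congr rev.
by apply: map_ext => -[b a]; exact: mark_ofV.
Qed.

Lemma marks_ceq c l m : C c -> ceq C c l m -> marks l = marks m.
Proof.
elim: l c m => [|[b a] l IH] c [|[b' a'] m] //= hc [<- [c' [hc' [e h]]]].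
by rewrite (IH _ _ hc' h) (mark_ofC b hc hc' e).
Qed.

Lemma marks_cmul c l : C c -> marks (cmul c l) = marks l.
Proof.
case: l => [//|[b a] l] hc /=; congr cons.
by symmetry; apply: (mark_ofC b hc (sub1 CG)); grp.
Qed.

Lemma red_subst l b a a' : red (l ++ [(b, a)]) -> S b a' -> ~ C a' -> red (l ++ [(b, a')]).
Proof.
move=> + h h'; elim: l => [|p l IH] //=.
move=> [h1 [h2 [h3 /IH h4]]]; do !split=> //.
by case: l h3 {IH h4}.
Qed.

Lemma red_last l b a c : red (l ++ [(b, a)]) -> C c -> red (l ++ [(b, a * c)]).
Proof.
move=> rl hc; have [/= h1 h2] := red_letter (m := []) rl.
apply: (red_subst rl); first by apply: (subM (sideG str b)) => //; exact: (core_side str).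
by move=> h; apply: h2; apply: (subMr CG) h.
Qed.

Section Insertion.
Variables (H : group) (g : W -> H) (ins : list mark -> list mark -> H).
Hypothesis gM : is_hom g.
Hypothesis insC : forall L R c, C c -> ins L R * g c = g c * ins L R.
Hypothesis insV : forall L R, ins R L = (ins L R)^-1.
Hypothesis ins0 : forall L, ins L [] = 1.

(* [ins L R] is inserted in the gap between the reversed list [L] and the list [R] of marks. *)
Fixpoint insert (L : list mark) l (R : list mark) : H :=
  match l with
  | [] => 1
  | p :: r => g (snd p) * (ins (mark_of p :: L) (marks r ++ R) * insert (mark_of p :: L) r R)
  end.

Lemma insert_app L l m R :
  insert L (l ++ m) R = insert L l (marks m ++ R) * insert (rev (marks l) ++ L) m R.
Proof.
elim: l L => [|p l IH] L /=; first by rewrite gmul1.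
by rewrite IH marks_app -!app_assoc; grp.
Qed.

(** Elements of [C] can be pushed through the filled gaps, as the inserted elements commute with
    their images and the marks do not change. This makes [spread] independent of the chosen normal
    form. *)
Lemma insert_ceq c L l m R : C c -> ceq C c l m -> g c * insert L l R = insert L m R.
Proof.
elim: l c m L => [|[b a] l IH] c [|[b' a'] m] L //= hc.
  by move=> ->; rewrite (hom1 gM) gmul1.
move=> [<- [c' [hc' [e h]]]].
rewrite (marks_ceq hc' h) (mark_ofC b hc hc' e) -(IH c' _ _ hc' h).
by rewrite !gmulA -gM e gM !gmulAr (gmulA _ (g c')) -insC //; grp.
Qed.

Definition spread (w : W) : H :=
  let cl := constructive_indefinite_description _ (nf_exists str w) in
  let l := constructive_indefinite_description _ (proj2_sig cl) in
  g (proj1_sig cl) * insert [] (proj1_sig l) [].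

Lemma spreadE c l : C c -> red l -> spread (c * word l) = g c * insert [] l [].
Proof.
rewrite /spread; move=> hc rl; case: constructive_indefinite_description => d hd0 /=.
case: constructive_indefinite_description => m [hd [rm e]] /=.
have hdc : C (d^-1 * c) by apply: (subM CG) => //; exact: (subV CG).
have h : ceq C (d^-1 * c) l m.
  by apply: (nf_uniq str) => //; rewrite gmulAr e gmulKg.
rewrite -(insert_ceq [] [] hdc h) gmulA -gM; congr (g _ * _); grp.
Qed.

Lemma spread_red l : red l -> spread (word l) = insert [] l [].
Proof.
move=> rl; have := spreadE (sub1 CG) rl; by rewrite gmul1 (hom1 gM) gmul1.
Qed.

Lemma spread_C c : C c -> spread c = g c.
Proof. by move=> hc; have := spreadE (l := []) hc I; rewrite /word /= !gmul1r. Qed.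

Lemma spread1 : spread 1 = 1.
Proof. by rewrite (spread_C (sub1 CG)) (hom1 gM). Qed.

(** Reading backwards swaps the two contexts of each gap, which inverts the insertion. The two outer
    factors correct for the ends: [insert] fills the gap after the last letter but not the one
    before the first. *)
Lemma insertV L l R :
  insert R (winv l) L = ins (rev (marks l) ++ L) R * (insert L l R)^-1 * (ins L (marks l ++ R))^-1.
Proof.
elim: l L => [|[b a] l IH] L /=; first by rewrite !grpE.
rewrite -/(winv ((b, a) :: l)) (winv_app [(b, a)] l) insert_app {}IH /= mark_ofV marks_winv rev_involutive.
rewrite -!app_assoc /= gmul1r (homV gM) !grpE.
by rewrite (insV L).
Qed.


Lemma spread_Cr c w : C c -> spread (w * c) = spread w * g c.
Proof.
move=> hc; have [d [l [hd [rl ->]]]] := nf_exists str w.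
elim/rev_ind: l rl => [|[b a] l _] rl.
  by rewrite (spreadE (l := [])) //= /word /= !gmul1r spread_C ?gM //; exact: (subM CG).
have rl' := red_last rl hc.
have -> : d * word (l ++ [(b, a)]) * c = d * word (l ++ [(b, a * c)]).
  by rewrite !word_app /word /=; grp.
rewrite !spreadE // !insert_app /=.
rewrite -(@mark_ofC b a (a * c) 1 c^-1) //; [exact: (sub1 CG) | exact: (subV CG) | by grp |].
by rewrite ins0 gM; grp.
Qed.

Lemma spreadV w : spread w^-1 = (spread w)^-1.
Proof.
have [d [l [hd [rl ->]]]] := nf_exists str w.
rewrite ginvM spread_Cr; first exact: (subV CG).
rewrite -word_winv spread_red; first exact: (red_winv str).
rewrite insertV spreadE // ins0 (homV gM) !app_nil_r.
have -> : ins [] (marks l) = 1 by rewrite insV ins0 ginv1.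
by grp.
Qed.

(** Around a cut, [A] is the left part in reverse and [B] the right part. No gap on either side, nor
    the cut itself, is filled differently when the part beyond the cut is removed. *)
Definition good (A B : list mark) : Prop :=
  (forall X L, A = X ++ L -> ins L (rev X ++ B) = ins L (rev X)) /\
  (forall Y R, B = Y ++ R -> ins (rev Y ++ A) R = ins (rev Y) R).

Lemma insert_goodl (A B L : list mark) l :
  (forall X L, A = X ++ L -> ins L (rev X ++ B) = ins L (rev X)) ->
  A = rev (marks l) ++ L -> insert L l B = insert L l [].
Proof.
move=> h; elim: l L => [//|p l IH] L /=; rewrite -app_assoc /= => e.
by rewrite (IH _ e) app_nil_r; have := h _ _ e; rewrite rev_involutive => ->.
Qed.

Lemma insert_goodr (A B Y : list mark) l :
  (forall Y R, B = Y ++ R -> ins (rev Y ++ A) R = ins (rev Y) R) ->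
  B = Y ++ marks l -> insert (rev Y ++ A) l [] = insert (rev Y) l [].
Proof.
move=> h; elim: l Y => [//|p l IH] Y /= e.
have e' : B = (Y ++ [mark_of p]) ++ marks l by rewrite -app_assoc.
have := IH _ e'; rewrite rev_app_distr /= => ->.
by have := h _ _ e'; rewrite rev_app_distr /= app_nil_r => ->.
Qed.

Lemma insert_cat l m : good (rev (marks l)) (marks m) ->
  insert [] (l ++ m) [] = insert [] l [] * insert [] m [].
Proof.
move=> [h1 h2]; rewrite insert_app !app_nil_r; congr (_ * _).
  by apply: (insert_goodl h1); rewrite app_nil_r.
exact: (insert_goodr (Y := []) h2).
Qed.

Lemma insert1 p : insert [] [p] [] = g (snd p).
Proof. by rewrite /= ins0; grp. Qed.

(** Up to [C], [m2] spells the inverse of [m1]. As [spread] respects inverses and right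
    multiplication by [C], the insertions cancel along with the letters. *)
Lemma spread_cancel c m1 m2 : red m1 -> red m2 -> C c -> C (word m1 * c * word m2) ->
  insert [] m1 [] * g c * insert [] m2 [] = g (word m1 * c * word m2).
Proof.
move=> r1 r2 hc h.
have e : c * word m2 = (word m1)^-1 * (word m1 * c * word m2) by grp.
have := spreadE hc r2; rewrite e spread_Cr // spreadV spread_red // => e2.
by rewrite gmulAr -e2 gmulKVg.
Qed.

End Insertion.

(* Each of the at most three junctions of the cancellation tripod contributes two gaps. *)
Lemma spreadM w1 w2 : exists gs : list (list mark * list mark), length gs <= 6 /\
  forall (H : group) (g : W -> H) (ins : list mark -> list mark -> H),
    is_hom g -> (forall L R c, C c -> ins L R * g c = g c * ins L R) ->
    (forall L R, ins R L = (ins L R)^-1) -> (forall L, ins L [] = 1) ->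
    (forall A B, In (A, B) gs -> good ins A B) ->
    spread g ins (w1 * w2) = spread g ins w1 * spread g ins w2.
Proof.
have [c1 [l1 [hc1 [rl1 ->]]]] := nf_exists str w1.
have [c2 [l2 [hc2 [rl2 ->]]]] := nf_exists str w2.
have [l [m1 [m2 [r [e1 [e2 [_ [hc st]]]]]]]] := cancellation hc2 rl1 rl2.
have rm1 : red m1 by move: rl1; rewrite e1 => /red_r.
have rm2 : red m2 by move: rl2; rewrite e2 => /red_l.
set c := word m1 * c2 * word m2 in hc st.
have E : c1 * word l1 * (c2 * word l2) = c1 * word l * (c * word r).
  by rewrite e1 e2 !word_app /c; grp.
have rr : red r by move: rl2; rewrite e2 => /red_r.
have rl : red l by move: rl1; rewrite e1 => /red_l.
case: (classic (l = [] \/ r = [])) => hn.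
  exists [(rev (marks l), marks m1); (rev (marks m2), marks r)]; split; first by move=> /=; lia.
  move=> H g ins gM insC insV ins0 hg.
  have g1 := hg _ _ (or_introl eq_refl); have g2 := hg _ _ (or_intror (or_introl eq_refl)).
  have K := spread_cancel gM insC insV ins0 rm1 rm2 hc2 hc.
  rewrite E (spreadE gM insC hc1 rl1) (spreadE gM insC hc2 rl2) e1 e2 (insert_cat g g1) (insert_cat g g2).
  have -> : g c1 * (insert g ins [] l [] * insert g ins [] m1 []) *
    (g c2 * (insert g ins [] m2 [] * insert g ins [] r [])) =
    g c1 * insert g ins [] l [] * g c * insert g ins [] r [] by rewrite -K; grp.
  case: hn => ->.
    have -> : c1 * word [] * (c * word r) = c1 * c * word r by rewrite (_ : word [] = 1) //; grp.
    rewrite (spreadE gM insC) //; first exact: (subM CG).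
    by rewrite gM /=; grp.
  have -> : c1 * word l * (c * word []) = c1 * word l * c by rewrite (_ : word [] = 1) //; grp.
  by rewrite spread_Cr // spreadE //= !grpE.
case: st => [h|[h|[l' [a [b' [a' [r' [b [el [er hb]]]]]]]]]]; [by case: hn; left | by case: hn; right |].
have [/= sa na] : S b a /\ ~ C a by move: rl; rewrite el => rl'; have := red_letter rl'.
have [/= sa' na'] : S b' a' /\ ~ C a' by move: rr; rewrite er => rr'; have := red_letter (l := []) rr'.
case: hb => [ne|[eb nc]].
  exists [(rev (marks l), marks m1); (rev (marks m2), marks r); (rev (marks l), marks r)].
  split; first by move=> /=; lia.
  move=> H g ins gM insC insV ins0 hg.
  have g1 := hg _ _ (or_introl eq_refl); have g2 := hg _ _ (or_intror (or_introl eq_refl)).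
  have g3 := hg _ _ (or_intror (or_intror (or_introl eq_refl))).
  have K := spread_cancel gM insC insV ins0 rm1 rm2 hc2 hc.
  have rc : red (l ++ cmul c r).
    rewrite el er -app_assoc; apply: red_cat; first by rewrite -el.
    split=> //; split=> //; split; first by move=> /= e; apply: ne.
    by apply: (@red_cmul _ _ _ str _ ((b', a') :: r')) => //; rewrite -er.
  have wc : word (cmul c r) = c * word r by apply: word_cmul; rewrite er.
  have ic : insert g ins [] (cmul c r) [] = g c * insert g ins [] r [].
    by rewrite -(spread_red gM insC (red_cmul str hc rr)) wc spreadE.
  rewrite E -wc gmulAr -word_app (spreadE gM insC hc1 rc) (spreadE gM insC hc1 rl1) (spreadE gM insC hc2 rl2).
  rewrite insert_cat ?marks_cmul // e1 e2 (insert_cat g g1) (insert_cat g g2) ic.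
  by rewrite -K; grp.
subst b'; set a3 := a * c * a' in nc.
have sa3 : S b a3 by apply: (subM (sideG str b)) => //; apply: (subM (sideG str b)) => //; exact: (core_side str).
(* The letters [a] and [a'] merge into [a3], so each of the two factors and the product is cut
   before and after its central letter, six cuts in all. *)
exists [(rev (marks l'), marks ((b, a) :: m1)); ([mark_of (b, a)], marks m1);
        (rev (marks m2), marks r); ([mark_of (b, a')], marks r');
        (rev (marks l'), marks ((b, a3) :: r')); ([mark_of (b, a3)], marks r')].
split; first by move=> /=; lia.
move=> H g ins gM insC insV ins0 hg.
have g1 := hg _ _ (or_introl eq_refl); have g2 := hg _ _ (or_intror (or_introl eq_refl)).
have g3 := hg _ _ (or_intror (or_intror (or_introl eq_refl))).
have g4 := hg _ _ (or_intror (or_intror (or_intror (or_introl eq_refl)))).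
have g5 := hg _ _ (or_intror (or_intror (or_intror (or_intror (or_introl eq_refl))))).
have g6 := hg _ _ (or_intror (or_intror (or_intror (or_intror (or_intror (or_introl eq_refl)))))).
have K := spread_cancel gM insC insV ins0 rm1 rm2 hc2 hc.
have r3 : red (l' ++ (b, a3) :: r').
  apply: red_cat; first by apply: (red_subst (a := a)) => //; rewrite -el.
  by move: rr; rewrite er => -[_ [_ h]].
have I3 u d : insert g ins [] ((b, d) :: u) [] = insert g ins [] ([(b, d)] ++ u) [] by [].
have w3 : c1 * word l * (c * word r) = c1 * word (l' ++ (b, a3) :: r').
  by rewrite el er !word_app /a3 /word /=; grp.
rewrite E w3 (spreadE gM insC hc1 r3) (spreadE gM insC hc1 rl1) (spreadE gM insC hc2 rl2).
rewrite (insert_cat g g5) I3 (insert_cat g (l := [_]) g6) e1 e2 (insert_cat g g3).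
rewrite el -app_assoc [[(b, a)] ++ m1]/= (insert_cat g g1) I3 (insert_cat g (l := [_]) g2).
rewrite er I3 (insert_cat g (l := [_]) g4) !insert1 //= /a3 (gM (gmul a c)) (gM a) -K; grp.
Qed.

End Marks.

(** * Detecting the pattern [x2 y (x1 y)^j x3] *)

Fixpoint zig (j : nat) : list mark := match j with 0 => [] | S j => K1 :: KY :: zig j end.
(** This is the portion of the pattern to the right of the gap; the gap follows the opening [K2]. *)
Definition pat (j : nat) : list mark := (KY :: zig j) ++ [K3].
Definition starts (p R : list mark) : Prop := exists s, R = p ++ s.

Definition in_run (k : mark) : bool := match k with K1 | KY => true | _ => false end.
Fixpoint run (R : list mark) : nat :=
  match R with k :: r => if in_run k then S (run r) else 0 | [] => 0 end.

Lemma run_app u s : forallb in_run u = true -> run (u ++ s) = length u + run s.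
Proof. by elim: u => [//|k u IH] /=; case: (in_run k) => //= /IH ->. Qed.

Lemma zig_run j : forallb in_run (zig j) = true.
Proof. by elim: j. Qed.

Lemma zig_length j : length (zig j) = (2 * j)%nat.
Proof. by elim: j => [//|j IH] /=; rewrite IH; lia. Qed.

Lemma run_pat j s : run (pat j ++ s) = (2 * j)%nat + 1.
Proof.
rewrite /pat -app_assoc run_app; first by rewrite /= zig_run.
by rewrite /= zig_length; lia.
Qed.

Lemma forallb_rev (A : Type) (f : A -> bool) l : forallb f l = true -> forallb f (rev l) = true.
Proof. move=> /forallb_forall h; apply/forallb_forall => x hx; apply: h; exact/(proj2 (in_rev _ _)). Qed.

Lemma starts_head j R : starts (pat j) R -> match R with KY :: _ => True | _ => False end.
Proof. by move=> [s ->]. Qed.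

Section Pattern.
Variables (H : group) (j : nat) (M : H).
Implicit Types L R X A B : list mark.

(** The second test recognises the pattern read backwards, as it occurs in inverse words. No gap
    passes both tests, because the pattern begins with [KY] and not with [K2]. *)
Definition pins L R : H :=
  if dec ((exists L', L = K2 :: L') /\ starts (pat j) R) then M
  else if dec ((exists R', R = K2 :: R') /\ starts (pat j) L) then M^-1 else 1.

Lemma pins0 L : pins L [] = 1.
Proof.
by rewrite /pins; case: dec => [[_ /starts_head]|_] //; case: dec => [[[R e] _]|].
Qed.

Lemma pinsV L R : pins R L = (pins L R)^-1.
Proof.
rewrite /pins; have n12 : (exists R', R = K2 :: R') -> starts (pat j) R -> False by move=> [R' ->] /starts_head.
case: dec => [[h1 h2]|n1].
  case: dec => [[h3 h4]|n2]; first by case: n12.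
  by rewrite ginvK.
by case: dec => _; rewrite ?ginv1.
Qed.

Lemma pins_triv L R : (forall L', L <> K2 :: L') -> (forall R', R <> K2 :: R') -> pins L R = 1.
Proof.
move=> hL hR; rewrite /pins; case: dec => [[[L' e] _]|_]; first by case: (hL _ e).
by case: dec => [[[R' e] _]|_] //; case: (hR _ e).
Qed.

Lemma pins_short L R : length L + length R < (2 * j)%nat + 2 -> pins L R = 1.
Proof.
have lp : length (pat j) = (2 * j)%nat + 2 by rewrite /pat length_app /= zig_length; lia.
rewrite /pins; case: dec => [[_ [s ->]]|_]; first by rewrite length_app; lia.
by case: dec => [[_ [s ->]]|_] //; rewrite length_app; lia.
Qed.

(* An occurrence of the pattern across a gap determines [j] from the unmarked stretch around the gap. *)
Lemma pins_cross A B X L : A = X ++ L -> run A + run B <> (2 * j)%nat + 1 ->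
  pins L (rev X ++ B) = pins L (rev X).
Proof.
move=> eA hr; rewrite /pins.
case: dec => [[[L' eL] [s es]]|n1].
  case: dec => [//|n1]; exfalso; apply: hr.
  have [[s' [e1 e2]]|[t [e1 e2]]] : (exists t, rev X = pat j ++ t /\ s = t ++ B) \/
      (exists t, pat j = rev X ++ t /\ B = t ++ s).
    have [t [[e1 e2]|[e1 e2]]] := @app_eq_app _ _ _ _ _ es; [by left; exists t | by right; exists t].
    by case: n1; split; [exists L' | exists s'].
  (* The pattern ends beyond the cut. Its part [X] in [A] is a run stopped by [K2], and [t] is a run
     in [B] stopped by the closing [K3]; together they have [2 j + 1] marks. *)
  have nt : t <> [].
    by move=> et; case: n1; split; [exists L' | exists []; rewrite e1 et !app_nil_r].
  have [t0 [k et]] := exists_last nt; subst t.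
  rewrite /pat app_assoc in e1; have [e1' ek] := app_inj_tail _ _ _ _ e1; clear e1; rename e1' into e1.
  have : forallb in_run (rev X ++ t0) = true by rewrite -e1 /= zig_run.
  rewrite forallb_app => /andb_prop [/forallb_rev hX ht]; rewrite rev_involutive in hX.
  have := f_equal (@length _) e1; rewrite /= zig_length length_app length_rev => el.
  rewrite eA eL e2 run_app //. rewrite -app_assoc run_app //. rewrite -ek /=. lia.
have n1' : ~ ((exists L', L = K2 :: L') /\ starts (pat j) (rev X)).
  by move=> [h [s e]]; apply: n1; split=> //; exists (s ++ B); rewrite e -app_assoc.
case: (dec (_ /\ starts (pat j) (rev X))) => [h|_]; first by case: n1'.
case: dec => [[[R' eR] [s es]]|n2].
  case: dec => [//|n3]; exfalso; apply: hr; case: X eA eR n3 {n1 n1'} => [|k X] /= eA eR n3.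
    by rewrite eA es run_pat eR /=; lia.
  exfalso; apply: n3; split; last by exists s.
  by case: (rev X) eR => [|k' r] /= [-> _]; eauto.
case: dec => [[[R' eR] h]|//]; exfalso; apply: n2; split=> //.
by rewrite eR /=; eauto.
Qed.

Lemma pins_good A B : run A + run B <> (2 * j)%nat + 1 -> good pins A B.
Proof.
move=> hr; split=> [X L e|Y R e]; first exact: (pins_cross e).
rewrite !(pinsV R); congr (_^-1); apply: (pins_cross e); lia.
Qed.

End Pattern.

(** The pattern for [i], with a further [y] so that sides still alternate when blocks are put
    together. *)
Definition block (i : nat) : list mark := K2 :: KY :: zig i ++ [K3; KY].
Definition blocks (i n : nat) : list mark := flat_map block (seq i n).

Definition is_a (k : mark) : bool := match k with KY => false | _ => true end.

Fixpoint alt (ks : list mark) : Prop :=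
  match ks with
  | [] => True
  | k :: r => k <> KO /\ match r with [] => True | k' :: _ => is_a k <> is_a k' end /\ alt r
  end.

Definition head_a (ks : list mark) : Prop := match ks with KY :: _ => False | _ => True end.

Lemma alt_zig i s : alt s -> head_a s -> alt (zig i ++ s) /\ head_a (zig i ++ s).
Proof.
move=> h1 h2; elim: i => [//|i [IH1 IH2]] /=; do !split=> //.
by case: (zig i ++ s) IH2 => // -[].
Qed.

Lemma alt_blocks i n : alt (blocks i n) /\ head_a (blocks i n).
Proof.
elim: n i => [//|n IH] i; have [h1 h2] := IH (S i).
have hz : alt (K3 :: KY :: blocks (S i) n).
  by do !split=> //; case: (blocks (S i) n) h2 => // -[].
have [h3 h4] := @alt_zig i _ hz I.
rewrite /blocks /= -/(blocks (S i) n) -app_assoc; do !split=> //.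
by case: (zig i ++ _) h4 => // -[].
Qed.

Lemma blocksS i n : blocks i (S n) = block i ++ blocks (S i) n.
Proof. by []. Qed.

Section BlockWords.
Variables (W : group) (S : bool -> W -> Prop) (C : W -> Prop) (x1 x2 x3 y : W).
Hypothesis str : amalgam_structure S C.
Hypothesis cl : central_letters S C x1 x2 x3 y.
Let red := reduced S C.
Let mks := marks C x1 x2 x3 y.

Definition letters (ks : list mark) : list (bool * W) := map (mletter x1 x2 x3 y) ks.

Lemma letters_app ks ks' : letters (ks ++ ks') = letters ks ++ letters ks'.
Proof. exact: map_app. Qed.

Lemma marks_letters ks : (forall k, In k ks -> k <> KO) -> mks (letters ks) = ks.
Proof.
elim: ks => [//|k ks IH] h; rewrite /mks /marks /letters /=.
rewrite (mark_of_mletter str cl); first by apply: h; left.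
congr (_ :: _); apply: IH => k' hk'; apply: h; by right.
Qed.

Lemma alt_noKO ks : alt ks -> forall k, In k ks -> k <> KO.
Proof. by elim: ks => [//|k ks IH] /= [h1 [_ /IH h2]] k' [<-|/h2]. Qed.

Lemma letters_red ks : alt ks -> red (letters ks).
Proof.
elim: ks => [//|k ks IH] /= [h1 [h2 /IH h3]].
split; first by case: k h1 {h2} => //= _; [exact: (cl_x1 cl) | exact: (cl_x2 cl) | exact: (cl_x3 cl) | exact: (cl_y cl)].
split; first by case: k h1 {h2} => //= _; [exact: (cl_n1 cl) | exact: (cl_n2 cl) | exact: (cl_n3 cl) | exact: (cl_ny cl)].
by split=> //; case: ks h2 {IH h3} => [//|k' ks] /= ne e; apply: ne; exact: eq_sym e.
Qed.

Lemma letters_comm ks c : C c -> word (letters ks) * c = c * word (letters ks).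
Proof.
move=> hc; elim: ks => [|k ks IH]; first by rewrite /word /=; grp.
rewrite /letters /= word_cons -/(letters ks) /= gmulAr IH !gmulA; congr (_ * _).
exact: (lett_comm cl).
Qed.

Section InsertPattern.
Variables (H : group) (g : W -> H) (j : nat) (M : H).
Hypothesis gM : is_hom g.
Let ins := pins j M.
Let insert := insert C x1 x2 x3 y g ins.

(** A gap can be filled only next to a [K2]. The left context is arbitrary because the gap before
    the first letter is not counted. *)
Lemma insert_triv L R ks : (forall k, In k ks -> k <> KO /\ k <> K2) -> (forall R', R <> K2 :: R') ->
  insert L (letters ks) R = g (word (letters ks)).
Proof.
move=> + hR; elim: ks L => [|k ks IH] L h; first by rewrite /word /= (hom1 gM).
have [n1 n2] := h k (or_introl eq_refl).
have h' k' : In k' ks -> k' <> KO /\ k' <> K2 by move=> hk; apply: h; right.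
rewrite /= -/(letters ks) -/(insert _ _ _) IH // word_cons gM /=; congr (_ * _).
have -> : ins (mark_of C x1 x2 x3 y (mletter x1 x2 x3 y k) :: L) (mks (letters ks) ++ R) = 1; last by rewrite gmul1.
rewrite (mark_of_mletter str cl) // marks_letters; first by move=> k' /h' [].
apply: pins_triv => [L' [e _]|R'] //.
by case: ks h' {IH h} => [|k' ks] h' /= e; [apply: hR e | case: e => e _; case: (h' k') => //; left].
Qed.

Lemma insert_short L R l : length L + length l + length R < (2 * j)%nat + 2 -> insert L l R = g (word l).
Proof.
elim: l L => [|p l IH] L /= h; first by rewrite /word /= (hom1 gM).
rewrite -/insert IH /=; first by lia.
rewrite [ins _ _]pins_short /= ?length_app ?length_map; first by lia.
by rewrite gmul1 word_cons gM.
Qed.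

Definition tail_marks (i : nat) : list mark := KY :: zig i ++ [K3; KY].

Lemma tail_marksP i k : In k (tail_marks i) -> k <> KO /\ k <> K2.
Proof.
have hz : In k (zig i) -> k <> KO /\ k <> K2.
  by elim: i => [//|i IH] /= [<-|[<-|/IH]].
rewrite /tail_marks /= => -[<-|] //; rewrite in_app_iff => -[/hz|] //=.
by move=> [<-|[<-|]].
Qed.

Lemma insert_block i : insert [] (letters (block i)) [] =
  g x2 * ((if dec (i = j) then M else 1) * g (word (letters (tail_marks i)))).
Proof.
have -> : insert [] (letters (block i)) [] =
  g x2 * (ins [mark_of C x1 x2 x3 y (mletter x1 x2 x3 y K2)] (mks (letters (tail_marks i)) ++ []) *
    insert [mark_of C x1 x2 x3 y (mletter x1 x2 x3 y K2)] (letters (tail_marks i)) []) by [].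
rewrite insert_triv //; first exact: tail_marksP.
rewrite (mark_of_mletter str cl) //; congr (_ * (_ * _)).
rewrite marks_letters; first by move=> k /tail_marksP [].
rewrite app_nil_r /ins /pins.
(* The run in [pat j] has length [2 j + 1], so the pattern determines its parameter. *)
have E : starts (pat j) (tail_marks i) <-> i = j.
  split=> [[s e]|->]; last by exists [KY]; rewrite /tail_marks /pat /= -app_assoc.
  have := run_pat j s; rewrite -e (_ : tail_marks i = pat i ++ [KY]) ?run_pat; last by lia.
  by rewrite /tail_marks /pat /= -app_assoc.
case: dec => [[_ /E h]|n]; first by case: dec.
case: dec => [[[R' []]]//|_]; case: dec => // /E h; case: n; split=> //; by exists [].
Qed.

Hypothesis j1 : 1 <= j.

Lemma insert_blocks_cons i n : insert [] (letters (blocks i (Datatypes.S n))) [] =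
  insert [] (letters (block i)) [] * insert [] (letters (blocks (Datatypes.S i) n)) [].
Proof.
rewrite blocksS letters_app; apply: insert_cat.
rewrite -/(mks _) -/(mks (letters (blocks _ _))) !marks_letters.
- by move=> k /= [<-|/tail_marksP []].
- by apply: alt_noKO; case: (alt_blocks (Datatypes.S i) n).
(* On the left of the cut the run is the single closing [y] of the block, on the right it is empty.
   The total 1 differs from [2 j + 1] because [j] is positive. *)
apply: pins_good; have -> : block i = (K2 :: KY :: zig i) ++ [K3; KY] by [].
rewrite rev_app_distr /=; case: n => [|n] /=; lia.
Qed.

Lemma insert_blocks_out i n : j < i \/ i + n <= j ->
  insert [] (letters (blocks i n)) [] = g (word (letters (blocks i n))).
Proof.
elim: n i => [|n IH] i h; first by rewrite /word /= (hom1 gM).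
rewrite insert_blocks_cons IH; first by lia.
rewrite blocksS letters_app word_app gM insert_block; congr (_ * _).
by case: dec => e; [lia | rewrite gmul1 -gM].
Qed.

Lemma insert_blocks_in i n1 n2 : i + n1 = j ->
  insert [] (letters (blocks i (n1 + Datatypes.S n2))) [] =
  g (word (letters (blocks i n1)) * x2) * M *
  g (word (letters (tail_marks j)) * word (letters (blocks (Datatypes.S j) n2))).
Proof.
elim: n1 i => [|n1 IH] i e.
  have -> : i = j by lia.
  rewrite insert_blocks_cons insert_blocks_out; first by lia.
  rewrite insert_block; case: dec => // _.
  by rewrite !gM /word /= (hom1 gM); grp.
rewrite [Datatypes.S n1 + _]/= insert_blocks_cons IH; first by lia.
rewrite insert_block; case: dec => ej; first by lia.
by rewrite blocksS letters_app word_app [word (letters (block i))]/word /= !gM; grp.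
Qed.

End InsertPattern.

Lemma blocks_split i n1 n2 : word (letters (blocks i (n1 + Datatypes.S n2))) =
  word (letters (blocks i n1)) * x2 *
  (word (letters (tail_marks (i + n1))) * word (letters (blocks (Datatypes.S (i + n1)) n2))).
Proof.
elim: n1 i => [|n1 IH] i.
  by rewrite Nat.add_0_r [0 + Datatypes.S n2]/= blocksS letters_app word_app /word /=; grp.
rewrite [Datatypes.S n1 + _]/= !blocksS !letters_app !word_app IH.
by rewrite -Nat.add_succ_comm; grp.
Qed.
End BlockWords.

(** * Adjoining an element that centralizes [C] *)

(** This describes the HNN extension of [W] whose stable letter [v] acts trivially on [C].
    Uniqueness of the extended homomorphism follows from generation. *)
Record central_extension (W : group) (C : W -> Prop) (G : group) (g : W -> G) (v : G) : Prop := {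
  ce_hom : is_hom g;
  ce_comm : forall c, C c -> v * g c = g c * v;
  ce_gen : forall x, generated (fun z => (exists w, g w = z) \/ v = z) x;
  ce_ext : forall (H : group) (h : W -> H) (u : H), is_hom h ->
    (forall c, C c -> u * h c = h c * u) ->
    exists f : G -> H, is_hom f /\ (forall w, f (g w) = h w) /\ f v = u }.

Fixpoint term_products (G : group) (env : nat -> G) (t : term) : list (G * G) :=
  match t with
  | tmul a b => (eval_term env a, eval_term env b) :: term_products env a ++ term_products env b
  | tinv a => term_products env a
  | _ => []
  end.

Fixpoint products (G : group) (env : nat -> G) (f : qf_formula) : list (G * G) :=
  match f with
  | feq a b => term_products env a ++ term_products env b
  | fnot a => products env a
  | fand a b | f_or a b => products env a ++ products env b
  end.

Lemma products_length (G H : group) (e : nat -> G) (e' : nat -> H) f :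
  length (products e f) = length (products e' f).
Proof.
have T t : length (term_products e t) = length (term_products e' t).
  by elim: t => //= a IHa b IHb; rewrite !length_app IHa IHb.
by elim: f => [a b|a IH|a IHa b IHb|a IHa b IHb] //=; rewrite !length_app ?T ?IHa ?IHb.
Qed.

(* Only the finitely many products occurring in a quantifier-free formula matter for its transfer. *)
Section Transfer.
Variables (G H : group) (env : nat -> G) (rho : G -> H).
Hypothesis rho1 : rho 1 = 1.
Hypothesis rhoV : forall x, rho x^-1 = (rho x)^-1.

Lemma eval_transfer t : (forall a b, In (a, b) (term_products env t) -> rho (a * b) = rho a * rho b) ->
  eval_term (fun k => rho (env k)) t = rho (eval_term env t).
Proof.
elim: t => [k|||] //=; last by move=> a IH h; rewrite IH.
move=> a IHa b IHb h; rewrite h; first by left.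
by rewrite IHa ?IHb // => a' b' hab; apply: h; right; rewrite in_app_iff; auto.
Qed.

Lemma qf_transfer f : (forall x y, rho x = rho y -> x = y) ->
  (forall a b, In (a, b) (products env f) -> rho (a * b) = rho a * rho b) ->
  qf_sat (fun k => rho (env k)) f <-> qf_sat env f.
Proof.
move=> rI; elim: f => [a b|a IH|a IHa b IHb|a IHa b IHb] /= h.
- rewrite !eval_transfer; try (by move=> *; apply: h; rewrite in_app_iff; auto).
  by split=> [/rI|->].
- by have := IH h; tauto.
- have h1 := IHa (fun a b i => h a b (proj2 (in_app_iff _ _ _) (or_introl i))).
  by have h2 := IHb (fun a b i => h a b (proj2 (in_app_iff _ _ _) (or_intror i))); tauto.
- have h1 := IHa (fun a b i => h a b (proj2 (in_app_iff _ _ _) (or_introl i))).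
  by have h2 := IHb (fun a b i => h a b (proj2 (in_app_iff _ _ _) (or_intror i))); tauto.
Qed.
End Transfer.

(** Pigeonhole: the candidates for [j] have distinct values [2 j + 1], and there is one more of them
    than there are forbidden values. *)
Lemma avoid (vals : list nat) (J : nat) :
  exists j, J <= j < J + S (length vals) /\ ~ In ((2 * j)%nat + 1) vals.
Proof.
apply: NNPP => h.
pose l := map (fun j => (2 * j)%nat + 1) (seq J (S (length vals))).
have nd : NoDup l.
  apply: FinFun.Injective_map_NoDup; last exact: seq_NoDup.
  by move=> a b; lia.
have inc : incl l vals.
  move=> a /in_map_iff [j [<- /in_seq hj]]; apply: NNPP => n; apply: h; exists j; split=> //.
by have := NoDup_incl_length nd inc; rewrite /l length_map length_seq; lia.
Qed.

Section CentralExtension.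
Variables (W : group) (S : bool -> W -> Prop) (C : W -> Prop) (x1 x2 x3 y : W).
Hypothesis str : amalgam_structure S C.
Hypothesis cl : central_letters S C x1 x2 x3 y.
Variables (G : group) (g : W -> G) (v : G).
Hypothesis ext : central_extension C g v.
Let gM : is_hom g := ce_hom ext.

(* With [t] split as [tl * tr] inside a pattern that no product of the list cuts, [tl^-1 v tr^-1] is inserted at the occurrences of that pattern: this turns [t] into [v] and is undone by [f]. *)
Lemma spreading (N J : nat) : 1 <= J -> exists t, (forall c, C c -> t * c = c * t) /\
  forall f : G -> W, is_hom f -> (forall w, f (g w) = w) -> f v = t ->
  forall prs : list (W * W), length prs <= N ->
  exists rho : W -> G, rho 1 = 1 /\ (forall w, rho w^-1 = (rho w)^-1) /\
    (forall w, f (rho w) = w) /\ rho t = v /\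
    (forall a b, In (a, b) prs -> rho (a * b) = rho a * rho b) /\
    (forall c l, C c -> reduced S C l -> length l < (2 * J)%nat + 2 -> rho (c * word l) = g (c * word l)).
Proof.
(* Each product forbids at most six values of [j], so among [6 N + 1] blocks one parameter remains
   allowed. *)
move=> J1; pose L := letters x1 x2 x3 y; pose n := (6 * N)%nat.
exists (word (L (blocks J (Datatypes.S n)))); split; first by move=> c; exact: (letters_comm cl).
move=> f fM fg fv prs hprs.
have [gs [hgs gsP]] : exists gs : list (list mark * list mark), length gs <= (6 * length prs)%nat /\
  forall (ins : list mark -> list mark -> G),
    (forall L R c, C c -> ins L R * g c = g c * ins L R) ->
    (forall L R, ins R L = (ins L R)^-1) -> (forall L, ins L [] = 1) ->
    (forall A B, In (A, B) gs -> good ins A B) ->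
    forall a b, In (a, b) prs ->
    spread x1 x2 x3 y str g ins (a * b) = spread x1 x2 x3 y str g ins a * spread x1 x2 x3 y str g ins b.
  elim: prs {hprs} => [|[a b] prs [gs [h1 h2]]]; first by exists [].
  have [gs' [h3 h4]] := spreadM str cl a b.
  exists (gs' ++ gs); split; first by rewrite length_app /=; lia.
  move=> ins H1 H2 H3 H4 a' b' [[<- <-]|hin].
    by apply: h4 => // A B hAB; apply: H4; rewrite in_app_iff; left.
  by apply: h2 => // A B hAB; apply: H4; rewrite in_app_iff; right.
have [j [hj nj]] := avoid (map (fun p => run (fst p) + run (snd p)) gs) J.
rewrite length_map in hj.
have [n1 [n2 [e1 e2]]] : exists n1 n2, J + n1 = j /\ Datatypes.S n = n1 + Datatypes.S n2.
  by exists (j - J), (n - (j - J)); rewrite /n; lia.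
pose tl := word (L (blocks J n1)) * x2.
pose tr := word (L (tail_marks j)) * word (L (blocks (Datatypes.S j) n2)).
have et : word (L (blocks J (Datatypes.S n))) = tl * tr by rewrite e2 blocks_split e1.
pose M := (g tl)^-1 * v * (g tr)^-1; pose ins := pins j M.
have comm_tl c : C c -> tl * c = c * tl.
  by move=> hc; rewrite /tl gmulAr (cl_c2 cl hc) gmulA (letters_comm cl _ hc) gmulAr.
have comm_tr c : C c -> tr * c = c * tr.
  by move=> hc; rewrite /tr gmulAr (letters_comm cl _ hc) gmulA (letters_comm cl _ hc) gmulAr.
have commV (a b : G) : a * b = b * a -> a^-1 * b = b * a^-1.
  by move=> e; apply: (@gmulI _ a); rewrite gmulKVg gmulA e gmulAr gmulVr gmul1r.
have MC c : C c -> M * g c = g c * M.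
  move=> hc; rewrite /M !gmulAr (commV (g tr)); first by rewrite -!gM comm_tr.
  rewrite (gmulA _ v) (ce_comm ext hc) !gmulA; congr (_ * _ * _).
  by apply: commV; rewrite -!gM comm_tl.
have insC A B c : C c -> ins A B * g c = g c * ins A B.
  move=> hc; rewrite /ins /pins; case: dec => _; first exact: MC.
  by case: dec => _; [apply: commV; exact: MC | grp].
have insV A B : ins B A = (ins A B)^-1 by exact: pinsV.
have ins0 A : ins A [] = 1 by exact: pins0.
(* Since [f] sends [v] to [t], the product of [tl] and [tr], it kills [M] and with it every inserted
   element. *)
have fM1 : f M = 1 by rewrite /M !fM !(homV fM) !fg fv et; grp.
have fins A B : f (ins A B) = 1.
  rewrite /ins /pins; case: dec => _ //; case: dec => _; rewrite ?(homV fM) ?fM1 ?ginv1 //.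
  exact: (hom1 fM).
have finsert A l B : f (insert C x1 x2 x3 y g ins A l B) = word l.
  elim: l A => [|p l IH] A /=; first exact: (hom1 fM).
  by rewrite !fM fg fins IH gmul1.
exists (spread x1 x2 x3 y str g ins); split; last split; last split; last split; last split.
- exact: (spread1 str cl gM insC).
- exact: (spreadV str cl gM insC insV ins0).
- move=> w; have [c [l [hc [rl ->]]]] := nf_exists str w.
  by rewrite (spreadE str cl gM insC hc rl) fM fg finsert.
- rewrite (spread_red str cl gM insC); first by apply: (letters_red cl); case: (alt_blocks J (Datatypes.S n)).
  rewrite e2 (insert_blocks_in str cl M gM _ n2 e1) -/L -/tl -/tr; first by lia.
  by rewrite /M; grp.
- apply: gsP => // A B hAB; apply: pins_good => e; apply: nj.
  by apply/in_map_iff; exists (A, B).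
(* A word with fewer than [2 J + 2] letters cannot contain the pattern for any [j] from [J] on, so
   nothing is inserted. *)
- move=> c l hc rl hl; rewrite (spreadE str cl gM insC hc rl) (insert_short C x1 x2 x3 y M gM) /=; last by rewrite gM.
  by lia.
Qed.

Definition glue (e : W + bool) : G :=
  match e with inl w => g w | inr true => v | inr false => v^-1 end.

Lemma glue_exists x : exists es, gprod (map glue es) = x.
Proof.
apply: (@generated_min _ _ (fun x => exists es, gprod (map glue es) = x) _ _ x (ce_gen ext x)).
- split; [|split].
  + by exists [].
  + by move=> _ _ [e1 <-] [e2 <-]; exists (e1 ++ e2); rewrite map_app gprod_app.
  + move=> _ [es <-]; elim: es => [|e es [es' IH]]; first by exists []; rewrite /= ginv1.
    pose e' : W + bool := match e with inl w => inl w^-1 | inr b => inr (negb b) end.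
    exists (es' ++ [e']); rewrite map_app gprod_app IH /= ginvM gmul1r; congr (_ * _).
    by rewrite {}/e'; case: e => [w|[]] /=; rewrite ?(homV gM) ?ginvK.
- move=> _ [[w <-]|<-]; first by exists [inl w]; rewrite /= gmul1r.
  by exists [inr true]; rewrite /= gmul1r.
Qed.

(** If [rho] respects these products, the element spelled by [es] can be rebuilt from its image
    under [f], letter by letter. *)
Fixpoint tail_products (f : G -> W) (es : list (W + bool)) : list (W * W) :=
  match es with
  | [] => []
  | e :: r => (f (glue e), f (gprod (map glue r))) :: tail_products f r
  end.

Lemma nat_bound (A : Type) (F : A -> nat) (l : list A) : exists J, forall a, In a l -> F a <= J.
Proof.
elim: l => [|a l [J h]]; first by exists 0.
by exists (F a + J) => b [<-|/h]; lia.
Qed.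

(** The parameters are specialised by [f], which sends [v] to [t]; witnesses are found in [W] and
    carried back by [rho]. For this, [rho] must also return the specialised parameters to the
    original ones, so their spellings contribute to the list of products. *)
Theorem AE_up n theta : AE_holds W n theta -> AE_holds G n theta.
Proof.
move=> hW xs.
have [es esE] : exists es, forall i, gprod (map glue (es i)) = xs i.
  exists (fun i => proj1_sig (constructive_indefinite_description _ (glue_exists (xs i)))) => i.
  by case: constructive_indefinite_description.
(* The length of some normal form of [w]. The patterns will be longer than all elements of [W] used
   to spell the parameters, so that [rho] agrees with [g] on these. *)
pose len w := epsilon (inhabits 0) (fun k => exists c l, C c /\ reduced S C l /\ w = c * word l /\ length l = k).
have lenE w : exists c l, C c /\ reduced S C l /\ w = c * word l /\ length l = len w.
  apply: (epsilon_spec (inhabits 0) (fun k => exists c l, C c /\ reduced S C l /\ w = c * word l /\ length l = k)).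
  by have [c [l [h1 [h2 h3]]]] := nf_exists str w; exists (length l), c, l.
pose lets := flat_map es (seq 0 n).
have [J hJ] := nat_bound (fun e => match e with inl w => len w | _ => 0 end) lets.
(* The number of products in the formula does not depend on the environment, so it is computed with
   a trivial one before [t] and the witnesses exist. *)
pose N := length (products (fun _ : nat => 1 : W) theta) + length lets.
have [|t [tC ht]] := @spreading N (Datatypes.S J); first by lia.
have [f [fM [fg fv]]] := ce_ext ext (@hom_id W) tC.
have [ys hys] := hW (fun i => f (xs i)).
set env := fun k => _ in hys.
pose prs := products env theta ++ flat_map (fun i => tail_products f (es i)) (seq 0 n).
have hprs : length prs <= N.
  rewrite /prs /N length_app (products_length env (fun _ => 1 : W)) /lets.
  apply: Nat.eq_le_incl; congr (_ + _).
  elim: (seq 0 n) => [//|i l IH] /=; rewrite !length_app IH; congr (_ + _).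
  by elim: (es i) => [//|e r IH'] /=; rewrite IH'.
have [rho [r1 [rV [fr [rt [rM rs]]]]]] := ht f fM fg fv prs hprs.
(* Along the spelling, elements of [W] are short and are sent to their images under [g], while [t]
   is sent back to [v]. *)
have rx i : i < n -> rho (f (xs i)) = xs i.
  move=> hi.
  have h1 a b : In (a, b) (tail_products f (es i)) -> rho (a * b) = rho a * rho b.
    move=> hab; apply: rM; rewrite in_app_iff; right; apply/in_flat_map; exists i.
    by split=> //; apply/in_seq; lia.
  have h2 e : In e (es i) -> match e with inl w => len w | _ => 0 end <= J.
    move=> he; apply: hJ; apply/in_flat_map; exists i; split=> //; apply/in_seq; lia.
  rewrite -esE; elim: (es i) h1 h2 => [|e r IH] h1 h2 /=; first by rewrite (hom1 fM).
  rewrite fM h1 /=; first by left.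
  rewrite IH; [by move=> a b hab; apply: h1; right | by move=> e' he'; apply: h2; right |].
  congr (_ * _); case: e h2 {h1} => [w|[]] h2 /=; last 2 first.
  - by rewrite fv.
  - by rewrite (homV fM) fv rV rt.
  rewrite fg; have [c [l [hc [rl [ew el]]]]] := lenE w; rewrite ew.
  by apply: rs => //; have /= := h2 _ (or_introl eq_refl); lia.
exists (fun k => rho (ys k)).
have -> : (fun k => if k <? n then xs k else rho (ys (k - n))) = fun k => rho (env k).
  apply: functional_extensionality => k; rewrite /env.
  by case: (Nat.ltb_spec k n) => hk //; rewrite rx.
apply/qf_transfer => //.
- by move=> a b e; rewrite -(fr a) e fr.
- by move=> a b hab; apply: rM; rewrite in_app_iff; left.
Qed.

End CentralExtension.

(** * Ping-pong *)

Fixpoint stop (R : list mark) : option mark :=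
  match R with k :: r => if in_run k then stop r else Some k | [] => None end.

Lemma stop_app u s : forallb in_run u = true -> stop (u ++ s) = stop s.
Proof. by elim: u => [//|k u IH] /=; case: (in_run k). Qed.

Lemma run_prefix u s : length u <= run (u ++ s) -> forallb in_run u = true.
Proof. elim: u => [//|k u IH] /=; case: (in_run k) => /= h; [apply: IH |]; lia. Qed.

Section PingPong.
Variables (W : group) (S : bool -> W -> Prop) (C : W -> Prop) (x1 x2 x3 y : W).
Hypothesis str : amalgam_structure S C.
Hypothesis cl : central_letters S C x1 x2 x3 y.
Let red := reduced S C.
Let mks := marks C x1 x2 x3 y.
Let L := letters x1 x2 x3 y.
Let CG : is_subgroup C := coreG str.

Definition has_marks (w : W) (ks : list mark) : Prop :=
  exists c l, C c /\ red l /\ w = c * word l /\ mks l = ks.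

Lemma has_marks_uniq w ks ks' : has_marks w ks -> has_marks w ks' -> ks = ks'.
Proof.
move=> [c [l [hc [rl [e <-]]]]] [d [m [hd [rm [e' <-]]]]].
have hdc : C (d^-1 * c) by apply: (subM CG) => //; exact: (subV CG).
apply: (marks_ceq str cl hdc); apply: (nf_uniq str rl rm hdc).
by rewrite gmulAr -e e' gmulKg.
Qed.

Definition begins (ks : list mark) (w : W) : Prop := exists s, has_marks w (ks ++ s).

Lemma word_marks l : (forall k, In k (mks l) -> k <> KO) -> exists c, C c /\ word l = c * word (L (mks l)).
Proof.
elim: l => [|[b a] l IH] h; first by exists 1; split; [exact: (sub1 CG) | rewrite /word /=; grp].
have [c [hc e]] := IH (fun k i => h k (or_intror i)).
pose k := mark_of C x1 x2 x3 y (b, a).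
have hk : C (a * lett x1 x2 x3 y k) by apply: (mark_ofE (p := (b, a))) => //; apply: h; left.
exists (a * lett x1 x2 x3 y k * c); split; first exact: (subM CG).
rewrite word_cons e /L /mks /= word_cons /= -/k.
rewrite !gmulAr; congr (_ * _); rewrite (gmulA _ c (lett _ _ _ _ _)) -(lett_comm cl _ hc) !gmulA.
by rewrite (lett_sq cl) gmul1.
Qed.

Lemma L_rev ks : L (rev ks) = winv (L ks).
Proof.
rewrite /winv /L /letters map_map map_rev; congr rev.
by apply: map_ext => k; rewrite /mletter /= (lettV cl).
Qed.

Lemma word_L_rev ks : word (L (rev ks)) = (word (L ks))^-1.
Proof. by rewrite L_rev word_winv. Qed.

Definition head_side (b : bool) (l : list (bool * W)) : Prop := exists a r, l = (b, a) :: r.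

(** The letters of [ks] meet [w] from the last one on. The first that is not cancelled stays,
    possibly merged with a letter of [w], and shields all earlier ones. Since the letters are
    involutions, full cancellation consumes an initial segment of [w] with marks [rev ks]. *)
Lemma absorb ks w : red (L ks) -> (forall k, In k ks -> k <> KO) ->
  (exists c l1 l2 c', C c /\ red (l1 ++ l2) /\ w = c * word (l1 ++ l2) /\ mks l1 = rev ks /\
     C c' /\ word (L ks) * w = c' * word l2) \/
  (exists c l, C c /\ red l /\ word (L ks) * w = c * word l /\
     match ks with [] => False | k :: _ => head_side (is_a k) l end).
Proof.
have C1 : C 1 := sub1 CG.
elim: ks => [|k ks IH] rk hk.
  have [c [l [h1 [h2 h3]]]] := nf_exists str w.
  by left; exists c, [], l, c; do !split=> //; rewrite {1}/word /= gmul1.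
have nk : k <> KO by apply: hk; left.
have [sk [ck _]] := rk.
have E : word (L (k :: ks)) * w = lett x1 x2 x3 y k * (word (L ks) * w).
  by rewrite /L /= word_cons; grp.
have Ec c u : C c -> lett x1 x2 x3 y k * (c * u) = c * (lett x1 x2 x3 y k * u).
  by move=> hc; rewrite gmulA (lett_comm cl) //; grp.
have [|k' hk' |H|H] := IH; first by case: rk => _ [_ []].
- by apply: hk; right.
- have [c [l1 [l2 [c' [hc [rl [ew [em [hc' el]]]]]]]]] := H.
  have r2 : red l2 := red_r rl.
  case: l2 rl ew el r2 => [|[b s] l3] rl ew el r2.
    right; exists c', [mletter x1 x2 x3 y k]; do !split=> //; first by rewrite E el Ec.
    by exists (lett x1 x2 x3 y k), [].
  case: (bool_dec b (is_a k)) => [eb|nb]; last first.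
    right; exists c', (mletter x1 x2 x3 y k :: (b, s) :: l3); split=> //; split.
      by split=> //; split=> //; split.
    by split; [rewrite E el Ec | exists (lett x1 x2 x3 y k), ((b, s) :: l3)].
  case: (dec (C (lett x1 x2 x3 y k * s))) => hs.
    left; exists c, (l1 ++ [(b, s)]), l3, (c' * (lett x1 x2 x3 y k * s)).
    rewrite -app_assoc; do 3!split=> //; split; last split.
    + rewrite /mks marks_app -/mks em /=; congr (_ ++ [_]).
      rewrite eb -[in RHS](mark_of_mletter str cl nk).
      apply: (mark_ofC str cl _ C1 (c' := lett x1 x2 x3 y k * s)) => //=.
      by rewrite gmul1 gmulA (lett_sq cl) gmul1.
    + exact: (subM CG).
    + by rewrite E el Ec // word_cons /=; grp.
  right; exists c', ((b, lett x1 x2 x3 y k * s) :: l3); split=> //; split; last split.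
  + case: r2 => /= h1 [h2 h3]; do !split=> //.
    by apply: (subM (sideG str b)) => //; rewrite eb.
  + by rewrite E el Ec // !word_cons /=; grp.
  + by rewrite -eb; exists (lett x1 x2 x3 y k * s), l3.
have [c [l [hc [rl [el hl]]]]] := H.
case: ks rk hl {IH hk H E} el => [//|k' ks] rk [a [r er]] el.
right; exists c, (mletter x1 x2 x3 y k :: l); split=> //; split; last split.
- split=> //; split=> //; split=> //; rewrite er /=.
  by case: rk => _ [_ []].
- by rewrite {1}/L /= word_cons -/(L _) gmulAr el Ec.
- by exists (lett x1 x2 x3 y k), l.
Qed.

Lemma begins_absorb ks w : red (L ks) -> (forall k, In k ks -> k <> KO) -> ~ begins (rev ks) w ->
  exists c l, C c /\ red l /\ word (L ks) * w = c * word l /\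
     match ks with [] => False | k :: _ => head_side (is_a k) l end.
Proof.
move=> h1 h2 h3; case: (absorb w h1 h2) => // -[c [l1 [l2 [c' [hc [rl [ew [em _]]]]]]]].
by case: h3; exists (mks l2), c, (l1 ++ l2); rewrite -em /mks marks_app.
Qed.

(* Left multiplication by a short element changes only a short initial segment. *)
Lemma shift z w cz lz ks : C cz -> red lz -> z = cz * word lz -> has_marks w ks ->
  length lz < length ks -> exists cw s F T d d',
    C cw /\ C d /\ C d' /\ ks = mks s ++ T /\ has_marks (z * w) (mks F ++ T) /\
    length s <= length lz /\ length F <= length lz /\ z * cw * word s = d * word F * d'.
Proof.
move=> hcz rz ez [cw [lw [hcw [rw [ew <-]]]]] hlen; have C1 : C 1 := sub1 CG.
have [l [m1 [m2 [r [e1 [e2 [el [hc st]]]]]]]] := cancellation hcw rz rw.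
set c := word m1 * cw * word m2 in hc st.
have rr : red r by move: rw; rewrite e2 => /red_r.
have rl : red l by move: rz; rewrite e1 => /red_l.
have E : z * w = cz * word l * (c * word r) by rewrite ez ew e1 e2 !word_app /c; grp.
have Ez : z * cw * word m2 = cz * word l * c by rewrite ez e1 word_app /c; grp.
have lm : length m1 <= length lz by rewrite e1 length_app; lia.
move: hlen; rewrite /mks /marks length_map -/(marks C x1 x2 x3 y) -/mks => hlen.
exists cw; case: st => [h|[h|[l' [a [b' [a' [r' [b [el' [er hb]]]]]]]]]].
- subst l; exists m2, [], (mks r), cz, c; do 3!split=> //.
  split; first by rewrite e2; exact: map_app.
  split; first by exists (cz * c), r; do !split=> //; [exact: (subM CG) | rewrite E /word /=; grp].
  by rewrite Ez -el /=; do !split=> //; lia.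
- by exfalso; move: hlen; rewrite e2 h length_app -el /=; lia.
have lr : lw = (m2 ++ [(b', a')]) ++ r' by rewrite e2 er -app_assoc.
have ll : length lz = length l' + 1 + length m1 by rewrite e1 el' !length_app /=; lia.
case: hb => [ne|[eb nc]].
  exists m2, l, (mks r), cz, c; do 3!split=> //.
  split; first by rewrite e2; exact: map_app.
  split.
    exists cz, (l ++ cmul c r); split=> //; split; last split.
    + rewrite el' er -app_assoc; apply: red_cat; first by rewrite -el'.
      have [/= h1 h2] := red_letter (m := []) (eq_ind _ red rl _ el').
      split=> //; split=> //; split; first by move=> /= e; apply: ne.
      by apply: (@red_cmul _ _ _ str _ ((b', a') :: r')) => //; rewrite -er.
    + by rewrite E word_app word_cmul ?er //; grp.
    + by rewrite /mks marks_app (marks_cmul str cl).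
  by do !split=> //; [rewrite -el; lia | rewrite e1 length_app; lia].
subst b'; exists (m2 ++ [(b, a')]), (l' ++ [(b, a * c * a')]), (mks r'), cz, 1; do 3!split=> //.
split; first by rewrite lr; exact: map_app.
have [/= sa _] := red_letter (m := []) (eq_ind _ red rl _ el').
have [/= sa' _] := red_letter (l := []) (eq_ind _ red rr _ er).
split.
  exists cz, ((l' ++ [(b, a * c * a')]) ++ r'); split=> //; split; last split.
  + rewrite -app_assoc; apply: red_cat.
      apply: (red_subst (a := a)) => //; first by rewrite -el'.
      apply: (subM (sideG str b)) => //; apply: (subM (sideG str b)) => //; exact: (core_side str).
    split; last by move: rr; rewrite er => -[_ [_ h]].
    apply: (subM (sideG str b)) => //; apply: (subM (sideG str b)) => //; exact: (core_side str).
  + by rewrite E el' er !word_app /word /=; grp.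
  + exact: map_app.
split; first by rewrite length_app /=; lia.
split; first by rewrite length_app /=; lia.
by rewrite word_app gmulA Ez el' !word_app /word /=; grp.
Qed.

(** Multiplication by [z] replaces an initial segment, which lies inside the run both before and
    after; so the mark ending the run is the same. With equal runs and a common prefix of sufficient
    length, the two segments have the same marks, hence agree modulo [C], and cancelling them leaves
    [z] in [C]. *)
Lemma shift_stop z w cz lz ks ks' : C cz -> red lz -> z = cz * word lz ->
  has_marks w ks -> has_marks (z * w) ks' -> length lz < run ks -> length lz < run ks' ->
  stop ks = stop ks' /\ (run ks = run ks' -> (exists p s s', ks = p ++ s /\ ks' = p ++ s' /\ length lz <= length p) -> C z).
Proof.
move=> hcz rz ez hw hzw h1 h2.
have rle R : run R <= length R by elim: R => [//|k R IH] /=; case: in_run; lia.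
have [|cw [s [F [T [d [d' [hcw [hd [hd' [e [hF [ls [lF E]]]]]]]]]]]]] := shift hcz rz ez hw.
  by have := rle ks; lia.
have e' := has_marks_uniq hzw hF.
have lms : length (mks s) = length s by exact: length_map.
have lmF : length (mks F) = length F by exact: length_map.
have rs : forallb in_run (mks s) = true by apply: (run_prefix (s := T)); rewrite -e; lia.
have rF : forallb in_run (mks F) = true by apply: (run_prefix (s := T)); rewrite -e'; lia.
split; first by rewrite e e' !stop_app.
rewrite e e' !run_app // => er [p [t [t' [e1 [e2 hp]]]]].
have em : mks s = mks F.
  have : firstn (length s) (mks s ++ T) = firstn (length F) (mks F ++ T).
    have -> : length s = length F by lia.
    rewrite e1 e2 !firstn_app.
    by have -> : length F - length p = 0 by lia.
  by rewrite -lms -lmF !firstn_app !Nat.sub_diag !firstn_all /= !app_nil_r.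
have noKO k : In k (mks s) -> k <> KO by move: rs => /forallb_forall h /h; case: k.
have [c1 [hc1 w1]] := word_marks noKO.
have [|c2 [hc2 w2]] := @word_marks F; first by rewrite -em.
move: E; rewrite w1 w2 -em; set X := word (L (mks s)).
have -> : d * (c2 * X) * d' = d * c2 * d' * X by rewrite !gmulAr (letters_comm cl _ hd').
rewrite gmulA => /gmulIr E; apply: (subMr CG (y := cw * c1)); first exact: (subM CG).
rewrite gmulA E; apply: (subM CG) => //; exact: (subM CG).
Qed.

Variable n : nat.

(** [shuttle] drives elements into the zone of words beginning with [ping], its inverse into that of
    [rev pong]. Both zones start with a run of length at least [2 n], ended by the marker [K2] in
    the first and [K3] in the second. *)
Definition ping : list mark := zig n ++ [K2; KY].
Definition pong : list mark := K3 :: KY :: zig n.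
Definition shuttle : W := word (L (ping ++ pong)).

Lemma alt_shuttle : alt (ping ++ pong).
Proof.
have [h _] := @alt_zig n [] I I; rewrite app_nil_r in h.
have h2 : alt (K2 :: KY :: K3 :: KY :: zig n).
  by do !split=> //; case: n h.
by have [h3 _] := @alt_zig n (K2 :: KY :: K3 :: KY :: zig n) h2 I; rewrite /ping /pong -app_assoc.
Qed.

Lemma noKO_ping k : In k ping -> k <> KO.
Proof. by move=> h; apply: (alt_noKO alt_shuttle); rewrite in_app_iff; left. Qed.

Lemma noKO_pong k : In k pong -> k <> KO.
Proof. by move=> h; apply: (alt_noKO alt_shuttle); rewrite in_app_iff; right. Qed.

Lemma red_shuttle : red (L ping ++ L pong).
Proof. by rewrite -letters_app; apply: (letters_red cl); exact: alt_shuttle. Qed.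

(** Unless [w] begins with the inverse of [pong], some letter of [pong] survives and protects [ping]
    from cancellation. *)
Lemma shuttle_ping w : ~ begins (rev pong) w -> begins ping (shuttle * w).
Proof.
move=> h; have rp := red_r red_shuttle.
have [c [l [hc [rl [e [a [r el]]]]]]] := begins_absorb rp noKO_pong h.
exists (mks l), c, (L ping ++ l); split=> //; split; last split.
- have eL : L ping = L (zig n ++ [K2]) ++ [mletter x1 x2 x3 y KY].
    by rewrite /L -(map_app _ _ [KY]) /ping -app_assoc.
  have rL := red_l red_shuttle; rewrite eL in rL; rewrite eL -app_assoc; apply: red_cat => //.
  have [h1 h2] := red_letter (m := []) rL.
  by split=> //; split=> //; split=> //; rewrite el.
- rewrite /shuttle /L (letters_app _ _ _ _ ping pong) !word_app gmulAr -/L e !gmulA.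
  by congr (_ * _); exact: (letters_comm cl).
- by rewrite /mks marks_app -/mks [mks (L ping)](marks_letters str cl) //; exact: noKO_ping.
Qed.

Lemma shuttle_pong w : ~ begins ping w -> begins (rev pong) (shuttle^-1 * w).
Proof.
move=> h; have rp : red (L (rev ping)) by rewrite L_rev; apply: (red_winv str); exact: (red_l red_shuttle).
have nk k : In k (rev ping) -> k <> KO by move/in_rev; rewrite ?rev_involutive; exact: noKO_ping.
have nk' k : In k (rev pong) -> k <> KO by move/in_rev; rewrite ?rev_involutive; exact: noKO_pong.
have [|c [l [hc [rl [e hl]]]]] := begins_absorb (w := w) rp nk; first by rewrite rev_involutive.
have [a [r el]] : head_side false l by move: hl; rewrite /ping rev_app_distr.
exists (mks l), c, (L (rev pong) ++ l); split=> //; split; last split.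
- have eL : L (rev pong) = L (rev (KY :: zig n)) ++ [mletter x1 x2 x3 y K3].
    by rewrite /L -(map_app _ _ [K3]).
  have rL : red (L (rev pong)) by rewrite L_rev; apply: (red_winv str); exact: (red_r red_shuttle).
  rewrite eL in rL; rewrite eL -app_assoc; apply: red_cat => //.
  have [h1 h2] := red_letter (m := []) rL.
  by split=> //; split=> //; split=> //; rewrite el.
- have -> : shuttle^-1 = word (L (rev pong)) * word (L (rev ping)).
    by rewrite !word_L_rev -ginvM /shuttle /L (letters_app _ _ _ _ ping pong) word_app.
  rewrite gmulAr e word_app !gmulA; congr (_ * _); exact: (letters_comm cl).
- by rewrite /mks marks_app -/mks [mks (L _)](marks_letters str cl).
Qed.

Definition short (m : nat) (z : W) : Prop := exists c l, C c /\ red l /\ z = c * word l /\ length l <= m.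

Variable m : nat.
Hypothesis hn : m < n.

Let zone (b : bool) : list mark := if b then ping else rev pong.

Let marker (b : bool) : mark := if b then K2 else K3.

Lemma zoneE b : exists u r, zone b = u ++ marker b :: r /\ forallb in_run u = true /\
  length u = (2 * n)%nat + (if b then 0 else 1%nat).
Proof.
case: b; first by exists (zig n), [KY]; rewrite zig_run zig_length; do !split=> //; lia.
exists (rev (KY :: zig n)), []; do !split=> //; first by apply: forallb_rev; rewrite /= zig_run.
by rewrite length_rev /= zig_length; lia.
Qed.

Lemma run_zone b s : run (zone b ++ s) = (2 * n)%nat + (if b then 0 else 1%nat).
Proof.
have [u [r [-> [hu hl]]]] := zoneE b; rewrite -app_assoc run_app // hl.
by case: b {hl}; rewrite /=; lia.
Qed.

Lemma stop_zone b s : stop (zone b ++ s) = Some (marker b).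
Proof.
have [u [r [-> [hu _]]]] := zoneE b; rewrite -app_assoc stop_app //.
by case: b.
Qed.

(** The run at the head of a zone is longer than [m], so a short factor does not reach the marker
    behind it, which differs between the zones. *)
Lemma no_switch z b w : short m z -> begins (zone b) w -> ~ begins (zone (negb b)) (z * w).
Proof.
move=> [c [l [hc [rl [ez hl]]]]] [s h] [s' h'].
have [] := shift_stop hc rl ez h h'; rewrite ?run_zone; try lia.
by rewrite !stop_zone; case: b {h h'}.
Qed.

Lemma no_return z b w : short m z -> begins (zone b) w -> begins (zone b) (z * w) -> C z.
Proof.
move=> [c [l [hc [rl [ez hl]]]]] [s h] [s' h'].
have [|| _ H] := shift_stop hc rl ez h h'; rewrite ?run_zone; try lia.
apply: H; first by rewrite !run_zone.
exists (zone b), s, s'; do !split=> //.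
by have [u [r [-> [_ hu]]]] := zoneE b; rewrite length_app hu; lia.
Qed.

Lemma short_not_one z b w : short m z -> begins (zone b) w -> z * w <> 1.
Proof.
move=> [c [l [hc [rl [ez hl]]]]] [s h] e.
have hlen : length l < length (zone b ++ s).
  by have [u [r [-> [_ hu]]]] := zoneE b; rewrite !length_app hu; lia.
have [cw [q [F [T [d [d' [_ [_ [_ [e1 [h1 [l1 _]]]]]]]]]]]] := shift hc rl ez h hlen.
have h0 : has_marks 1 [].
  by exists 1, []; do !split=> //; [exact: (sub1 CG) | rewrite /word /=; grp].
rewrite e in h1; have := has_marks_uniq h0 h1.
case: T e1 {h1} => [|t T] e1; last by case: (mks F).
by move: hlen; rewrite e1 app_nil_r /mks /marks length_map; lia.
Qed.

Lemma short_not_begins z b : short m z -> ~ begins (zone b) z.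
Proof.
move=> [c [l [hc [rl [ez hl]]]]] [s h].
have h' : has_marks z (mks l) by exists c, l.
have := f_equal (@length _) (has_marks_uniq h h'); rewrite length_app /mks /marks length_map.
by have [u [r [-> [_ hu]]]] := zoneE b; rewrite length_app hu; lia.
Qed.

Definition vword (H : group) (h : W -> H) (u : H) (l : list (bool * W)) : H :=
  gprod (map (fun p : bool * W => (if fst p then u else u^-1) * h (snd p)) l).

(** Reducedness in the sense of Britton: no element of [C] stands between [v] and its inverse, in
    either order. *)
Fixpoint vreduced (l : list (bool * W)) : Prop :=
  match l with
  | [] => True
  | p :: r => match r with [] => True | q :: _ => fst q <> fst p -> ~ C (snd p) end /\ vreduced r
  end.

Lemma shuttle_zone b w : ~ begins (zone (negb b)) w ->
  begins (zone b) ((if b then shuttle else shuttle^-1) * w).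
Proof. by case: b; [exact: shuttle_ping | exact: shuttle_pong]. Qed.

(** Induction from the right end. Before the next power of [v] is applied, the element must not lie
    in the opposite zone. If the exponents agree, a short factor cannot switch zones; if they
    differ, staying in the zone would put the factor in [C], against reducedness. *)
Lemma ping_pong b z l : vreduced ((b, z) :: l) -> (forall p, In p ((b, z) :: l) -> short m (snd p)) ->
  begins (zone b) (vword (fun w => w) shuttle ((b, z) :: l)).
Proof.
elim: l b z => [|[b' z'] l IH] b z hl hs; have hz := hs _ (or_introl eq_refl); rewrite /vword /= gmulAr.
  by apply: shuttle_zone; rewrite gmul1r; exact: short_not_begins.
have {}IH : begins (zone b') (vword (fun w => w) shuttle ((b', z') :: l)).
  by apply: IH; [case: hl | move=> p hp; apply: hs; right].
apply: shuttle_zone; case: (bool_dec b' b) => [e|ne].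
  by subst b'; apply: no_switch IH.
have -> : negb b = b' by case: b b' ne {hl hs hz IH} => [] [].
move=> h; case: hl => /(_ ne) + _; apply.
exact: no_return hz IH h.
Qed.

End PingPong.

(** * Discrimination of the extension by retractions, and transfer of sentences to [W] *)

Section Discrimination.
Variables (W : group) (S : bool -> W -> Prop) (C : W -> Prop) (x1 x2 x3 y : W).
Hypothesis str : amalgam_structure S C.
Hypothesis cl : central_letters S C x1 x2 x3 y.
Variables (G : group) (g : W -> G) (v : G).
Hypothesis ext : central_extension C g v.
Let gM : is_hom g := ce_hom ext.

Lemma vword_hom (H : group) (f : G -> H) l : is_hom f ->
  f (vword g v l) = vword (fun w => f (g w)) (f v) l.
Proof.
move=> fM; elim: l => [|[b z] l IH]; first exact: (hom1 fM).
rewrite /vword /= !fM; congr (_ * _ * _); last exact: IH.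
by case: b => //; exact: (homV fM).
Qed.

Lemma vword_exists x : exists z l, vreduced C l /\ x = g z * vword g v l.
Proof.
have [es <-] := glue_exists ext x; elim: es => [|e es [z [l [hl IH]]]].
  by exists 1, []; split=> //; rewrite /vword /= (hom1 gM) gmul1.
case: e => [w|b] /=; first by exists (w * z), l; split=> //; rewrite IH gM gmulA.
have main : (forall p r, l = p :: r -> fst p <> b -> ~ C z) -> exists z' l', vreduced C l' /\
    (if b then v else v^-1) * (g z * vword g v l) = g z' * vword g v l'.
  move=> h; exists 1, ((b, z) :: l); split; last by rewrite /vword /= (hom1 gM); grp.
  split=> //; case: l hl h {IH} => // p r _ h; exact: h.
rewrite IH; case: l hl main {IH} => [|[b' z'] r] hl main; first by apply: main.
case: (dec (b' <> b /\ C z)) => [[ne hz]|n]; last first.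
  by apply: main => p q [<- _] /= ne hz; apply: n.
exists (z * z'), r; split; first by case: hl.
have cz : v^-1 * g z * v = g z by rewrite gmulAr -?(ce_comm ext hz) ?gmulKg.
have cz' : v * g z * v^-1 = g z by rewrite (ce_comm ext hz); grp.
rewrite /vword /= gM; case: b b' ne {hl main} => [] [] // _; rewrite !gmulA.
  by rewrite cz'.
by rewrite (gmulAr _ (g z) v) -(ce_comm ext hz); grp.
Qed.

(** Sending [v] to a shuttle whose runs are longer than all factors from [W] in the given elements
    makes ping-pong apply to each of them that involves [v]. The others are fixed by the
    retraction. *)
Theorem discriminating (hs : list G) : exists f : G -> W, is_hom f /\ (forall w, f (g w) = w) /\
  forall h, In h hs -> f h = 1 -> h = 1.
Proof.
have [m hm] : exists m, forall h, In h hs -> exists z l, vreduced C l /\ h = g z * vword g v l /\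
    forall w, In w (z :: map snd l) -> short S C m w.
  elim: hs => [|h hs [m IH]]; first by exists 0.
  have [z [l [hl e]]] := vword_exists h.
  have [m' hm'] : exists m, forall w, In w (z :: map snd l) -> short S C m w.
    elim: (z :: map snd l) => [|w ws [m' IH']]; first by exists 0.
    have [c [k [hc [rk ew]]]] := nf_exists str w.
    exists (m' + length k) => w' [<-|/IH' [c' [k' [h1 [h2 [h3 h4]]]]]].
      by exists c, k; do !split=> //; lia.
    by exists c', k'; do !split=> //; lia.
  have mono k k' w : k <= k' -> short S C k w -> short S C k' w.
    by move=> hk [c [q [h1 [h2 [h3 h4]]]]]; exists c, q; do !split=> //; lia.
  exists (m + m') => h' [<-|/IH [z' [l' [h1 [h2 h3]]]]].
    by exists z, l; split=> //; split=> // w /hm'; apply: mono; lia.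
  by exists z', l'; split=> //; split=> // w /h3; apply: mono; lia.
pose n := Datatypes.S m; have hn : m < n by rewrite /n; lia.
pose u := shuttle x1 x2 x3 y n.
have uC c : C c -> u * c = c * u by exact: (letters_comm cl).
have [f [fM [fg fv]]] := ce_ext ext (@hom_id W) uC.
exists f; split=> //; split=> // h hh fh; have [z [[|[b z'] l] [hl [e hz]]]] := hm _ hh.
  move: fh; rewrite e fM fg (hom1 fM) gmul1r => ->.
  by rewrite /vword /= (hom1 gM) gmul1.
exfalso; move: fh; rewrite e fM fg (vword_hom _ fM) fv.
have -> : vword (fun w => f (g w)) u ((b, z') :: l) = vword (fun w => w) u ((b, z') :: l).
  by rewrite /vword; congr gprod; apply: map_ext => p; rewrite fg.
apply: (short_not_one str cl hn (b := b)); first by apply: hz; left.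
apply: (ping_pong str cl hn hl) => p hp; apply: hz; right; exact: in_map.
Qed.

Fixpoint equations (H : group) (env : nat -> H) (f : qf_formula) : list H :=
  match f with
  | feq a b => [eval_term env a * (eval_term env b)^-1]
  | fnot a => equations env a
  | fand a b | f_or a b => equations env a ++ equations env b
  end.

Lemma eval_hom (H K : group) (f : H -> K) env t : is_hom f ->
  eval_term (fun k => f (env k)) t = f (eval_term env t).
Proof.
move=> fM; elim: t => //= [|a -> b ->|a ->]; by rewrite ?(hom1 fM) ?(homV fM) ?fM.
Qed.

Lemma sat_hom (H K : group) (f : H -> K) env theta : is_hom f ->
  (forall h, In h (equations env theta) -> f h = 1 -> h = 1) ->
  qf_sat (fun k => f (env k)) theta <-> qf_sat env theta.
Proof.
move=> fM; elim: theta => [a b|a IH|a IHa b IHb|a IHa b IHb] /= h.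
- rewrite !eval_hom //; split=> [e|-> //].
  have := h _ (or_introl eq_refl); rewrite fM (homV fM) e gmulVr => /(_ eq_refl) e'.
  by rewrite -(gmul1r (eval_term env a)) -(gmulV _ (eval_term env b)) gmulA e' gmul1.
- by have := IH h; tauto.
- have h1 := IHa (fun a i => h a (proj2 (in_app_iff _ _ _) (or_introl i))).
  by have h2 := IHb (fun a i => h a (proj2 (in_app_iff _ _ _) (or_intror i))); tauto.
- have h1 := IHa (fun a i => h a (proj2 (in_app_iff _ _ _) (or_introl i))).
  by have h2 := IHb (fun a i => h a (proj2 (in_app_iff _ _ _) (or_intror i))); tauto.
Qed.

(** The parameters come from [W] and are fixed by the retraction, so only the witnesses are moved. A
    retraction that kills none of the finitely many quotients of compared terms preserves the truth
    of every equation. *)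
Theorem AE_down n theta : AE_holds G n theta -> AE_holds W n theta.
Proof.
move=> hG xs; have [ys hys] := hG (fun i => g (xs i)).
set env := fun k => _ in hys.
have [f [fM [fg hf]]] := discriminating (equations env theta).
exists (fun k => f (ys k)).
have -> : (fun k => if k <? n then xs k else f (ys (k - n))) = fun k => f (env k).
  apply: functional_extensionality => k; rewrite /env.
  by case: (k <? n); rewrite ?fg.
by apply/sat_hom.
Qed.

Theorem AE_central_extension : AE_equivalent W G.
Proof. by move=> n theta; split; [exact: (AE_up str cl ext) | exact: AE_down]. Qed.

End Discrimination.

(** * Twisted amalgams *)

Definition int_group : group.
Proof.
refine (@Group Z Z.add Z.opp 0%Z _ _ _); by [exact: Z.add_assoc | exact: Z.add_0_l | exact: Z.add_opp_diag_l].
Defined.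

Definition zpow (G : group) (x : G) (k : Z) : G :=
  if (0 <=? k)%Z then gpow x (Z.to_nat k) else (gpow x (Z.to_nat (- k)))^-1.

Lemma zpow_succ (G : group) (x : G) k : zpow x (k + 1) = zpow x k * x.
Proof.
rewrite /zpow; case: (Z.leb_spec 0 k) => hk.
  case: (Z.leb_spec 0 (k + 1)) => h; last by lia.
  have -> : Z.to_nat (k + 1) = S (Z.to_nat k) by lia.
  by rewrite /= gpow_comm.
case: (Z.leb_spec 0 (k + 1)) => h.
  have -> : k = (-1)%Z by lia.
  by change (gpow x 0 = (gpow x 1)^-1 * x); rewrite /= !grpE.
have -> : Z.to_nat (- k) = S (Z.to_nat (- (k + 1))) by lia.
by rewrite /= !grpE.
Qed.

Lemma zpow_add (G : group) (x : G) k l : zpow x (k + l) = zpow x k * zpow x l.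
Proof.
elim/Z.peano_ind: l => [|l IH|l IH]; first by rewrite Z.add_0_r {3}/zpow /=; grp.
  by rewrite -Z.add_1_r Z.add_assoc !zpow_succ IH; grp.
apply: (@gmulIr _ x); rewrite gmulAr -!zpow_succ.
have -> : (k + Z.pred l + 1 = k + l)%Z by lia.
by have -> : (Z.pred l + 1 = l)%Z by lia.
Qed.

Lemma zpow_conj (G : group) (x y : G) k : x * y = y * x -> zpow x k * y = y * zpow x k.
Proof.
move=> e; elim/Z.peano_ind: k => [|k IH|k IH]; first by rewrite /zpow /=; grp.
  by rewrite -Z.add_1_r zpow_succ gmulAr e gmulA IH gmulAr.
apply: (@gmulIr _ x); rewrite !gmulAr -e (gmulA _ (zpow _ _)) -!zpow_succ.
by have -> : (Z.pred k + 1 = k)%Z by lia.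
Qed.

(** The group is the amalgam of [W] with the product of [C] and the integers over [C], and [v]
    generates the integers. *)
Theorem central_extension_exists (W : group) (C : W -> Prop) : is_subgroup C ->
  exists (G : group) (g : W -> G) (v : G), central_extension C g v.
Proof.
move=> CG; pose D := subgroup_group CG.
pose iA (c : D) : W := proj1_sig c; pose iB (c : D) : prod_group D int_group := (c, 0%Z).
have [G [g [jB [[gM [jM [gj U]]] [_ [_ [_ [_ [_ [gen _]]]]]]]]]] : exists (G : group) (g : W -> G)
  (jB : prod_group D int_group -> G), is_amalgam D W (prod_group D int_group) G iA iB g jB /\
    (forall a, g a = 1 -> a = 1) /\ (forall b, jB b = 1 -> b = 1) /\
    amalgam_structure (fun s w => if s : bool then exists a, g a = w else exists b, jB b = w)
      (fun w => exists c, g (iA c) = w).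
  apply: amalgam_exists => //.
  - by move=> [c hc] [d hd]; rewrite /iA /= => e; apply: subset_eq_compat.
  - by move=> c d [].
have JM (c d : D) k l : jB (c, k) * jB (d, l) = jB (c * d, (k + l)%Z) by rewrite -jM.
pose v := jB (1, 1%Z); have Ev k : jB (1, k) = zpow v k.
  elim/Z.peano_ind: k => [|k IH|k IH].
  - exact: (hom1 jM).
  - by rewrite -Z.add_1_r zpow_succ -IH JM gmul1.
  - apply: (@gmulIr _ v); rewrite -zpow_succ JM gmul1.
    by have -> : (Z.pred k + 1 = k)%Z by lia.
have Ej c k : jB (c, k) = g (proj1_sig c) * zpow v k.
  by rewrite -Ev -/(iA c) gj JM gmul1r.
exists G, g, v; split=> //.
- move=> c hc; pose d : D := exist _ c hc.
  by rewrite -[c]/(iA d) gj !JM gmul1 gmul1r Z.add_comm.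
- move=> x; apply: (generated_min _ _ (gen x)); first exact: generated_subgroup.
  move=> z [[] [a <-]]; first by apply: gen_in; left; exists a.
  case: a => c k; rewrite Ej; apply: gen_mul; first by apply: gen_in; left; eexists.
  have hv : generated (fun z => (exists w, g w = z) \/ v = z) v by apply: gen_in; right.
  have hp j : generated (fun z => (exists w, g w = z) \/ v = z) (gpow v j).
    by elim: j => [|j IH] /=; [exact: gen_one | exact: gen_mul].
  by rewrite /zpow; case: (0 <=? k)%Z; [| apply: gen_inv].
- move=> H h u hM hu.
  pose fB (p : prod_group D int_group) : H := h (iA (fst p)) * zpow u (snd p).
  have fM : is_hom fB.
    move=> [c k] [d l]; rewrite /fB /= zpow_add hM !gmulAr; congr (_ * _).
    rewrite !gmulA; congr (_ * _); symmetry; apply: zpow_conj; apply: hu.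
    exact: (proj2_sig d).
  have [|f [f1 [f2 [f3 _]]]] := U H h fB hM fM; first by move=> c; rewrite /fB /= /zpow /=; grp.
  exists f; do !split=> //.
  by rewrite /v f3 /fB /= (hom1 hM) /zpow /=; grp.
Qed.

Definition core_image (C A W : group) (iA : C -> A) (jA : A -> W) (w : W) : Prop := exists c, jA (iA c) = w.

Section Twist.
Variables (C A B : group) (iA iA' : C -> A) (iB : C -> B) (tau : C -> C).
Hypothesis eA : forall c, iA' c = iA (tau c).
Hypothesis tauK : forall c, tau (tau c) = c.
Variables (W W' : group) (jA : A -> W) (jB : B -> W) (kA : A -> W') (kB : B -> W').
Hypothesis am : is_amalgam C A B W iA iB jA jB.
Hypothesis am' : is_amalgam C A B W' iA' iB kA kB.
Variables (n : W) (n' : W').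
Hypothesis nE : forall c, n * jA (iA c) * n^-1 = jA (iA (tau c)).
Hypothesis nE' : forall c, n' * kA (iA' c) * n'^-1 = kA (iA' (tau c)).
Variables (G : group) (g : W -> G) (v : G) (G' : group) (g' : W' -> G') (v' : G').
Hypothesis ext : central_extension (core_image iA jA) g v.
Hypothesis ext' : central_extension (core_image iA' kA) g' v'.

Let gM : is_hom g := ce_hom ext.

Lemma conj_comm (H : group) (x y : H) : x * y * x^-1 = y <-> x * y = y * x.
Proof. by split=> e; [rewrite -{2}e; grp | rewrite e; grp]. Qed.

Lemma v_fix c : v * g (jA (iA c)) * v^-1 = g (jA (iA c)).
Proof. by apply/conj_comm; apply: (ce_comm ext); exists c. Qed.

(** Conjugation by [n] already undoes the twist on [C]. The extra [v], which centralizes [C],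
    provides the freedom needed to make the extended map invertible. *)
Definition cross_map (psi : W' -> G) : Prop :=
  is_hom psi /\ (forall a, psi (kA a) = g (jA a)) /\
  (forall b, psi (kB b) = (v * g n) * g (jB b) * (v * g n)^-1).

Lemma cross_exists : exists psi, cross_map psi.
Proof.
have [jAM [jBM [jj U]]] := am; have [kAM [kBM [kk U']]] := am'.
have [||| psi [h1 [h2 [h3 _]]]] := U' G (fun a => g (jA a)) (fun b => (v * g n) * g (jB b) * (v * g n)^-1).
- exact: (hom_comp jAM gM).
- by move=> x y; rewrite jBM gM; grp.
- move=> c; rewrite eA -jj -v_fix -nE !gM (homV gM); grp.
- by exists psi.
Qed.

(** On [C], both [n] and [psi n'] act as [tau], an involution, and [v] acts trivially. So
    [psi n' * v * g n] centralizes [C], and its inverse is an admissible image of [v']. *)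
Lemma cross_extend psi : cross_map psi -> exists Phi : G' -> G, is_hom Phi /\
  (forall w, Phi (g' w) = psi w) /\ Phi v' = (psi n' * v * g n)^-1.
Proof.
move=> [h1 [h2 h3]]; apply: (ce_ext ext') => // _ [c <-].
rewrite h2 eA; set d := tau c; set s := psi n' * v * g n.
have e : s * g (jA (iA d)) = g (jA (iA d)) * s.
  apply/conj_comm; rewrite /s.
  have -> : psi n' * v * g n * g (jA (iA d)) * (psi n' * v * g n)^-1 =
    psi n' * (v * (g n * g (jA (iA d)) * (g n)^-1) * v^-1) * (psi n')^-1 by grp.
  rewrite -(homV gM) -!gM nE v_fix -h2 -(homV h1) -!h1 /d tauK.
  have e1 : iA c = iA' (tau c) by rewrite eA tauK.
  by rewrite e1 nE' tauK eA h2.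
by apply: (@gmulI _ s); rewrite gmulKVg gmulA e gmulAr gmulVr gmul1r.
Qed.

(** The image of [v'] is chosen such that [Phi] sends [v' * g' n'] to the inverse of [v * g n]. The
    two conjugations on [B] then cancel, and the same cancellation returns [v]. *)
Lemma cross_id psi (Phi : G' -> G) (Psi : W -> G') (Phi' : G -> G') :
  cross_map psi -> is_hom Phi -> (forall w, Phi (g' w) = psi w) ->
  Phi v' = (psi n' * v * g n)^-1 ->
  is_hom Psi -> (forall a, Psi (jA a) = g' (kA a)) ->
  (forall b, Psi (jB b) = (v' * g' n') * g' (kB b) * (v' * g' n')^-1) ->
  is_hom Phi' -> (forall w, Phi' (g w) = Psi w) -> Phi' v = (Psi n * v' * g' n')^-1 ->
  forall x, Phi (Phi' x) = x.
Proof.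
move=> [h1 [h2 h3]] PM P1 P2 QM Q1 Q2 RM R1 R2.
have [jAM [jBM [jj U]]] := am.
have E w : Phi (Psi w) = g w.
  have [|||phi [e1 [_ [_ e4]]]] := U G (fun a => g (jA a)) (fun b => g (jB b)).
  - exact: (hom_comp jAM gM).
  - exact: (hom_comp jBM gM).
  - by move=> c; rewrite jj.
  rewrite (e4 (fun w => Phi (Psi w))); [exact: (hom_comp QM PM) | by move=> a; rewrite Q1 P1 h2 | |].
    by move=> b; rewrite Q2 !PM (homV PM) !PM !P1 P2 h3; grp.
  by rewrite (e4 g).
move=> x; apply: (@hom_ext _ _ (fun x => Phi (Phi' x)) (fun x => x) _ _ _ _ _ (ce_gen ext x)) => //.
  exact: (hom_comp RM PM).
move=> z [[w <-]|<-]; first by rewrite R1 E.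
by rewrite R2 (homV PM) !PM E P1 P2; grp.
Qed.
End Twist.

Theorem twist_isomorphic (C A B : group) (iA iA' : C -> A) (iB : C -> B) (tau : C -> C)
  (W W' : group) (jA : A -> W) (jB : B -> W) (kA : A -> W') (kB : B -> W') (n : W) (n' : W')
  (G : group) (g : W -> G) (v : G) (G' : group) (g' : W' -> G') (v' : G') :
  (forall c, iA' c = iA (tau c)) -> (forall c, tau (tau c) = c) ->
  is_amalgam C A B W iA iB jA jB -> is_amalgam C A B W' iA' iB kA kB ->
  (forall c, n * jA (iA c) * n^-1 = jA (iA (tau c))) ->
  (forall c, n' * kA (iA' c) * n'^-1 = kA (iA' (tau c))) ->
  central_extension (core_image iA jA) g v -> central_extension (core_image iA' kA) g' v' ->
  isomorphic G G'.
Proof.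
move=> eA tauK am am' nE nE' ext ext'.
have eA' c : iA c = iA' (tau c) by rewrite eA tauK.
have [psi hpsi] := cross_exists eA am am' nE ext.
have [Phi [P1 [P2 P3]]] := cross_extend eA tauK nE nE' ext ext' hpsi.
have [Psi hPsi] := cross_exists eA' am' am nE' ext'.
have [Phi' [P4 [P5 P6]]] := cross_extend eA' tauK nE' nE ext' ext hPsi.
have [q1 [q2 q3]] := hPsi; have [q4 [q5 q6]] := hpsi.
exists Phi', Phi; split=> //; split=> //; split=> x.
- by apply: (cross_id am ext hpsi P1 P2 P3 q1 q2 q3 P4 P5 P6).
- by apply: (cross_id am' ext' hPsi P4 P5 P6 q4 q5 q6 P1 P2 P3).
Qed.

Lemma AE_isomorphic (G H : group) : isomorphic G H -> AE_equivalent G H.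
Proof.
have half (G1 H1 : group) n theta (f : G1 -> H1) (k : H1 -> G1) : is_hom f ->
    (forall x, k (f x) = x) -> (forall y, f (k y) = y) -> AE_holds G1 n theta -> AE_holds H1 n theta.
  move=> fM kf fk h xs; have [ys hys] := h (fun i => k (xs i)).
  exists (fun i => f (ys i)); set env := fun k => _ in hys.
  have -> : (fun k => if k <? n then xs k else f (ys (k - n))) = fun k => f (env k).
    by apply: functional_extensionality => i; rewrite /env; case: (i <? n); rewrite ?fk.
  by apply/sat_hom => // x _ e; rewrite -(kf x) e -(hom1 fM) kf.
by move=> [f [k [fM [kM [kf fk]]]]] n theta; split; [apply: half fM kf fk | apply: half kM fk kf].
Qed.

Lemma AE_sym (G H : group) : AE_equivalent G H -> AE_equivalent H G.
Proof. by move=> h n theta; have := h n theta; tauto. Qed.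

Lemma AE_trans (G H K : group) : AE_equivalent G H -> AE_equivalent H K -> AE_equivalent G K.
Proof. by move=> h h' n theta; have := h n theta; have := h' n theta; tauto. Qed.

(** * Isomorphisms between amalgams of finite groups *)

Section FiniteSubgroups.
Variables (W : group) (S : bool -> W -> Prop) (C : W -> Prop).
Hypothesis str : amalgam_structure S C.
Let red := reduced S C.
Let CG : is_subgroup C := coreG str.
Implicit Types (l m : list (bool * W)) (a x w : W) (b : bool).

Lemma word_in_side b l : red l -> S b (word l) -> l = [] \/ exists a, l = [(b, a)].
Proof.
move=> rl h; case: (dec (C (word l))) => hc; first by left; apply: (normal_form str rl).
have r1 : red [(b, word l)] by do !split.
have := nf_uniq str rl r1 (sub1 CG).
rewrite gmul1 {2}/word /= gmul1r => /(_ eq_refl).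
case: l rl h hc r1 => [|[b' a] [|q l]] //= _ _ _ _ [e [c [_ [_ //]]]] _.
by right; exists a; rewrite e.
Qed.

Lemma side_inter b b' x : b <> b' -> S b x -> S b' x -> C x.
Proof.
move=> ne h h'; apply: NNPP => n; have r : red [(b, x)] by do !split.
have := word_in_side (b := b') r; rewrite /word /= gmul1r => /(_ h') [//|[a [e _]]].
by case: ne.
Qed.

Lemma red_conj l b a : red l -> head_not b l -> S b a -> ~ C a -> red (winv l ++ (b, a) :: l).
Proof.
move=> rl hl ha na; apply: red_cat; last by do !split.
case: l rl hl => [|p l] rl hl; first by do !split.
have r := red_winv str rl; rewrite /winv /= in r *; rewrite -app_assoc; apply: red_cat => //.
have [h1 h2] := red_letter (m := []) r.
by do 3!split=> //; move=> e; apply: hl.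
Qed.

Lemma conj_word l a b : word (winv l ++ (b, a) :: l) = (word l)^-1 * a * word l.
Proof. by rewrite word_app word_winv word_cons /=; grp. Qed.

Lemma conj_length l a b : length (winv l ++ (b, a) :: l) = length l + length l + 1.
Proof. by rewrite length_app winv_length /=; lia. Qed.

(** The conjugate is spelled by a reduced word of length [2 * length l + 1], at least three, whereas
    one letter suffices for an element of a side. *)
Lemma conj_not_in_side l b a b' : red l -> l <> [] -> head_not b l -> S b a -> ~ C a ->
  ~ S b' ((word l)^-1 * a * word l).
Proof.
move=> rl nl hl ha na; rewrite -(conj_word l a b) => h.
have := conj_length l a b; case: (word_in_side (red_conj rl hl ha na) h) => [->|[a' ->]] /=.
  by lia.
by case: l nl {rl hl h} => //= *; lia.
Qed.

Lemma short_length k c l : C c -> red l -> short S C k (c * word l) -> length l <= k.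
Proof.
move=> hc rl [d [m [hd [rm [e h]]]]].
have hdc : C (d^-1 * c) by apply: (subM CG) => //; exact: (subV CG).
by rewrite (ceq_length (nf_uniq str rl rm hdc _)) // gmulAr e gmulKg.
Qed.

Lemma short_word k l : red l -> short S C k (word l) -> length l <= k.
Proof. by move=> rl h; apply: (short_length (sub1 CG) rl); rewrite gmul1. Qed.

Lemma word_short k c l d : C c -> C d -> red l -> length l <= k -> 1 <= k ->
  short S C k (c * word l * d).
Proof.
move=> hc hd rl hl k1; elim/rev_ind: l rl hl => [|[b a] l _] rl hl.
  exists (c * d), []; do !split=> //=; [exact: (subM CG) | by rewrite /word /=; grp].
exists c, (l ++ [(b, a * d)]); split=> //; split; first exact: (red_last str rl hd).
split; first by rewrite !word_app /word /=; grp.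
by move: hl; rewrite !length_app.
Qed.

Section FiniteSubgroup.
Variables (F : W -> Prop) (s : W) (b : bool) (l : list (bool * W)).
Hypothesis FG : is_subgroup F.
Hypothesis rl : red ((b, s) :: l).
Hypothesis Fw : F (word ((b, s) :: l)).
Hypothesis Fs : forall w, F w -> short S C (length ((b, s) :: l)) w.

(* Otherwise multiplication by the inverse of the longest element of [F] would produce a longer one. *)
Lemma same_head b' a m : F (word ((b', a) :: m)) -> red ((b', a) :: m) -> b = b' /\ (m <> [] -> C (s^-1 * a)).
Proof.
move=> hF rm; have hp := subM FG (subV FG Fw) hF.
have rs := red_winv str rl; rewrite /winv /= -/(winv l) in rs.
have [/= h1 h2] := red_letter (m := []) rs; have [/= h3 h4] := red_letter (l := []) rm.
case: (bool_dec b' b) => [e|ne]; last first.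
  have r : red (winv l ++ (b, s^-1) :: (b', a) :: m).
    by apply: red_cat => //; do !split=> //; case: rm.
  have /(short_word r) : short S C (length ((b, s) :: l)) (word (winv l ++ (b, s^-1) :: (b', a) :: m)).
    by apply: Fs; move: hp; rewrite -word_winv word_app /winv /= word_app /word /=; grp.
  by rewrite length_app winv_length /=; lia.
subst b'; split=> // nm; apply: NNPP => n.
have r : red (winv l ++ (b, s^-1 * a) :: m).
  apply: red_cat; first by apply: (red_subst rs) => //; exact: (subM (sideG str b)).
  by case: rm => _ [_ [h5 h6]]; do !split=> //; exact: (subM (sideG str b)).
have /(short_word r) : short S C (length ((b, s) :: l)) (word (winv l ++ (b, s^-1 * a) :: m)).
  by apply: Fs; move: hp; rewrite -word_winv word_app /winv /= word_app /word /=; grp.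
by rewrite length_app winv_length /=; case: m nm {hF rm hp r} => //= *; lia.
Qed.

(** Modulo [C], all elements of [F] with more than one letter begin with [s] and, by passing to
    inverses, end with its inverse. So conjugation by [s] removes both end letters. Elements with at
    most one letter lie on side [b] and remain there. *)
Lemma conj_shorter w k : l <> [] -> length ((b, s) :: l) = Datatypes.S k -> F w -> short S C k (s^-1 * w * s).
Proof.
move=> nl ek hw; have k1 : 1 <= k by case: l nl ek => //= *; lia.
have hs : S b s by case: rl.
have [c [m [hc [rm ew]]]] := nf_exists str w.
have inS z : S b z -> short S C k z.
  move=> hz; case: (dec (C z)) => hcz.
    by exists z, []; do !split=> //=; [rewrite /word /=; grp | lia].
  by exists 1, [(b, z)]; do !split=> //; [exact: (sub1 CG) | rewrite /word /=; grp].
case: m rm ew => [|[b' a] m] rm ew.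
  apply: inS; apply: (subM (sideG str b)) => //; apply: (subM (sideG str b)).
    exact: (subV (sideG str b)).
  by rewrite ew /word /= gmul1r; exact: (core_side str).
have rm' : red ((b', c * a) :: m) := red_head str rm hc.
have ew' : w = word ((b', c * a) :: m) by rewrite ew !word_cons /=; grp.
have hw' := hw; rewrite ew' in hw'; have [eb hsa] := same_head hw' rm'; subst b'.
case: (classic (m = [])) => nm.
  apply: inS; apply: (subM (sideG str b)) => //; apply: (subM (sideG str b)).
    exact: (subV (sideG str b)).
  by rewrite ew' nm /word /= gmul1r; case: rm'.
have [q [[b2 a2] em]] := exists_last nm.
have hsa' : C (s^-1 * a2^-1).
  have ri := red_winv str rm'; have hi := subV FG hw'.
  rewrite -word_winv in hi; move: ri hi; rewrite em /winv /= map_app rev_app_distr /= => ri hi.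
  by have [_] := same_head hi ri; apply; case: (rev (map _ q)).
have C1 := hsa nm.
have -> : s^-1 * w * s = s^-1 * (c * a) * word q * (a2 * s).
  by rewrite ew' em word_cons word_app /word /=; grp.
apply: word_short => //.
- by have := subV CG hsa'; grp.
- by case: rm' => _ [_ [_]]; rewrite em => /red_l.
have /(short_word rm') : short S C (length ((b, s) :: l)) (word ((b, c * a) :: m)) by apply: Fs.
by rewrite ek em /= length_app /=; lia.
Qed.
End FiniteSubgroup.

(** Induction on the maximal length: as long as it exceeds one, conjugation by the first letter of a
    longest element reduces it. *)
Lemma bounded_conj k (F : W -> Prop) : is_subgroup F -> (forall w, F w -> short S C k w) ->
  exists b h, forall w, F w -> S b (h^-1 * w * h).
Proof.
elim: k F => [|k IH] F FG Fk.
  exists true, 1 => w /Fk [c [[|p l] [hc [_ [-> /= h]]]]]; last by lia.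
  by rewrite /word /=; grp; exact: (core_side str).
case: (classic (forall w, F w -> short S C k w)) => [h|n]; first exact: IH.
have [w n1] := not_all_ex_not _ _ n.
have [hw {n1}n] := imply_to_and _ _ n1.
have [c [[|[b a] l] [hc [rl [ew hl]]]]] := Fk _ hw.
  by case: n; exists c, []; do !split=> //=; lia.
have rl' : red ((b, c * a) :: l) := red_head str rl hc; set s := c * a in rl'.
have ew' : w = word ((b, s) :: l) by rewrite ew !word_cons /s /=; grp.
have el : length ((b, s) :: l) = Datatypes.S k.
  apply: NNPP => ne; apply: n; exists 1, ((b, s) :: l); do !split=> //; first exact: (sub1 CG).
    by rewrite gmul1.
  by move: hl ne => /=; lia.
(* The maximal length is one. Letters on different sides would give a product of length two, so all
   of [F] lies on one side. *)
case: (classic (l = [])) => nl.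
  exists b, 1 => w' hw'; rewrite ginv1 gmul1 gmul1r.
  have [c' [m [hc' [rm [e' hm]]]]] := Fk _ hw'.
  case: m rm e' hm => [|[b' a'] [|q m]] rm e' hm.
  - by rewrite e' /word /= gmul1r; exact: (core_side str).
  - have rm' : red [(b', c' * a')] := red_head str rm hc'.
    have e2 : w' = word [(b', c' * a')] by rewrite e' /word /=; grp.
    have hF : F (word [(b', c' * a')]) by rewrite -e2.
    have hFw : F (word ((b, s) :: l)) by rewrite -ew'.
    have [|-> _] := same_head FG rl' hFw _ hF rm'; first by rewrite el.
    by rewrite e2 /word /= gmul1r; case: rm'.
  - by move: hm el; rewrite nl /= => h1 h2; lia.
have hFw : F (word ((b, s) :: l)) by rewrite -ew'.
pose F' w := F (s * w * s^-1).
have FG' : is_subgroup F'.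
  split; [|split]; rewrite /F'.
  - by rewrite gmul1r gmulVr; exact: (sub1 FG).
  - by move=> x y hx hy; have := subM FG hx hy; grp.
  - by move=> x hx; have := subV FG hx; grp.
have Fs' : forall w, F w -> short S C (length ((b, s) :: l)) w by rewrite el.
have [w' hw'|b' [h hh]] := IH F' FG'.
  have -> : w' = s^-1 * (s * w' * s^-1) * s by grp.
  exact: (conj_shorter FG rl' hFw Fs' nl el).
exists b', (s * h) => w' hw'.
have -> : (s * h)^-1 * w' * (s * h) = h^-1 * (s^-1 * w' * s) * h by grp.
by apply: hh; rewrite /F'; grp.
Qed.

Theorem finite_subgroup (F : W -> Prop) (L : list W) : is_subgroup F -> (forall w, F w -> In w L) ->
  exists b h, forall w, F w -> S b (h^-1 * w * h).
Proof.
move=> FG FL.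
have [k hk] : exists k, forall w, In w L -> short S C k w.
  elim: L {FL} => [|w L [k IH]]; first by exists 0.
  have [c [l [hc [rl ew]]]] := nf_exists str w.
  exists (k + length l) => w' [<-|/IH [c' [l' [h1 [h2 [h3 h4]]]]]].
    by exists c, l; do !split=> //; lia.
  by exists c', l'; do !split=> //; lia.
by apply: (bounded_conj FG (k := k)) => w /FL /hk.
Qed.

(** Leading letters of [g] on side [b] are stripped, as they preserve that side. A leading letter on
    the other side would turn an element outside [C] into a word of at least three letters. *)
Lemma side_conj b b' g : (forall w, S b w -> S b' (g^-1 * w * g)) -> (exists a, S b a /\ ~ C a) ->
  b = b' /\ S b g.
Proof.
move=> + [a [ha na]]; have [c [l [hc [rl ->]]]] := nf_exists str g.
elim: l c hc rl => [|[d p] l IH] c hc rl h.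
  rewrite {1}/word /= gmul1r; split; last exact: (core_side str).
  apply: NNPP => ne; have hca : S b (c * a * c^-1).
    by apply: (subM (sideG str b)); [apply: (subM (sideG str b)) |] => //; apply: (core_side str) => //; exact: (subV CG).
  have := h _ hca; rewrite /word /= gmul1r; grp => h'.
  by apply: na; exact: side_inter ne ha h'.
have hS : S d p by case: rl.
have rl' : red l by case: rl => _ [_ []].
case: (bool_dec d b) => [e|ne].
  subst d; have hcp : S b (c * p) by apply: (subM (sideG str b)) => //; exact: (core_side str).
  have [|e1 e2] := IH 1 (sub1 CG) rl'; last first.
  - split=> //; rewrite word_cons /= gmulA; apply: (subM (sideG str b)) => //.
    by move: e2; rewrite gmul1.
  - move=> w hw; have hw' : S b (c * p * w * (c * p)^-1).
      apply: (subM (sideG str b)); [exact: (subM (sideG str b)) | exact: (subV (sideG str b))].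
    by have := h _ hw'; rewrite word_cons /=; grp.
exfalso; have hca : S b (c * a * c^-1).
  by apply: (subM (sideG str b)); [apply: (subM (sideG str b)) |] => //; apply: (core_side str) => //; exact: (subV CG).
have := h _ hca.
have -> : (c * word ((d, p) :: l))^-1 * (c * a * c^-1) * (c * word ((d, p) :: l)) =
  (word ((d, p) :: l))^-1 * a * word ((d, p) :: l) by grp.
by apply: (conj_not_in_side rl _ _ ha na).
Qed.

(** Conjugating letter by letter, an element that leaves [C] before the last letter becomes too long
    to lie on a side. At the last letter the result lies on both sides, hence in [C]. *)
Lemma conj_stays l a c : red (l ++ [(true, a)]) -> C c ->
  S false ((word (l ++ [(true, a)]))^-1 * c * word (l ++ [(true, a)])) ->
  C ((word (l ++ [(true, a)]))^-1 * c * word (l ++ [(true, a)])).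
Proof.
elim: l c => [|[d p] l IH] c rl hc h.
  apply: (side_inter (b := true) (b' := false)) => //.
  have ha : S true a by case: rl.
  rewrite /word /= gmul1r; apply: (subM (sideG str true)) => //; apply: (subM (sideG str true)).
    exact: (subV (sideG str true)).
  exact: (core_side str).
set r := l ++ [(true, a)] in rl h IH *.
have hp : S d p by case: rl.
have E : (word ((d, p) :: r))^-1 * c * word ((d, p) :: r) = (word r)^-1 * (p^-1 * c * p) * word r.
  by rewrite word_cons /=; grp.
rewrite [word _]/= -/r E in h *.
have hd : S d (p^-1 * c * p).
  apply: (subM (sideG str d)) => //; apply: (subM (sideG str d)); first exact: (subV (sideG str d)).
  exact: (core_side str).
have rr : red r by case: rl => _ [_ []].
case: (dec (C (p^-1 * c * p))) => hC; first exact: IH.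
exfalso; move: h; apply: (conj_not_in_side rr _ _ hd hC); first by rewrite /r; case: (l).
by case: rl => _ [_ []].
Qed.

End FiniteSubgroups.
Lemma finite_self_map (D T : Type) (e : D -> T) (phi : T -> T) : FinFun.Finite D ->
  (forall d d', e d = e d' -> d = d') ->
  (forall d, exists d', phi (e d) = e d') -> (forall x y, phi x = phi y -> x = y) ->
  forall d, exists d', phi (e d') = e d.
Proof.
move=> fD eI hphi phiI d.
pose f d := proj1_sig (constructive_indefinite_description _ (hphi d)).
have fE d0 : phi (e d0) = e (f d0) by rewrite /f; case: constructive_indefinite_description.
have fI : FinFun.Injective f.
  by move=> a b E; apply: eI; apply: phiI; rewrite !fE E.
have [d' <-] := proj1 (FinFun.Endo_Injective_Surjective fD (fun x y => classic (x = y)) f) fI d.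
by exists d'.
Qed.

(** * Matching the vertex groups under an isomorphism *)

Section Isomorphism.
Variables (W W' : group) (S : bool -> W -> Prop) (C : W -> Prop) (S' : bool -> W' -> Prop) (C' : W' -> Prop).
Hypothesis str : amalgam_structure S C.
Hypothesis str' : amalgam_structure S' C'.
Hypothesis proper : forall b, exists a, S b a /\ ~ C a.
Hypothesis finS : forall b, exists L : list W, forall w, S b w -> In w L.
Hypothesis finS' : forall b, exists L : list W', forall w, S' b w -> In w L.
Hypothesis expS : forall w, S true w -> gpow w 12 = 1.
Hypothesis expS' : forall w, S' true w -> gpow w 12 = 1.
Hypothesis nexpS : exists w, S false w /\ gpow w 12 <> 1.
Hypothesis nexpS' : exists w, S' false w /\ gpow w 12 <> 1.
Variables (D : Type) (e : D -> W) (e' : D -> W').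
Hypothesis finD : FinFun.Finite D.
Hypothesis eI : forall d d', e d = e d' -> d = d'.
Hypothesis eI' : forall d d', e' d = e' d' -> d = d'.
Hypothesis eC : forall w, C w <-> exists d, e d = w.
Hypothesis eC' : forall w, C' w <-> exists d, e' d = w.

Definition bijective_hom (f : W -> W') : Prop :=
  is_hom f /\ exists k, is_hom k /\ (forall x, k (f x) = x) /\ (forall y, f (k y) = y).

Lemma bijective_hom_conj f h : bijective_hom f -> bijective_hom (fun x => h^-1 * f x * h).
Proof.
move=> [fM [k [kM [kf fk]]]]; split; first by move=> x y; rewrite fM; grp.
exists (fun y => k (h * y * h^-1)); split; last split.
- by move=> x y; rewrite -kM; congr k; grp.
- by move=> x; rewrite -{2}(kf x); congr k; grp.
- by move=> y; rewrite fk; grp.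
Qed.

Lemma gpow_conj (G : group) (x h : G) n : gpow (h^-1 * x * h) n = h^-1 * gpow x n * h.
Proof. by elim: n => [|n /= ->]; grp. Qed.

(** The image of a vertex group is finite, hence conjugate into a vertex group, and likewise for the
    inverse map. By [side_conj] the round trip is conjugation by an element of the original vertex
    group, so both inclusions are equalities. The exponent then shows that the side is the same. *)
Lemma vertex_image f b : bijective_hom f -> exists h, forall w, S b w <-> S' b (h^-1 * f w * h).
Proof.
move=> [fM [k [kM [kf fk]]]].
have [b' [h hh]] : exists b' h, forall w, S b w -> S' b' (h^-1 * f w * h).
  have [L hL] := finS b.
  have [||b' [h hh]] := finite_subgroup str' (F := fun y => exists x, S b x /\ f x = y) (L := map f L).
  - exact: (image_subgroup fM (sideG str b)).
  - by move=> _ [x [hx <-]]; apply: in_map; exact: hL.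
  - by exists b', h => w hw; apply: hh; exists w.
have [b2 [h2 hh2]] : exists b2 h2, forall w, S' b' w -> S b2 (h2^-1 * k w * h2).
  have [L hL] := finS' b'.
  have [||b2 [h2 hh2]] := finite_subgroup str (F := fun y => exists x, S' b' x /\ k x = y) (L := map k L).
  - exact: (image_subgroup kM (sideG str' b')).
  - by move=> _ [x [hx <-]]; apply: in_map; exact: hL.
  - by exists b2, h2 => w hw; apply: hh2; exists w.
have [eb hg] : b = b2 /\ S b (k h * h2).
  apply: (side_conj str) (proper b) => w hw.
  have := hh2 _ (hh _ hw); rewrite !kM kf (homV kM); grp.
subst b2.
have conv w : S' b' (h^-1 * f w * h) -> S b w.
  move=> hw; have := hh2 _ hw; rewrite !kM kf (homV kM) => h3.
  have -> : w = k h * h2 * (h2^-1 * ((k h)^-1 * w * k h) * h2) * (k h * h2)^-1 by grp.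
  apply: (subM (sideG str b)); last exact: (subV (sideG str b)).
  exact: (subM (sideG str b)).
suff eb : b = b' by subst b'; exists h => w; split; [exact: hh | exact: conv].
have pw w n : gpow (h^-1 * f w * h) n = 1 <-> gpow w n = 1.
  rewrite gpow_conj -(homX fM); split=> E; last by rewrite E (hom1 fM); grp.
  rewrite -(kf (gpow w n)) -(hom1 kM); congr k.
  have -> : f (gpow w n) = h * (h^-1 * f (gpow w n) * h) * h^-1 by grp.
  by rewrite E; grp.
case: b b' hh conv {hh2 hg} => [] [] // hh conv.
- have [w [hw nw]] := nexpS'; case: nw.
  have ew : w = h^-1 * f (k (h * w * h^-1)) * h by rewrite fk; grp.
  by rewrite ew; apply/pw; apply: expS; apply: conv; rewrite -ew.
- by have [w [hw nw]] := nexpS; case: nw; apply/pw; apply: expS'; exact: hh.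
Qed.

Lemma conj_iff (f : W -> W') b h a : S' b a ->
  (forall w, S b w <-> S' b (h^-1 * f w * h)) ->
  forall w, S b w <-> S' b ((h * a)^-1 * f w * (h * a)).
Proof.
move=> ha hf w; rewrite hf.
have -> : (h * a)^-1 * f w * (h * a) = a^-1 * (h^-1 * f w * h) * a by grp.
have SG := sideG str' b; split=> H.
  by apply: (subM SG) => //; apply: (subM SG) => //; exact: (subV SG).
have -> : h^-1 * f w * h = a * (a^-1 * (h^-1 * f w * h) * a) * a^-1 by grp.
by apply: (subM SG); [exact: (subM SG) | exact: (subV SG)].
Qed.

(** Only the relative position of the two conjugators matters. Factors of it from the true side on
    the left and the false side on the right normalize the respective vertex groups and are
    absorbed. *)
Lemma standard_position f : bijective_hom f -> exists f2 l, bijective_hom f2 /\ reduced S' C' l /\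
  head_not true l /\ (l = [] \/ exists r a, l = r ++ [(true, a)]) /\
  (forall w, S true w <-> S' true (f2 w)) /\
  (forall w, S false w <-> S' false ((word l)^-1 * f2 w * word l)).
Proof.
move=> bf; have [h1 H1] := vertex_image true bf; have [h2 H2] := vertex_image false bf.
have [a [l [ha [rl [hl E]]]]] : exists a l, S' true a /\ reduced S' C' l /\ head_not true l /\ h1^-1 * h2 = a * word l.
  have [c [l [hc [rl E]]]] := nf_exists str' (h1^-1 * h2).
  case: l rl E => [|[[] p] l] rl E.
  - by exists c, []; do !split=> //; exact: (core_side str').
  - exists (c * p), l; case: rl => /= [h3 [_ [h4 h5]]]; do !split=> //.
      by apply: (subM (sideG str' true)) => //; exact: (core_side str').
    by rewrite E word_cons /=; grp.
  - by exists c, ((false, p) :: l); split; [exact: (core_side str') |].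
have [b [l' [hb [rl' [hl' [ll' E']]]]]] : exists b l', S' false b /\ reduced S' C' l' /\ head_not true l' /\
    (l' = [] \/ exists r a, l' = r ++ [(true, a)]) /\ word l = word l' * b.
  elim/rev_ind: l rl hl {E} => [|[[] p] l _] rl hl.
  - by exists 1, []; do !split=> //; [exact: (sub1 (sideG str' false)) | left | rewrite gmul1r].
  - exists 1, (l ++ [(true, p)]); split; first exact: (sub1 (sideG str' false)).
    by do !split=> //; [right; exists l, p | rewrite gmul1r].
  - exists p, l; split; first by case: (red_letter (m := []) rl).
    split; first exact: (red_l rl); split; first by case: l hl {rl}.
    split; last by rewrite word_app /word /= gmul1r.
    elim/rev_ind: l rl {hl} => [|[[] q] l _] rl; [by left | by right; exists l, q |].
    by move: rl; rewrite -app_assoc => rl; case: (red_adj rl).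
have ea : h2 = h1 * a * word l' * b by rewrite gmulAr (gmulAr _ a) -E' -E; grp.
exists (fun x => (h1 * a)^-1 * f x * (h1 * a)), l'; split; first exact: bijective_hom_conj.
do 3!split=> //; split; first exact: conj_iff.
move=> w; have hb' := subV (sideG str' false) hb.
rewrite (conj_iff hb' H2) ea.
have -> : h1 * a * word l' * b * b^-1 = h1 * a * word l' by grp.
by have -> : (h1 * a * word l')^-1 * f w * (h1 * a * word l') =
  (word l')^-1 * ((h1 * a)^-1 * f w * (h1 * a)) * word l' by grp.
Qed.

(** If the relative conjugator [l] is not empty, its first letter [p], on the false side, is out of
    reach: letters on the false side are sent to words of length at least three, and reduced words
    go to reduced words. *)
Theorem iso_preserves_sides f : bijective_hom f -> exists f2, bijective_hom f2 /\
  forall b w, S b w <-> S' b (f2 w).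
Proof.
move=> /standard_position [f2 [l [bf [rl [hl [ll [HT HF]]]]]]].
have [fM [k [kM [kf fk]]]] := bf.
case: l rl hl ll HF => [|p l0] rl hl ll HF.
  exists f2; split=> // -[] w //; rewrite HF.
  by rewrite /word /=; grp.
exfalso; set l := p :: l0 in rl hl ll HF; set g := word l in HF.
have nl : l <> [] by [].
have hp : fst p = false by move: hl => /=; case: (fst p).
have [r [a el]] : exists r a, l = r ++ [(true, a)] by case: ll.
have fI x z : f2 x = f2 z -> x = z by move=> E; rewrite -(kf x) E kf.
(* Such an image lies in the true vertex group and in the conjugate of the false one by [g]. Outside
   [C'] this is excluded by the length of its conjugate. *)
have fC c : C c -> C' (f2 c).
  move=> hc; apply: NNPP => n.
  have h1 : S' true (f2 c) by apply/HT; exact: (core_side str).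
  have h2 : S' false (g^-1 * f2 c * g) by apply/HF; exact: (core_side str).
  exact: (conj_not_in_side str' rl nl hl h1 n h2).
have fC' c' : C' c' -> exists c, C c /\ f2 c = c'.
  (* [C] and [C'] are enumerated by the same finite type, so an injection between them is onto. *)
  move=> /eC' [d <-].
  have kd d0 : exists d', f2 (e d0) = e' d'.
    have /eC' [d' h] : C' (f2 (e d0)) by apply: fC; apply/eC; exists d0.
    by exists d'.
  pose phi d := proj1_sig (constructive_indefinite_description _ (kd d)).
  have phiI x z : phi x = phi z -> x = z.
    rewrite /phi; case: constructive_indefinite_description => x' /= ex.
    case: constructive_indefinite_description => z' /= ez E; apply: eI; apply: fI.
    by rewrite ex ez E.
  have [d' E] := @finite_self_map D D (fun x => x) phi finD (fun _ _ E => E)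
    (fun d0 => ex_intro _ (phi d0) eq_refl) phiI d.
  exists (e d'); split; first by apply/eC; exists d'.
  by rewrite -E /phi; case: constructive_indefinite_description.
(* As all of [C'] comes from [C], conjugation by [g] takes it into the false side, and by
   [conj_stays] into [C']; so [g] normalizes [C']. *)
have gC c' : C' c' -> C' (g^-1 * c' * g).
  move=> /[dup] hc' /fC' [c [hc ec]].
  have hF : S' false (g^-1 * c' * g) by rewrite -ec; apply/HF; exact: (core_side str).
  by move: hF; rewrite /g el; apply: (conj_stays str') => //; rewrite -el.
have gC' c' : C' (g^-1 * c' * g) -> C' c'.
  move=> /eC' [d E].
  have hg d0 : exists d', g^-1 * e' d0 * g = e' d'.
    have /eC' [d' h] : C' (g^-1 * e' d0 * g) by apply: gC; apply/eC'; exists d0.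
    by exists d'.
  have gI x z : g^-1 * x * g = g^-1 * z * g -> x = z by move=> /gmulIr /gmulI.
  have [d' E'] := finite_self_map finD eI' hg gI d.
  by apply/eC'; exists d'; apply: gI; rewrite -E -E'.
(* A true letter is sent to a true letter, a false one to [l], a false letter, and [winv l]. As [l]
   starts with a false letter and ends with a true one, the images join without reduction. *)
have main m : reduced S C m -> exists L, reduced S' C' L /\ f2 (word m) = word L /\
    (forall b, head_not b m -> head_not b L) /\
    ((exists q, In q m /\ fst q = false) -> 3 <= length L).
  elim: m => [|[b x] m IH] rm.
    by exists []; do !split=> //; [rewrite /word /= (hom1 fM) | move=> [q []]].
  have [hx [nx [hm rm']]] : S b x /\ ~ C x /\ head_not b m /\ reduced S C m by case: rm.
  have [L [rL [EL [hL cL]]]] := IH rm'.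
  have nfx : ~ C' (f2 x) by move=> /fC' [c [hc /fI ec]]; apply: nx; rewrite -ec.
  case: b hx hm {rm} => hx hm.
    exists ((true, f2 x) :: L); split; first by split=> /=; [apply/HT | do !split=> //; exact: hL].
    split; first by rewrite !word_cons fM EL.
    split=> // -[q [[<-|hq]]] //= eq.
    by have := cL (ex_intro _ q (conj hq eq)); lia.
  pose z := g^-1 * f2 x * g; have hz : S' false z by apply/HF.
  have nz : ~ C' z by move=> /gC'.
  exists ((l ++ (false, z) :: winv l) ++ L); split; last split; last split.
  - have rlz : reduced S' C' (l ++ [(false, z)]).
      by rewrite el -app_assoc; apply: red_cat; [rewrite -el | do !split=> //; case: (red_letter (m := []) (eq_ind _ (reduced S' C') rl _ el))].
    have -> : (l ++ (false, z) :: winv l) ++ L = l ++ (false, z) :: (winv l ++ L) by rewrite -app_assoc.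
    apply: red_cat => //.
    have ewl : winv l = winv l0 ++ [(false, (snd p)^-1)] by rewrite /l /winv /= hp.
    have rw := red_winv str' rl.
    have rwL : reduced S' C' (winv l ++ L).
      rewrite ewl -app_assoc; apply: red_cat; first by rewrite -ewl.
      have [h1 h2] : S' false (snd p)^-1 /\ ~ C' (snd p)^-1.
        by rewrite ewl in rw; case: (red_letter (m := []) rw).
      by do !split=> //; exact: hL.
    split=> //; split=> //; split=> //.
    by rewrite el winv_app.
  - rewrite word_cons fM EL !word_app word_cons word_winv /= -/g /z; grp.
  - by move=> b /=; rewrite hp.
  - by move=> _; rewrite !length_app /= winv_length /l /=; lia.
(* The preimage of [p] has an image of length one, so it contains no false letter; but then its
   image starts with a true letter, unlike [p]. *)
have [c [m [hc [rm em]]]] := nf_exists str (k (snd p)).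
have [L [rL [EL [hL cL]]]] := main m rm.
have hc' := fC c hc.
have Ep : f2 c * word L = word [p] by rewrite -EL -fM -em fk /word /= gmul1r.
have rp : reduced S' C' [p] by case: rl => h1 [h2 _]; do !split.
have hceq := nf_uniq str' rL rp hc' Ep.
have lL := ceq_length hceq; rewrite /= in lL.
have noF q : In q m -> fst q = true.
  move=> hq; case E: (fst q) => //.
  by have := cL (ex_intro _ q (conj hq E)); lia.
have hLF : head_not false L.
  by apply: hL; case: m noF {rm em EL cL} => [//|q m] /= noF; rewrite noF //; left.
case: L hceq hLF lL {rL EL hL cL Ep} => [//|q L] /= [eq _] h _.
by apply: h; rewrite eq.
Qed.
End Isomorphism.

(** * Coxeter systems *)

(** The universal property gives a map to the subgroup generated by the [s i]. Followed by the
    inclusion it equals the identity by uniqueness. *)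
Lemma coxeter_generated (G : group) (I : Type) (s : I -> G) m : coxeter_system G I s m ->
  forall x, generated (fun y => exists i, s i = y) x.
Proof.
move=> [_ [_ [_ [rel U]]]] x.
pose P := generated (fun y => exists i, s i = y).
have sP : is_subgroup P := generated_subgroup _.
have hs i : P (s i) by apply: gen_in; exists i.
pose K := subgroup_group sP; pose f i : K := exist _ (s i) (hs i).
have inc : is_hom (fun k : K => proj1_sig k) by [].
have incI (k k' : K) : proj1_sig k = proj1_sig k' -> k = k'.
  by case: k k' => [a ha] [b hb] /= e; apply: subset_eq_compat.
have [|phi [phiM [phis _]]] := U K f.
  by move=> i j n /rel h; apply: incI; rewrite (homX inc) /= h.
have [psi [_ [_ uniq]]] := U G s rel.
have e1 := uniq _ (@hom_id G) (fun i => eq_refl) x.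
have e2 := uniq _ (hom_comp phiM inc) (fun i => f_equal (@proj1_sig _ _) (phis i)) x.
have -> : x = proj1_sig (phi x) by rewrite e2; exact: e1.
exact: (proj2_sig (phi x)).
Qed.

Lemma gpow_mul_comm (G : group) (x y : G) : gpow (x * x) 1 = 1 -> gpow (y * y) 1 = 1 ->
  (gpow (x * y) 2 = 1 <-> x * y = y * x).
Proof.
rewrite /= !gmul1r => hx hy.
have ex : x^-1 = x by symmetry; exact: ginv_uniq.
have ey : y^-1 = y by symmetry; exact: ginv_uniq.
split=> h; first by rewrite (ginv_uniq h) ginvM ex ey.
by rewrite {2}h gmulAr (gmulA _ y) hy gmul1.
Qed.

Lemma gpow_mulC (G : group) (x y : G) n : gpow (x * y) n = 1 -> gpow (y * x) n = 1.
Proof.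
move=> h; have -> : y * x = x^-1 * (x * y) * x by grp.
by rewrite gpow_conj h; grp.
Qed.

(** ** Direct products *)

Definition prod_matrix (I J : Type) (m : I -> I -> option nat) (m' : J -> J -> option nat)
    (k l : I + J) : option nat :=
  match k, l with
  | inl i, inl i' => m i i'
  | inr j, inr j' => m' j j'
  | _, _ => Some 2
  end.

Definition prod_gens (G H : group) (I J : Type) (s : I -> G) (t : J -> H) (k : I + J) : prod_group G H :=
  match k with inl i => (s i, 1) | inr j => (1, t j) end.

Lemma gpow_pair (G H : group) (x : G) (y : H) n : gpow ((x, y) : prod_group G H) n = (gpow x n, gpow y n).
Proof. by elim: n => [|n /= ->]. Qed.

Lemma gpow1 (G : group) n : gpow (1 : G) n = 1.
Proof. by elim: n => [|n /= ->]; grp. Qed.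

Lemma coxeter_prod (G H : group) (I J : Type) (s : I -> G) (t : J -> H) m m' :
  coxeter_system G I s m -> coxeter_system H J t m' ->
  coxeter_system (prod_group G H) (I + J) (prod_gens s t) (prod_matrix m m').
Proof.
move=> cG cH; have genG := coxeter_generated cG; have genH := coxeter_generated cH.
have [sym [one [zero [rel U]]]] := cG; have [sym' [one' [zero' [rel' U']]]] := cH.
have sq i : gpow (s i * s i) 1 = 1 by apply: rel; apply/one.
have PM (a a' : G) (b b' : H) : ((a, b) : prod_group G H) * ((a', b') : prod_group G H) = (a * a', b * b') by [].
have sq' j : gpow (t j * t j) 1 = 1 by apply: rel'; apply/one'.
split; [|split; [|split; [|split]]].
- by move=> [i|j] [i'|j'] /=.
- move=> [i|j] [i'|j'] /=; [|by split|by split|].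
    by split=> [/one ->|[<-]] //; apply/one.
  by split=> [/one' ->|[<-]] //; apply/one'.
- by move=> [i|j] [i'|j'] /=.
- move=> [i|j] [i'|j'] n h.
  + by have := rel _ _ _ h; rewrite /prod_gens PM gmul1 gpow_pair gpow1 => ->.
  + case: h => <-; have := sq i; have := sq' j'; rewrite /= !gmul1 !gmul1r => h1 h2.
    by rewrite h1 h2.
  + case: h => <-; have := sq i'; have := sq' j; rewrite /= !gmul1 !gmul1r => h1 h2.
    by rewrite h1 h2.
  + by have := rel' _ _ _ h; rewrite /prod_gens PM gmul1 gpow_pair gpow1 => ->.
move=> K f hf.
have [|phi [phiM [phis uphi]]] := U K (fun i => f (inl i)); first by move=> i i' n h; apply: hf.
have [|psi [psiM [psis upsi]]] := U' K (fun j => f (inr j)); first by move=> j j' n h; apply: hf.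
have comm_gen i j : f (inl i) * f (inr j) = f (inr j) * f (inl i).
  apply/gpow_mul_comm; [by apply: hf; apply/one | by apply: hf; apply/one' | exact: hf].
have sub_comm (z : K) (L : group) (h : L -> K) : is_hom h -> is_subgroup (fun x => h x * z = z * h x).
  move=> hM; split; [|split].
  - by rewrite (hom1 hM); grp.
  - by move=> x y ex ey; rewrite hM gmulAr ey gmulA ex gmulAr.
  - by move=> x ex; rewrite (homV hM); apply: (@gmulI _ (h x)); rewrite gmulKVg gmulA ex gmulAr gmulVr gmul1r.
have comm x y : phi x * psi y = psi y * phi x.
  apply: (generated_min (sub_comm (psi y) _ _ phiM) _ (genG x)) => _ [i <-]; rewrite phis.
  symmetry; apply: (generated_min (sub_comm (f (inl i)) _ _ psiM) _ (genH y)) => _ [j <-].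
  by rewrite psis.
exists (fun p => phi (fst p) * psi (snd p)); split; last split.
- move=> [x y] [x' y'] /=; rewrite phiM psiM !gmulAr; congr (_ * _).
  by rewrite !gmulA comm.
- by move=> [i|j] /=; rewrite ?phis ?psis ?(hom1 phiM) ?(hom1 psiM); grp.
- move=> chi chiM chis [x y] /=.
  have -> : ((x, y) : prod_group G H) = ((x, 1) : prod_group G H) * ((1, y) : prod_group G H).
    by rewrite /= gmul1 gmul1r.
  rewrite chiM; congr (_ * _).
    apply: (uphi (fun x => chi ((x, 1) : prod_group G H))).
      by move=> a b; rewrite -chiM /= gmul1.
    by move=> i; exact: (chis (inl i)).
  apply: (upsi (fun y => chi ((1, y) : prod_group G H))).
    by move=> a b; rewrite -chiM /= gmul1.
  by move=> i; exact: (chis (inr i)).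
Qed.

Lemma finite_prod (G H : group) : finite_group G -> finite_group H -> finite_group (prod_group G H).
Proof. by move=> [l hl] [l' hl']; exists (list_prod l l') => -[x y]; apply/in_prod_iff. Qed.

(** ** Amalgams *)

Lemma special_image (C A : group) (iA : C -> A) (IC I : Type) (gC : IC -> C) (s : I -> A) m (e : IC -> I) :
  is_hom iA -> (forall c c', iA c = iA c' -> c = c') ->
  (forall c, generated (fun y => exists j, gC j = y) c) ->
  coxeter_system A I s m -> (forall j, s (e j) = iA (gC j)) -> special_embedding C A iA.
Proof.
move=> iM iI gen cA es; split=> //; split=> //; exists I, s, m; split=> //.
exists (fun i => exists j, e j = i) => a; split.
  move=> [c <-]; apply: (generated_min (Q := fun c => generated _ (iA c)) _ _ (gen c)).
    split; [|split].
    - by rewrite (hom1 iM); exact: gen_one.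
    - by move=> x y hx hy; rewrite iM; exact: gen_mul.
    - by move=> x hx; rewrite (homV iM); exact: gen_inv.
  by move=> _ [j <-]; apply: gen_in; exists (e j); split; [exists j |].
move=> h; apply: (generated_min (Q := fun a => exists c, iA c = a) _ _ h).
  split; [|split].
  - by exists 1; exact: (hom1 iM).
  - by move=> _ _ [x <-] [y <-]; exists (x * y); exact: iM.
  - by move=> _ [x <-]; exists x^-1; exact: (homV iM).
by move=> _ [_ [[j <-] <-]]; exists (gC j).
Qed.

Section AmalgamCoxeter.
Variables (C A B W : group) (iA : C -> A) (iB : C -> B) (jA : A -> W) (jB : B -> W).
Variables (IC IA IB : Type) (gC : IC -> C) (sA : IA -> A) (sB : IB -> B).
Variables (mA : IA -> IA -> option nat) (mB : IB -> IB -> option nat) (eA : IC -> IA) (eB : IC -> IB).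
Hypothesis am : is_amalgam C A B W iA iB jA jB.
Hypothesis iAM : is_hom iA.
Hypothesis iBM : is_hom iB.
Hypothesis gen : forall c, generated (fun y => exists j, gC j = y) c.
Hypothesis cA : coxeter_system A IA sA mA.
Hypothesis cB : coxeter_system B IB sB mB.
Hypothesis eAI : forall j j', eA j = eA j' -> j = j'.
Hypothesis eBI : forall j j', eB j = eB j' -> j = j'.
Hypothesis esA : forall j, sA (eA j) = iA (gC j).
Hypothesis esB : forall j, sB (eB j) = iB (gC j).
Hypothesis em : forall j j', mA (eA j) (eA j') = mB (eB j) (eB j').

Let IB' := {k : IB | ~ exists j, eB j = k}.

(** A generator of [A] interacts with the new generators of [B] only if it comes from [C]; otherwise
    there is no relation, encoded by [None]. *)
Definition cross (i : IA) (k : IB') : option nat :=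
  match dec (exists j, eA j = i) with
  | left h => mB (eB (proj1_sig (constructive_indefinite_description _ h))) (proj1_sig k)
  | right _ => None
  end.

Lemma crossE j k : cross (eA j) k = mB (eB j) (proj1_sig k).
Proof.
rewrite /cross; case: dec => [h|[]]; last by exists j.
by case: constructive_indefinite_description => j' /= /eAI ->.
Qed.

Lemma cross_Some i k n : cross i k = Some n -> exists j, eA j = i /\ mB (eB j) (proj1_sig k) = Some n.
Proof.
rewrite /cross; case: dec => [h|//].
by case: constructive_indefinite_description => j' /= e; exists j'.
Qed.

Definition amalgam_matrix (p q : IA + IB') : option nat :=
  match p, q with
  | inl i, inl i' => mA i i'
  | inr k, inr k' => mB (proj1_sig k) (proj1_sig k')
  | inl i, inr k | inr k, inl i => cross i k
  end.

Definition amalgam_gens (p : IA + IB') : W :=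
  match p with inl i => jA (sA i) | inr k => jB (sB (proj1_sig k)) end.

Theorem amalgam_coxeter : coxeter_system W (IA + IB') amalgam_gens amalgam_matrix.
Proof.
have [jAM [jBM [jj U]]] := am.
have [symA [oneA [zeroA [relA UA]]]] := cA; have [symB [oneB [zeroB [relB UB]]]] := cB.
have not1 i k : cross i k <> Some 1%nat.
  move=> /cross_Some [j [_ /oneB e]]; case: k e => k hk /= e.
  by apply: hk; exists j.
have jjs j : jA (sA (eA j)) = jB (sB (eB j)) by rewrite esA esB jj.
split; [|split; [|split; [|split]]].
- by move=> [i|k] [i'|k'] /=.
- move=> [i|k] [i'|k'] /=; [|by split=> // /not1|by split=> // /not1|].
    by split=> [/oneA ->|[<-]] //; apply/oneA.
  split=> [/oneB e|[<-]]; last exact/oneB.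
  by congr inr; case: k k' e => [k hk] [k' hk'] /= e; apply: subset_eq_compat.
- move=> [i|k] [i'|k'] //=; by move=> /cross_Some [j [_ /zeroB]].
- move=> [i|k] [i'|k'] n /=.
  + by move=> /relA h; rewrite -jAM -(homX jAM) h (hom1 jAM).
  + by move=> /cross_Some [j [<- /relB h]]; rewrite jjs -jBM -(homX jBM) h (hom1 jBM).
  + by move=> /cross_Some [j [<- /relB h]]; apply: gpow_mulC; rewrite jjs -jBM -(homX jBM) h (hom1 jBM).
  + by move=> /relB h; rewrite -jBM -(homX jBM) h (hom1 jBM).
move=> H f hf.
(* On generators of [B] that come from [C], the values already prescribed on [A] are used. *)
pose fB k := match dec (exists j, eB j = k) with
  | left h => f (inl (eA (proj1_sig (constructive_indefinite_description _ h))))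
  | right h => f (inr (exist _ k h)) end.
have fBE j : fB (eB j) = f (inl (eA j)).
  rewrite /fB; case: dec => [h|[]]; last by exists j.
  by case: constructive_indefinite_description => j' /= /eBI ->.
have fBN (k : IB') : fB (proj1_sig k) = f (inr k).
  rewrite /fB; case: dec => [h|h]; first by case: (proj2_sig k).
  by congr (f (inr _)); case: k h => k hk h; apply: subset_eq_compat.
have [|phiA [phiAM [phiAs uA]]] := UA H (fun i => f (inl i)); first by move=> i i' n h; apply: hf.
have cases k : (exists j, k = eB j) \/ (exists k' : IB', k = proj1_sig k').
  case: (dec (exists j, eB j = k)) => [[j <-]|h]; first by left; exists j.
  by right; exists (exist _ k h).
have [|phiB [phiBM [phiBs uB]]] := UB H fB.
  move=> k k' n; case: (cases k) => [[j ->]|[k1 ->]]; case: (cases k') => [[j' ->]|[k2 ->]] h;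
    rewrite ?fBE ?fBN; apply: hf => /=; rewrite ?crossE //; first by rewrite em.
  by rewrite symB.
have [|phi [phiM [phiE1 [phiE2 u]]]] := U H phiA phiB phiAM phiBM.
  move=> c; apply: (hom_ext (hom_comp iAM phiAM) (hom_comp iBM phiBM) _ (gen c)) => _ [j <-].
  by rewrite -esA -esB phiAs phiBs fBE.
exists phi; split=> //; split=> [[i|k]|psi psiM psis] /=.
- by rewrite phiE1 phiAs.
- by rewrite phiE2 phiBs fBN.
apply: u => //.
- by apply: (uA (fun a => psi (jA a))); [exact: (hom_comp jAM psiM) | move=> i; exact: (psis (inl i))].
- apply: (uB (fun b => psi (jB b))); first exact: (hom_comp jBM psiM).
  move=> k; case: (cases k) => [[j ->]|[k1 ->]]; first by rewrite -jjs fBE; exact: (psis (inl _)).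
  by rewrite fBN; exact: (psis (inr _)).
Qed.
End AmalgamCoxeter.

(** ** The groups of order two *)

Definition bool_group : group.
Proof.
by refine (@Group bool xorb (fun b => b) false _ _ _); [case=> [] [] [] | case | case].
Defined.

Lemma bool_coxeter : coxeter_system bool_group unit (fun _ => true) (fun _ _ => Some 1%nat).
Proof.
split; [|split; [|split; [|split]]] => //; first by move=> [] [].
  by move=> [] [] n [<-].
move=> H f hf; have := hf tt tt _ eq_refl; rewrite /= gmul1r => h.
exists (fun b : bool => if b then f tt else 1); split; last split.
- by case=> [] [] /=; grp.
- by case.
- by move=> psi psiM psis []; [exact: (psis tt) | exact: (hom1 psiM)].
Qed.

Lemma bool_finite : finite_group bool_group.
Proof. by exists [true; false]; case; [left | right; left]. Qed.

(** ** Symmetric groups *)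

(* The list [j :: r] encodes [s_j s_(j+1) ... s_(n-1)] times the element of rank [n - 1] encoded by [r], with [j <= n]; [cact n i] is left multiplication by [s_i]. *)
Fixpoint cact (n i : nat) (l : list nat) : list nat :=
  match n, l with
  | S k, j :: r =>
      if i =? j then S j :: r else if S i =? j then i :: r
      else if i <? j then j :: cact k i r else j :: cact k (pred i) r
  | _, _ => l
  end.

Fixpoint code (n : nat) (l : list nat) : Prop :=
  match n, l with
  | 0, [] => True
  | S k, j :: r => j <= n /\ code k r
  | _, _ => False
  end.

Arguments Nat.eqb : simpl never.
Arguments Nat.ltb : simpl never.

Ltac cact_cases :=
  repeat (match goal with
  | |- context [?a =? ?b] => case: (Nat.eqb_spec a b) => ?; simpl; try lia
  | |- context [?a <? ?b] => case: (Nat.ltb_spec a b) => ?; simpl; try lia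
  end).

Lemma cact_code n i l : i < n -> code n l -> code n (cact n i l).
Proof.
elim: n i l => [|k IH] i [|j r] //=.
by move=> hi [hj hr]; cact_cases; split; try lia; try done; apply: IH => //; lia.
Qed.

Lemma cactK n i l : cact n i (cact n i l) = l.
Proof.
elim: n i l => [|k IH] i [|j r] //=.
cact_cases; by [f_equal; lia | rewrite IH].
Qed.

Lemma cact_comm n i j l : S i < j -> cact n i (cact n j l) = cact n j (cact n i l).
Proof.
elim: n i j l => [|k IH] i j [|h r] //= hij.
cact_cases; subst; try lia; try reflexivity; f_equal; try lia; apply: IH; lia.
Qed.

Lemma cact_braid n i l : cact n i (cact n (S i) (cact n i l)) = cact n (S i) (cact n i (cact n (S i) l)).
Proof.
elim: n i l => [|k IH] i [|h r] //=.
cact_cases; subst; try lia; try reflexivity; f_equal; try lia; try exact: IH.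
by have -> : i = S (pred i) by lia; exact: IH.
Qed.

Definition index (n : nat) := {i : nat | (i <? n) = true}.
Definition codes (n : nat) := {l : list nat | code n l}.

Lemma index_lt n (i : index n) : proj1_sig i < n.
Proof. by apply/Nat.ltb_lt; exact: (proj2_sig i). Qed.

Definition sact n (i : index n) (t : codes n) : codes n :=
  exist _ (cact n (proj1_sig i) (proj1_sig t)) (cact_code (index_lt i) (proj2_sig t)).

Lemma codes_eq n (t u : codes n) : proj1_sig t = proj1_sig u -> t = u.
Proof. by case: t u => [l hl] [l' hl'] /= e; apply: subset_eq_compat. Qed.

Lemma sactK n (i : index n) t : sact i (sact i t) = t.
Proof. by apply: codes_eq; exact: cactK. Qed.

(** Here [n] is the rank: this is the symmetric group on [n + 1] letters, so that [sym 3] is [S_4]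
    and [sym 4] is [S_5]. *)
Definition sym (n : nat) : group := perm_group (sinv := fun i => i) (@sactK n) (@sactK n).
Definition refl n (i : index n) : sym n := perm_gen (sinv := fun i => i) (@sactK n) (@sactK n) i.

Definition sym_matrix n (i j : index n) : option nat :=
  let a := proj1_sig i in let b := proj1_sig j in
  Some (if a =? b then 1%nat else if (S a =? b) || (S b =? a) then 3 else 2).

Lemma gpow_braid (G : group) (x y : G) : gpow (x * x) 1 = 1 -> gpow (y * y) 1 = 1 ->
  (gpow (x * y) 3 = 1 <-> x * (y * x) = y * (x * y)).
Proof.
rewrite /= !gmul1r => hx hy.
have ex : x^-1 = x by symmetry; exact: ginv_uniq.
have ey : y^-1 = y by symmetry; exact: ginv_uniq.
split=> h; last by rewrite !gmulAr -h (gmulA _ x x) hx gmul1 (gmulA _ y y) hy gmul1 hx.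
have h' : x * (y * x) * (y * (x * y)) = 1 by rewrite -h; grp.
by have := ginv_uniq h'; rewrite !ginvM ex ey => ->; grp.
Qed.

(** The code of the identity, in which every ascending product is empty. *)
Fixpoint base (n : nat) : list nat := match n with 0 => [] | S k => S k :: base k end.

Lemma base_code n : code n (base n).
Proof. by elim: n => [//|n IH] /=. Qed.

Definition sbase n : codes n := exist _ (base n) (base_code n).

Section Evaluation.
Variables (H : group) (f : nat -> H) (n : nat).
Hypothesis f2 : forall i, i < n -> f i * f i = 1.
Hypothesis fcomm : forall i j, S i < j -> j < n -> f i * f j = f j * f i.
Hypothesis fbraid : forall i, S i < n -> f i * (f (S i) * f i) = f (S i) * (f i * f (S i)).

Definition ascent (j c : nat) : H := gprod (map f (seq j c)).

Lemma ascent_comm i j c : S i < j -> j + c <= n -> f i * ascent j c = ascent j c * f i.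
Proof.
elim: c j => [|c IH] j h1 h2; first by rewrite /ascent /=; grp.
have e : f i * f j = f j * f i by apply: fcomm; lia.
have h : f i * ascent (S j) c = ascent (S j) c * f i by apply: IH; lia.
by rewrite /ascent /= -/(ascent (S j) c) gmulA e gmulAr h gmulA.
Qed.

(** The generator commutes with the ascent up to its predecessor, where one braid relation lowers
    its index, and then commutes with the rest. *)
Lemma ascent_shift i j c : j < i -> i < j + c -> j + c <= n -> f i * ascent j c = ascent j c * f (pred i).
Proof.
elim: c j => [|c IH] j h1 h2 h3; first by lia.
rewrite /ascent /= -/(ascent (S j) c); case: (Nat.eq_dec i (S j)) => [e|ne]; last first.
  have e : f j * f i = f i * f j by apply: fcomm; lia.
  have h : f i * ascent (S j) c = ascent (S j) c * f (pred i) by apply: IH; lia.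
  by rewrite gmulA -e gmulAr h gmulA.
subst i; case: c {IH} h2 h3 => [|c] h2 h3; first by lia.
rewrite /ascent /= -/(ascent (S (S j)) c).
have h : f j * ascent (S (S j)) c = ascent (S (S j)) c * f j by apply: ascent_comm; lia.
have E : f j * (f (S j) * f j) = f (S j) * (f j * f (S j)) by apply: fbraid; lia.
have -> : f (S j) * (f j * (f (S j) * ascent (S (S j)) c)) =
  f (S j) * (f j * f (S j)) * ascent (S (S j)) c by grp.
by rewrite -E !gmulAr h.
Qed.

Fixpoint ceval (k : nat) (l : list nat) : H :=
  match k, l with S k', j :: r => ascent j (S k' - j) * ceval k' r | _, _ => 1 end.

Lemma cevalE k j r : ceval (S k) (j :: r) = ascent j (S k - j) * ceval k r.
Proof. by []. Qed.

(** The branches of [cact] are the ways in which a generator meets an ascent: it cancels the first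
    letter, prolongs the ascent, commutes with it, or passes it with its index lowered. *)
Lemma ceval_act k i l : k <= n -> i < k -> code k l -> ceval k (cact k i l) = f i * ceval k l.
Proof.
elim: k i l => [|k IH] i l hk hi; first by lia.
case: l => [//|j r] [hj hr]; rewrite [cact _ _ _]/=.
case: (Nat.eqb_spec i j) => [e|ne].
  subst j; rewrite !cevalE; have -> : S k - i = S (S k - S i) by lia.
  have e : f i * f i = 1 by apply: f2; lia.
  by rewrite [ascent i _]/ascent /= -/(ascent _ _) !gmulA e gmul1.
case: (Nat.eqb_spec (S i) j) => [e|ne'].
  subst j; rewrite !cevalE; have -> : S k - i = S (S k - S i) by lia.
  by rewrite [ascent i _]/ascent /= -/(ascent _ _) gmulAr.
case: (Nat.ltb_spec i j) => h; rewrite !cevalE IH //; try lia.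
  have e : f i * ascent j (S k - j) = ascent j (S k - j) * f i by apply: ascent_comm; lia.
  by rewrite !gmulA e.
have e : f i * ascent j (S k - j) = ascent j (S k - j) * f (pred i) by apply: ascent_shift; lia.
by rewrite !gmulA e.
Qed.

Lemma ceval_base k : ceval k (base k) = 1.
Proof. by elim: k => [//|k IH] /=; rewrite IH Nat.sub_diag /ascent /=; grp. Qed.
End Evaluation.

Lemma refl_sq n (i : index n) : refl i * refl i = 1.
Proof. by apply: (perm_elt_eq (@sactK n) (@sactK n)) => t; exact: sactK. Qed.

Lemma refl_comm n (i j : index n) : S (proj1_sig i) < proj1_sig j -> refl i * refl j = refl j * refl i.
Proof. by move=> h; apply: (perm_elt_eq (@sactK n) (@sactK n)) => t; apply: codes_eq; exact: cact_comm. Qed.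

Lemma refl_braid n (i j : index n) : S (proj1_sig i) = proj1_sig j ->
  refl i * (refl j * refl i) = refl j * (refl i * refl j).
Proof.
by move=> h; apply: (perm_elt_eq (@sactK n) (@sactK n)) => t; apply: codes_eq; rewrite /pfun /= -h; exact: cact_braid.
Qed.

Definition extend n (H : group) (f : index n -> H) (k : nat) : H :=
  match bool_dec (k <? n) true with left h => f (exist _ k h) | right _ => 1 end.

Lemma extendE n (H : group) (f : index n -> H) (i : index n) : extend f (proj1_sig i) = f i.
Proof.
rewrite /extend; case: i => k h /=; case: bool_dec => // h'.
by congr f; apply: subset_eq_compat.
Qed.

Section SymExtension.
Variables (n : nat) (H : group) (f : index n -> H).
Hypothesis rel : forall i j m, sym_matrix i j = Some m -> gpow (f i * f j) m = 1.

Definition sym_eval (t : codes n) : H := ceval (extend f) n (proj1_sig t).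
Definition sym_ext : sym n -> H := perm_ext (sbase n) sym_eval.

Let fsq (i : index n) : gpow (f i * f i) 1 = 1.
Proof. by apply: rel; rewrite /sym_matrix Nat.eqb_refl. Qed.

Lemma sym_eval_act i t : sym_eval (sact i t) = f i * sym_eval t.
Proof.
rewrite /sym_eval -(extendE f i).
apply: (@ceval_act H (extend f) n) => //; [| | |exact: index_lt | exact: (proj2_sig t)].
- move=> k /Nat.ltb_lt hk; rewrite -[k]/(proj1_sig (exist (fun k => (k <? n) = true) k hk)) extendE.
  by have := fsq (exist _ k hk); rewrite /= gmul1r.
- move=> k l hkl hl; have hk : (k <? n) = true by apply/Nat.ltb_lt; lia.
  move/Nat.ltb_lt: hl => hl.
  rewrite -[k]/(proj1_sig (exist (fun k => (k <? n) = true) k hk)).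
  rewrite -[l]/(proj1_sig (exist (fun k => (k <? n) = true) l hl)) !extendE.
  apply/gpow_mul_comm; [exact: fsq | exact: fsq |]; apply: rel; rewrite /sym_matrix /=.
  case: Nat.eqb_spec => [|_]; first by lia.
  case: Nat.eqb_spec => [|_]; first by lia.
  by case: Nat.eqb_spec => [|_] //=; lia.
- move=> k hl; have hk : (k <? n) = true by apply/Nat.ltb_lt; lia.
  move/Nat.ltb_lt: hl => hl.
  rewrite -{1 3 4}[k]/(proj1_sig (exist (fun k => (k <? n) = true) k hk)).
  rewrite -[S k]/(proj1_sig (exist (fun k => (k <? n) = true) (S k) hl)) !extendE.
  apply/gpow_braid; [exact: fsq | exact: fsq |]; apply: rel; rewrite /sym_matrix /=.
  case: Nat.eqb_spec => [|_]; first by lia.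
  by rewrite Nat.eqb_refl.
Qed.

Lemma sym_eval_base : sym_eval (sbase n) = 1.
Proof. exact: ceval_base. Qed.

Lemma sym_ext_hom : is_hom sym_ext.
Proof. exact: (perm_ext_hom sym_eval_base sym_eval_act). Qed.

Lemma sym_ext_refl i : sym_ext (refl i) = f i.
Proof. exact: (@perm_ext_gen _ _ _ _ (@sactK n) (@sactK n) (sbase n) H _ sym_eval sym_eval_base sym_eval_act i). Qed.
End SymExtension.

Lemma refl_rel n (i j : index n) m : sym_matrix i j = Some m -> gpow (refl i * refl j) m = 1.
Proof.
have sq (k : index n) : gpow (refl k * refl k) 1 = 1 by rewrite -[LHS]/(refl k * refl k * 1) gmul1r refl_sq.
rewrite /sym_matrix; case: Nat.eqb_spec => [e [<-]|ne].
  by have -> : i = j by (case: i j e => [a ha] [b hb] /= e; apply: subset_eq_compat).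
case: Nat.eqb_spec => [e [<-]|ne1]; first by apply/gpow_braid => //; exact: refl_braid.
case: Nat.eqb_spec => [e [<-]|ne2]; first by apply: gpow_mulC; apply/gpow_braid => //; exact: refl_braid.
move=> [<-]; case: (Nat.lt_ge_cases (proj1_sig i) (proj1_sig j)) => h.
  by apply/gpow_mul_comm => //; apply: refl_comm; lia.
by apply: gpow_mulC; apply/gpow_mul_comm => //; apply: refl_comm; lia.
Qed.

Lemma sym_generated n (x : sym n) : generated (fun y => exists i, refl i = y) x.
Proof. exact: perm_group_generated. Qed.

Theorem sym_coxeter n : coxeter_system (sym n) (index n) (@refl n) (@sym_matrix n).
Proof.
split; [|split; [|split; [|split]]].
- by move=> i j; rewrite /sym_matrix Nat.eqb_sym orb_comm.
- move=> i j; rewrite /sym_matrix; split=> [|->]; last by rewrite Nat.eqb_refl.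
  case: Nat.eqb_spec => [e _|_]; last by case: (_ || _).
  by case: i j e => [a ha] [b hb] /= e; apply: subset_eq_compat.
- by move=> i j; rewrite /sym_matrix; case: (_ =? _) => //; case: (_ || _).
- exact: refl_rel.
- move=> H f rel; exists (sym_ext f); split; first exact: sym_ext_hom.
  split; first exact: sym_ext_refl.
  move=> psi psiM psis x; apply: (hom_ext psiM (sym_ext_hom rel) _ (sym_generated x)) => _ [i <-].
  by rewrite psis sym_ext_refl.
Qed.

(** The extension of [refl] to [sym n] is the identity on generators, hence everywhere. So an
    element is determined by its action on the base code, and equality becomes computable. *)
Lemma sym_elt n (x : sym n) : x = ceval (extend (@refl n)) n (proj1_sig (pfun x (sbase n))).
Proof.
have rel := @refl_rel n; apply: (hom_ext (@hom_id _) (sym_ext_hom rel) _ (sym_generated x)) => _ [i <-].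
by rewrite sym_ext_refl.
Qed.

Lemma sym_eq n (x y : sym n) :
  proj1_sig (pfun x (sbase n)) = proj1_sig (pfun y (sbase n)) -> x = y.
Proof. by move=> e; rewrite (sym_elt x) (sym_elt y) e. Qed.

Fixpoint all_codes (n : nat) : list (list nat) :=
  match n with
  | 0 => [[]]
  | S k => flat_map (fun j => map (cons j) (all_codes k)) (seq 0 (S n))
  end.

Lemma all_codesP n l : code n l -> In l (all_codes n).
Proof.
elim: n l => [|n IH] [|j r] //; first by left.
move=> [h /IH hr]; rewrite -[all_codes (S n)]/(flat_map (fun j => map (cons j) (all_codes n)) (seq 0 (S (S n)))).
by apply/in_flat_map; exists j; split; [apply/in_seq; lia | exact: in_map].
Qed.

Lemma sym_finite n : finite_group (sym n).
Proof.
exists (map (ceval (extend (@refl n)) n) (all_codes n)) => x; rewrite (sym_elt x).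
by apply: in_map; apply: all_codesP; exact: (proj2_sig (pfun x (sbase n))).
Qed.

Fixpoint code_word (n : nat) (l : list nat) : list nat :=
  match n, l with S k, j :: r => seq j (S k - j) ++ code_word k r | _, _ => [] end.

Definition word_act (n : nat) (w l : list nat) : list nat := fold_right (cact n) l w.

Lemma pfun_extend n i (t : codes n) : i < n -> proj1_sig (pfun (extend (@refl n) i) t) = cact n i (proj1_sig t).
Proof.
by move=> /Nat.ltb_lt h; rewrite -{1}[i]/(proj1_sig (exist (fun k => (k <? n) = true) i h)) extendE.
Qed.

(** Elements are replaced by words acting on lists of numbers, so that statements about all of
    [sym n] can be settled by evaluation over [all_codes n]. *)
Lemma sym_word n (x : sym n) : exists w, In w (map (code_word n) (all_codes n)) /\
  forall t, proj1_sig (pfun x t) = word_act n w (proj1_sig t).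
Proof.
set l := proj1_sig (pfun x (sbase n)); have hl : code n l := proj2_sig (pfun x (sbase n)).
exists (code_word n l); split; first by apply: in_map; exact: all_codesP.
pose f := extend (@refl n).
have ascE (y : sym n) j c w : j + c <= n -> (forall t, proj1_sig (pfun y t) = word_act n w (proj1_sig t)) ->
    forall t, proj1_sig (pfun (ascent f j c * y) t) = word_act n (seq j c ++ w) (proj1_sig t).
  elim: c j => [|c IH] j h hy t.
    by have -> : ascent f j 0 = 1 by []; rewrite gmul1 hy.
  have -> : ascent f j (S c) = f j * ascent f (S j) c by [].
  rewrite gmulAr pfunM pfun_extend; first by lia.
  by rewrite IH //; lia.
rewrite (sym_elt x) -/l; have : n <= n by [].
suff : forall k l, code k l -> k <= n -> forall t,
    proj1_sig (pfun (ceval (extend (@refl n)) k l) t) = word_act n (code_word k l) (proj1_sig t).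
  by move=> h _; exact: (h n l hl (le_n n)).
elim=> [|k IH] [|j r] // [hj hr] hk t.
rewrite cevalE; apply: ascE; first by lia.
by apply: IH => //; lia.
Qed.

Lemma pfun_gpow n (x : sym n) w m t : (forall t, proj1_sig (pfun x t) = word_act n w (proj1_sig t)) ->
  proj1_sig (pfun (gpow x m) t) = Nat.iter m (word_act n w) (proj1_sig t).
Proof. by move=> h; elim: m => [//|m IH]; rewrite [gpow _ _]/= pfunM h IH. Qed.

Definition list_eqb (l l' : list nat) : bool :=
  match list_eq_dec Nat.eq_dec l l' with left _ => true | right _ => false end.

Lemma list_eqbP l l' : list_eqb l l' = true <-> l = l'.
Proof. by rewrite /list_eqb; case: list_eq_dec. Qed.

Lemma sym_check n (P : list nat -> bool) :
  forallb P (map (code_word n) (all_codes n)) = true ->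
  forall x : sym n, exists w, P w = true /\ forall t, proj1_sig (pfun x t) = word_act n w (proj1_sig t).
Proof.
move=> /forallb_forall h x; have [w [hw e]] := sym_word x.
by exists w; split=> //; exact: h.
Qed.

(** Twelve is the least common multiple of 1, 2, 3, 4, the element orders in [S_4]. *)
Lemma sym_exponent n : n <= 3 -> forall x : sym n, gpow x 12 = 1.
Proof.
move=> hn x.
have h : forallb (fun w => list_eqb (Nat.iter 12 (word_act n w) (base n)) (base n)) (map (code_word n) (all_codes n)) = true.
  by case: n hn {x} => [|[|[|[|n]]]] hn; [vm_compute | vm_compute | vm_compute | vm_compute | lia].
have [w [/list_eqbP e hw]] := sym_check h x.
by apply: sym_eq; rewrite (pfun_gpow _ _ hw).
Qed.

Lemma sym3_order5 (x : sym 3) : gpow x 5 = 1 -> x = 1.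
Proof.
have h : forallb (fun w => implb (list_eqb (Nat.iter 5 (word_act 3 w) (base 3)) (base 3))
    (list_eqb (word_act 3 w (base 3)) (base 3))) (map (code_word 3) (all_codes 3)) = true by vm_compute.
have [w [e hw]] := sym_check h x => hx.
have e1 : list_eqb (Nat.iter 5 (word_act 3 w) (base 3)) (base 3) = true.
  by apply/list_eqbP; rewrite -(pfun_gpow _ (sbase 3) hw) hx.
rewrite e1 /= in e; apply: sym_eq; rewrite hw; exact/list_eqbP.
Qed.

Definition a0 := refl (exist (fun i => (i <? 3) = true) 0 eq_refl).
Definition a1 := refl (exist (fun i => (i <? 3) = true) 1%nat eq_refl).
Definition a2 := refl (exist (fun i => (i <? 3) = true) 2 eq_refl).
Definition b0 := refl (exist (fun i => (i <? 4) = true) 0 eq_refl).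
Definition b1 := refl (exist (fun i => (i <? 4) = true) 1%nat eq_refl).
Definition b2 := refl (exist (fun i => (i <? 4) = true) 2 eq_refl).
Definition b3 := refl (exist (fun i => (i <? 4) = true) 3 eq_refl).
Definition r0 := refl (exist (fun i => (i <? 2) = true) 0 eq_refl).
Definition r1 := refl (exist (fun i => (i <? 2) = true) 1%nat eq_refl).

(** The centralizer of a transposition in [S_5] has order twelve and contains no five-cycle; this is
    verified by enumeration. *)
Lemma sym4_order5 (x : sym 4) : gpow x 5 = 1 -> x * b2 = b2 * x -> x = 1.
Proof.
have h : forallb (fun w => implb (list_eqb (Nat.iter 5 (word_act 4 w) (base 4)) (base 4) &&
      list_eqb (word_act 4 w (cact 4 2 (base 4))) (cact 4 2 (word_act 4 w (base 4))))
    (list_eqb (word_act 4 w (base 4)) (base 4))) (map (code_word 4) (all_codes 4)) = true by vm_compute.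
have [w [e hw]] := sym_check h x => hx hc.
have e1 : list_eqb (Nat.iter 5 (word_act 4 w) (base 4)) (base 4) = true.
  by apply/list_eqbP; rewrite -(pfun_gpow _ (sbase 4) hw) hx.
have e2 : list_eqb (word_act 4 w (cact 4 2 (base 4))) (cact 4 2 (word_act 4 w (base 4))) = true.
  apply/list_eqbP; have := f_equal (fun y : sym 4 => proj1_sig (pfun y (sbase 4))) hc.
  by rewrite !pfunM hw [pfun b2 _]/pfun /= hw.
rewrite e1 e2 /= in e; apply: sym_eq; rewrite hw; exact/list_eqbP.
Qed.

(** * The example *)

Notation Z2 := bool_group.

Definition two (G : group) (g h : G) (a b : bool) : G := (if a then g else 1) * (if b then h else 1).

Section TwoInvolutions.
Variables (G : group) (g h : G).
Hypothesis gg : g * g = 1.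
Hypothesis hh : h * h = 1.
Hypothesis gh : h * g = g * h.

Lemma two_mul a b a' b' : two g h (xorb a a') (xorb b b') = two g h a b * two g h a' b'.
Proof.
have ggx x : g * (g * x) = x by rewrite gmulA gg gmul1.
have hhx x : h * (h * x) = x by rewrite gmulA hh gmul1.
have ghx x : h * (g * x) = g * (h * x) by rewrite gmulA gh gmulAr.
case: a a' b b' => [] [] [] []; rewrite /two /= ?gmul1 ?gmul1r ?gmulAr ?gg ?hh ?gh //;
  by rewrite ?ghx ?gh ?ggx ?hhx ?gg ?hh ?gmul1r.
Qed.

Lemma two00 : two g h false false = 1. Proof. by rewrite /two gmul1. Qed.
Lemma two10 : two g h true false = g. Proof. by rewrite /two gmul1r. Qed.
Lemma two01 : two g h false true = h. Proof. by rewrite /two gmul1. Qed.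

Lemma two_swap p a b : p * g * p^-1 = h -> p * h * p^-1 = g -> p * two g h a b * p^-1 = two g h b a.
Proof.
move=> e1 e2; have -> : p * two g h a b * p^-1 =
  (p * (if a then g else 1) * p^-1) * (p * (if b then h else 1) * p^-1) by rewrite /two; grp.
have -> : p * (if a then g else 1) * p^-1 = if a then h else 1 by case: a; rewrite ?e1 //; grp.
have -> : p * (if b then h else 1) * p^-1 = if b then g else 1 by case: b; rewrite ?e2 //; grp.
by rewrite /two; case: a b => [] []; rewrite /= ?gmul1 ?gmul1r ?gh.
Qed.
End TwoInvolutions.
Arguments two : simpl never.

(* [C] is generated by [c_1, ..., c_4]. In [A] the pair [c_2, c_3] lies in an [S_4] and [c_4] in an [S_3]; in [B] the pair [c_1, c_2] lies in an [S_4] and [c_3, c_4] in an [S_5]. The remaining factors commute with [C]. *)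
Definition groupC : group := prod_group Z2 (prod_group Z2 (prod_group Z2 Z2)).
Definition groupA : group := prod_group (sym 3) (prod_group Z2 (prod_group (sym 2) (prod_group Z2 Z2))).
Definition groupB : group := prod_group (sym 3) (prod_group (sym 4) Z2).

Definition inA (c : groupC) : groupA :=
  let '(c1, (c2, (c3, c4))) := c in (two a0 a2 c2 c3, (c1, (if c4 : bool then r0 else 1, (false, false)))).
Definition inB (c : groupC) : groupB :=
  let '(c1, (c2, (c3, c4))) := c in (two a0 a2 c1 c2, (two b0 b2 c3 c4, false)).
Definition twist (c : groupC) : groupC := let '(c1, (c2, (c3, c4))) := c in (c4, (c2, (c3, c1))).
Definition inA' (c : groupC) : groupA := inA (twist c).

Lemma twistK c : twist (twist c) = c.
Proof. by case: c => [c1 [c2 [c3 c4]]]. Qed.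

Lemma twist_hom : is_hom twist.
Proof. by move=> [c1 [c2 [c3 c4]]] [d1 [d2 [d3 d4]]]. Qed.

Lemma a0a0 : a0 * a0 = 1. Proof. exact: refl_sq. Qed.
Lemma a2a2 : a2 * a2 = 1. Proof. exact: refl_sq. Qed.
Lemma b0b0 : b0 * b0 = 1. Proof. exact: refl_sq. Qed.
Lemma b2b2 : b2 * b2 = 1. Proof. exact: refl_sq. Qed.
Lemma r0r0 : r0 * r0 = 1. Proof. exact: refl_sq. Qed.
Lemma a2a0 : a2 * a0 = a0 * a2. Proof. by symmetry; apply: refl_comm => /=; lia. Qed.
Lemma b2b0 : b2 * b0 = b0 * b2. Proof. by symmetry; apply: refl_comm => /=; lia. Qed.

Lemma inA_hom : is_hom inA.
Proof.
move=> [c1 [c2 [c3 c4]]] [d1 [d2 [d3 d4]]].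
have e : (if xorb c4 d4 then r0 else 1) = (if c4 : bool then r0 else 1) * (if d4 : bool then r0 else 1).
  by case: c4 d4 => [] []; rewrite [xorb _ _]/= ?gmul1 ?gmul1r ?r0r0.
have -> : inA (((c1, (c2, (c3, c4))) : groupC) * ((d1, (d2, (d3, d4))) : groupC)) =
  (two a0 a2 (xorb c2 d2) (xorb c3 d3), (xorb c1 d1, (if xorb c4 d4 then r0 else 1, (false, false)))) by [].
by rewrite (two_mul a0a0 a2a2 a2a0) e.
Qed.

Lemma inB_hom : is_hom inB.
Proof.
move=> [c1 [c2 [c3 c4]]] [d1 [d2 [d3 d4]]].
have -> : inB (((c1, (c2, (c3, c4))) : groupC) * ((d1, (d2, (d3, d4))) : groupC)) =
  (two a0 a2 (xorb c1 d1) (xorb c2 d2), (two b0 b2 (xorb c3 d3) (xorb c4 d4), false)) by [].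
by rewrite (two_mul a0a0 a2a2 a2a0) (two_mul b0b0 b2b2 b2b0).
Qed.

Definition trace n (x : sym n) : list nat := proj1_sig (pfun x (sbase n)).

Lemma inA_inj c d : inA c = inA d -> c = d.
Proof.
apply: (hom_inj inA_hom) => -[c1 [c2 [c3 c4]]] h.
have h1 := f_equal (fun x : groupA => trace (fst x)) h.
have h2 := f_equal (fun x : groupA => fst (snd x)) h.
have h3 := f_equal (fun x : groupA => trace (fst (snd (snd x)))) h.
by move: h1 h2 h3 {h}; case: c1; case: c2; case: c3; case: c4; vm_compute.
Qed.

Lemma inB_inj c d : inB c = inB d -> c = d.
Proof.
apply: (hom_inj inB_hom) => -[c1 [c2 [c3 c4]]] h.
have h1 := f_equal (fun x : groupB => trace (fst x)) h.
have h2 := f_equal (fun x : groupB => trace (fst (snd x))) h.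
by move: h1 h2 {h}; case: c1; case: c2; case: c3; case: c4; vm_compute.
Qed.

Lemma inA'_hom : is_hom inA'.
Proof. exact: (hom_comp twist_hom inA_hom). Qed.

Lemma inA'_inj c d : inA' c = inA' d -> c = d.
Proof. by move=> /inA_inj e; rewrite -(twistK c) e twistK. Qed.

Definition coxC := coxeter_prod bool_coxeter (coxeter_prod bool_coxeter (coxeter_prod bool_coxeter bool_coxeter)).
Definition coxA := coxeter_prod (sym_coxeter 3) (coxeter_prod bool_coxeter
  (coxeter_prod (sym_coxeter 2) (coxeter_prod bool_coxeter bool_coxeter))).
Definition coxB := coxeter_prod (sym_coxeter 3) (coxeter_prod (sym_coxeter 4) bool_coxeter).

Definition ixC : Type := (unit + (unit + (unit + unit)))%type.
Definition ixA : Type := (index 3 + (unit + (index 2 + (unit + unit))))%type.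
Definition ixB : Type := (index 3 + (index 4 + unit))%type.

Definition at3 (k : nat) (h : (k <? 3) = true) : index 3 := exist _ k h.
Definition at4 (k : nat) (h : (k <? 4) = true) : index 4 := exist _ k h.
Definition at2 (k : nat) (h : (k <? 2) = true) : index 2 := exist _ k h.

Definition embA (j : ixC) : ixA :=
  match j with
  | inl _ => inr (inl tt)
  | inr (inl _) => inl (at3 (k := 0) eq_refl)
  | inr (inr (inl _)) => inl (at3 (k := 2) eq_refl)
  | inr (inr (inr _)) => inr (inr (inl (at2 (k := 0) eq_refl)))
  end.
Definition embB (j : ixC) : ixB :=
  match j with
  | inl _ => inl (at3 (k := 0) eq_refl)
  | inr (inl _) => inl (at3 (k := 2) eq_refl)
  | inr (inr (inl _)) => inr (inl (at4 (k := 0) eq_refl))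
  | inr (inr (inr _)) => inr (inl (at4 (k := 2) eq_refl))
  end.
Definition twist_ix (j : ixC) : ixC :=
  match j with
  | inl _ => inr (inr (inr tt))
  | inr (inr (inr _)) => inl tt
  | _ => j
  end.
Definition embA' (j : ixC) : ixA := embA (twist_ix j).

Definition genC : ixC -> groupC := prod_gens (fun _ => true : Z2) (prod_gens (fun _ => true : Z2)
  (prod_gens (fun _ => true : Z2) (fun _ => true : Z2))).
Definition genA : ixA -> groupA := prod_gens (@refl 3) (prod_gens (fun _ => true : Z2)
  (prod_gens (@refl 2) (prod_gens (fun _ => true : Z2) (fun _ => true : Z2)))).
Definition genB : ixB -> groupB := prod_gens (@refl 3) (prod_gens (@refl 4) (fun _ => true : Z2)).

Lemma embA_inj j j' : embA j = embA j' -> j = j'.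
Proof. by move: j j' => [[]|[[]|[[]|[]]]] [[]|[[]|[[]|[]]]]. Qed.

Lemma embB_inj j j' : embB j = embB j' -> j = j'.
Proof. by move: j j' => [[]|[[]|[[]|[]]]] [[]|[[]|[[]|[]]]]. Qed.

Lemma embA'_inj j j' : embA' j = embA' j' -> j = j'.
Proof. by move: j j' => [[]|[[]|[[]|[]]]] [[]|[[]|[[]|[]]]]. Qed.

Lemma genA_emb j : genA (embA j) = inA (genC j).
Proof. by move: j => [[]|[[]|[[]|[]]]]; rewrite [RHS]/= ?two00 ?two10 ?two01. Qed.

Lemma genA_emb' j : genA (embA' j) = inA' (genC j).
Proof. by rewrite genA_emb; move: j => [[]|[[]|[[]|[]]]]. Qed.

Lemma genB_emb j : genB (embB j) = inB (genC j).
Proof. by move: j => [[]|[[]|[[]|[]]]]; rewrite [RHS]/= ?two00 ?two10 ?two01. Qed.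

Lemma genC_generated c : generated (fun y => exists j, genC j = y) c.
Proof. exact: (coxeter_generated coxC). Qed.

Lemma groupC_finite : finite_group groupC.
Proof. by do !(apply: finite_prod; first exact: bool_finite); exact: bool_finite. Qed.

Lemma groupA_finite : finite_group groupA.
Proof.
apply: finite_prod (sym_finite 3) _; apply: finite_prod bool_finite _.
exact: (finite_prod (sym_finite 2) (finite_prod bool_finite bool_finite)).
Qed.

Lemma groupB_finite : finite_group groupB.
Proof. exact: (finite_prod (sym_finite 3) (finite_prod (sym_finite 4) bool_finite)). Qed.

(** In [S_4], the product [a1 * a0 * a2 * a1] exchanges the blocks [{1,2}] and [{3,4}], and so the
    transpositions [a0] and [a2]. *)
Definition flipA : groupA := (a1 * a0 * a2 * a1, 1).
Definition flipB1 : groupB := (a1 * a0 * a2 * a1, 1).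
Definition flipB2 : groupB := (1, (b1 * b0 * b2 * b1, false)).

Lemma conj_a0 : a1 * a0 * a2 * a1 * a0 * (a1 * a0 * a2 * a1)^-1 = a2.
Proof. by apply: sym_eq; vm_compute. Qed.
Lemma conj_a2 : a1 * a0 * a2 * a1 * a2 * (a1 * a0 * a2 * a1)^-1 = a0.
Proof. by apply: sym_eq; vm_compute. Qed.
Lemma conj_b0 : b1 * b0 * b2 * b1 * b0 * (b1 * b0 * b2 * b1)^-1 = b2.
Proof. by apply: sym_eq; vm_compute. Qed.
Lemma conj_b2 : b1 * b0 * b2 * b1 * b2 * (b1 * b0 * b2 * b1)^-1 = b0.
Proof. by apply: sym_eq; vm_compute. Qed.

Lemma pairM (G H : group) (x x' : G) (y y' : H) :
  ((x, y) : prod_group G H) * ((x', y') : prod_group G H) = (x * x', y * y').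
Proof. by []. Qed.

Lemma pairV (G H : group) (x : G) (y : H) : ((x, y) : prod_group G H)^-1 = (x^-1, y^-1).
Proof. by []. Qed.

Lemma flipAE c1 c2 c3 c4 : flipA * inA (c1, (c2, (c3, c4))) * flipA^-1 = inA (c1, (c3, (c2, c4))).
Proof.
rewrite /flipA [inA _]/= pairV !pairM (two_swap a2a0 _ _ conj_a0 conj_a2); congr (_, _).
by grp.
Qed.

Lemma flipB1E c1 c2 c3 c4 : flipB1 * inB (c1, (c2, (c3, c4))) * flipB1^-1 = inB (c2, (c1, (c3, c4))).
Proof.
rewrite /flipB1 [inB _]/= pairV !pairM (two_swap a2a0 _ _ conj_a0 conj_a2); congr (_, _).
by grp.
Qed.

Lemma flipB2E c1 c2 c3 c4 : flipB2 * inB (c1, (c2, (c3, c4))) * flipB2^-1 = inB (c1, (c2, (c4, c3))).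
Proof.
rewrite /flipB2 [inB _]/= !pairV !pairM (two_swap b2b0 _ _ conj_b0 conj_b2).
by congr (_, _); grp.
Qed.

(** The three non-trivial values are the involutions used as [x1], [x2] and [x3]; [centB] is used as
    [y]. *)
Definition centA (p q : bool) : groupA := (1, (1, (1, (p, q)))).
Definition centB : groupB := (1, (1, true)).

Lemma inr_mul (G H : group) (y y' : H) : ((1, y) : prod_group G H) * ((1, y') : prod_group G H) = (1, y * y').
Proof. by rewrite pairM gmul1. Qed.

Lemma centA_mul p q p' q' : centA p q * centA p' q' = centA (xorb p p') (xorb q q').
Proof. by rewrite /centA !inr_mul. Qed.

Lemma exponent_prod (G H : group) n : (forall x : G, gpow x n = 1) -> (forall y : H, gpow y n = 1) ->
  forall p : prod_group G H, gpow p n = 1.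
Proof. by move=> hx hy [x y]; rewrite gpow_pair hx hy. Qed.

Lemma groupA_exponent (x : groupA) : gpow x 12 = 1.
Proof.
have e (b : Z2) : gpow b 12 = 1 by case: b.
apply: exponent_prod x; first by apply: sym_exponent; lia.
apply: exponent_prod => //; apply: exponent_prod; first by apply: sym_exponent; lia.
exact: exponent_prod.
Qed.

(** A Coxeter element of [S_5], that is, a five-cycle. It lies in the factor that contains [c_3] and
    [c_4], hence commutes with [c_1]. *)
Definition five : groupB := (1, (b0 * b1 * b2 * b3, 1)).

Lemma gpow_inr (G H : group) (y : H) n : gpow ((1, y) : prod_group G H) n = (1, gpow y n).
Proof. by rewrite gpow_pair gpow1. Qed.

Lemma five5 : gpow five 5 = 1.
Proof.
have e : gpow (b0 * b1 * b2 * b3) 5 = 1 by apply: sym_eq; vm_compute.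
by rewrite /five gpow_inr gpow_pair gpow1 e.
Qed.

(** * Properties common to both amalgams, with [sigma] the identity or [twist] *)

Section Vertices.
Variables (i : groupC -> groupA) (sigma : groupC -> groupC).
Hypothesis iE : forall c, i c = inA (sigma c).
Variables (W : group) (jA : groupA -> W) (jB : groupB -> W).
Hypothesis am : is_amalgam groupC groupA groupB W i inB jA jB.
Hypothesis jA1 : forall a, jA a = 1 -> a = 1.
Hypothesis jB1 : forall b, jB b = 1 -> b = 1.

Definition sides (s : bool) (w : W) : Prop := if s : bool then exists a, jA a = w else exists b, jB b = w.

Lemma vertex_letters : central_letters sides (core_image i jA) (jA (centA true false)) (jA (centA false true)) (jA (centA true true)) (jB centB).
Proof.
have [jAM [jBM [jj _]]] := am.
have jAI := hom_inj jAM jA1; have jBI := hom_inj jBM jB1.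
have nA p q : p || q = true -> ~ core_image i jA (jA (centA p q)).
  move=> hpq [c /jAI]; rewrite iE; case: (sigma c) => [c1 [c2 [c3 c4]]] e.
  have e1 := f_equal (fun x : groupA => fst (snd (snd (snd x)))) e.
  have e2 := f_equal (fun x : groupA => snd (snd (snd (snd x)))) e.
  by move: hpq e1 e2; case: p {e}; case: q.
have commA p q c : core_image i jA c -> jA (centA p q) * c = c * jA (centA p q).
  move=> [d <-]; rewrite -!jAM iE; case: (sigma d) => [c1 [c2 [c3 c4]]]; congr jA.
  by rewrite /centA [inA _]/= !pairM !gmul1 !gmul1r; case: p; case: q.
have sqA p q : jA (centA p q) * jA (centA p q) = 1.
  by rewrite -jAM centA_mul !xorb_nilpotent; exact: (hom1 jAM).
split; rewrite ?sqA //; try by eexists.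
- exact: nA.
- exact: nA.
- exact: nA.
- rewrite /core_image => -[c]; rewrite jj => /jBI; case: c => [c1 [c2 [c3 c4]]] e.
  by have := f_equal (fun x : groupB => snd (snd x)) e.
- by rewrite -jBM -(hom1 jBM); congr jB; rewrite /centB !pairM !gmul1.
- by rewrite -jAM centA_mul.
- by move=> c; exact: commA.
- by move=> c; exact: commA.
- by move=> c; exact: commA.
- move=> _ [[c1 [c2 [c3 c4]]] <-]; rewrite jj -!jBM; congr jB.
  by rewrite /centB [inB _]/= !pairM !gmul1 !gmul1r.
Qed.

(** Both choices of [sigma] fix the two middle coordinates, so [flipA] exchanges [c_2] and [c_3] in
    either amalgam. *)
Hypothesis sigma_flip : forall c1 c2 c3 c4, exists d1 d4,
  sigma (c1, (c2, (c3, c4))) = (d1, (c2, (c3, d4))) /\ sigma (c1, (c3, (c2, c4))) = (d1, (c3, (c2, d4))).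

(* [(1 4) = (1 2)(2 3)(3 4)(2 3)(1 2)] *)
Lemma twist_conj : exists n, forall c, n * jA (i c) * n^-1 = jA (i (twist c)).
Proof.
have [jAM [jBM [jj _]]] := am.
have fA c1 c2 c3 c4 : jA flipA * jA (i (c1, (c2, (c3, c4)))) * (jA flipA)^-1 = jA (i (c1, (c3, (c2, c4)))).
  have [d1 [d4 [e e']]] := sigma_flip c1 c2 c3 c4.
  by rewrite -(homV jAM) -!jAM !iE e e' flipAE.
have fB1 c1 c2 c3 c4 : jB flipB1 * jA (i (c1, (c2, (c3, c4)))) * (jB flipB1)^-1 = jA (i (c2, (c1, (c3, c4)))).
  by rewrite !jj -(homV jBM) -!jBM flipB1E.
have fB2 c1 c2 c3 c4 : jB flipB2 * jA (i (c1, (c2, (c3, c4)))) * (jB flipB2)^-1 = jA (i (c1, (c2, (c4, c3)))).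
  by rewrite !jj -(homV jBM) -!jBM flipB2E.
exists (jB flipB1 * (jA flipA * (jB flipB2 * (jA flipA * jB flipB1)))) => -[c1 [c2 [c3 c4]]].
have -> x : jB flipB1 * (jA flipA * (jB flipB2 * (jA flipA * jB flipB1))) * x *
    (jB flipB1 * (jA flipA * (jB flipB2 * (jA flipA * jB flipB1))))^-1 =
  jB flipB1 * (jA flipA * (jB flipB2 * (jA flipA * (jB flipB1 * x * (jB flipB1)^-1) *
    (jA flipA)^-1) * (jB flipB2)^-1) * (jA flipA)^-1) * (jB flipB1)^-1 by grp.
by rewrite fB1 fA fB2 fA fB1.
Qed.

Lemma sides_finite b : exists L : list W, forall w, sides b w -> In w L.
Proof.
case: b; [have [l hl] := groupA_finite | have [l hl] := groupB_finite].
  by exists (map jA l) => _ [a <-]; apply: in_map.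
by exists (map jB l) => _ [a <-]; apply: in_map.
Qed.

Lemma sides_exponent w : sides true w -> gpow w 12 = 1.
Proof.
have [jAM _] := am; move=> [x <-]; rewrite -(homX jAM) groupA_exponent; exact: (hom1 jAM).
Qed.

Lemma sides_not_exponent : exists w, sides false w /\ gpow w 12 <> 1.
Proof.
have [_ [jBM _]] := am; exists (jB five); split; first by exists five.
rewrite -(homX jBM) => /jB1; rewrite /five !gpow_pair => e.
have := f_equal (fun x : groupB => trace (fst (snd x))) e.
by vm_compute.
Qed.
End Vertices.

Definition c1 : groupC := (true, (false, (false, false))).
Definition c4 : groupC := (false, (false, (false, true))).

Lemma inA_c1 : inA c1 = (1, (true, (1, 1))).
Proof. by rewrite /c1 [inA _]/= two00. Qed.

Lemma inB_c1 : inB c1 = (a0, (1, false)).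
Proof. by rewrite /c1 [inB _]/= two10 two00. Qed.

Lemma inB_c4 : inB c4 = (1, (b2, false)).
Proof. by rewrite /c4 [inB _]/= two01 two00. Qed.

Lemma inA_c1_central a : a * inA c1 = inA c1 * a.
Proof.
case: a => [x [b [s t]]]; rewrite inA_c1 !pairM !gmul1 !gmul1r.
by case: b.
Qed.

(** Commuting with [a1] forces the coordinates of [c_2] and [c_3] to vanish, and commuting with [r1]
    that of [c_4]. *)
Lemma inA_central c : (forall a, a * inA c = inA c * a) -> c = 1 \/ c = c1.
Proof.
case: c => [d1 [d2 [d3 d4]]] h.
have h1 := f_equal (fun x : groupA => trace (fst x)) (h (a1, 1)).
have h2 := f_equal (fun x : groupA => trace (fst (snd (snd x)))) (h (1, (1, (r1, 1)))).
suff [-> [-> ->]] : d2 = false /\ d3 = false /\ d4 = false.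
  by case: d1 {h h1 h2}; [right | left].
by move: h1 h2 {h}; case: d2; case: d3; case: d4; vm_compute.
Qed.

Lemma five_not1 : five <> 1.
Proof.
move=> e; have := f_equal (fun x : groupB => trace (fst (snd x))) e.
by vm_compute.
Qed.

Lemma inB_c1_five : inB c1 * five = five * inB c1.
Proof. by rewrite inB_c1 /five !pairM !gmul1 !gmul1r. Qed.

Lemma order5_centralizing_c4 (b : groupB) : gpow b 5 = 1 -> b * inB c4 = inB c4 * b -> b = 1.
Proof.
case: b => [x [x' t]]; rewrite inB_c4 !pairM !gpow_pair => e e'.
have e1 : gpow x 5 = 1 := f_equal (fun x : groupB => fst x) e.
have e2 : gpow x' 5 = 1 := f_equal (fun x : groupB => fst (snd x)) e.
have e3 : gpow (t : Z2) 5 = false := f_equal (fun x : groupB => snd (snd x)) e.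
have e4 : x' * b2 = b2 * x' := f_equal (fun x : groupB => fst (snd x)) e'.
rewrite (sym3_order5 e1) (sym4_order5 e2 e4).
by case: t {e e'} e3.
Qed.

Section NotIsomorphic.
Variables (W W' : group) (jA : groupA -> W) (jB : groupB -> W) (kA : groupA -> W') (kB : groupB -> W').
Hypothesis am : is_amalgam groupC groupA groupB W inA inB jA jB.
Hypothesis am' : is_amalgam groupC groupA groupB W' inA' inB kA kB.
Hypothesis jA1 : forall a, jA a = 1 -> a = 1.
Hypothesis jB1 : forall b, jB b = 1 -> b = 1.
Hypothesis kA1 : forall a, kA a = 1 -> a = 1.
Hypothesis kB1 : forall b, kB b = 1 -> b = 1.
Hypothesis str : amalgam_structure (sides jA jB) (core_image inA jA).
Hypothesis str' : amalgam_structure (sides kA kB) (core_image inA' kA).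

(* An isomorphism matching the vertex groups sends [c_1], central in [A], to [c_4]; but [c_1] commutes with an element of order five of [B], unlike [c_4]. *)
Lemma twisted_not_isomorphic : ~ isomorphic W W'.
Proof.
move=> [f [k [fM [kM [kf fk]]]]].
have [jAM [jBM [jj _]]] := am; have [kAM [kBM [kk _]]] := am'.
have jAI := hom_inj jAM jA1; have jBI := hom_inj jBM jB1.
have kAI := hom_inj kAM kA1; have kBI := hom_inj kBM kB1.
have cl := vertex_letters (sigma := fun c => c) (fun c => eq_refl) am jA1 jB1.
have proper b : exists a, sides jA jB b a /\ ~ core_image inA jA a.
  case: b; first by exists (jA (centA true false)); split; [eexists | exact: (cl_n1 cl)].
  by exists (jB centB); split; [eexists | exact: (cl_ny cl)].
have [f2 [[f2M [k2 [k2M [k2f f2k]]]] hs]] : exists f2, bijective_hom (W := W) (W' := W') f2 /\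
    forall b w, sides jA jB b w <-> sides kA kB b (f2 w).
  apply: (iso_preserves_sides str str' proper (sides_finite jA jB) (sides_finite kA kB) _ _
    (sides_not_exponent am jB1) (sides_not_exponent am' kB1)
    (e := fun c => jA (inA c)) (e' := fun c => kA (inA' c)) _ _ _ _ _ (f := f)).
  - exact: (sides_exponent am).
  - exact: (sides_exponent am').
  - by have [l hl] := groupC_finite; exists l.
  - by move=> d d' /jAI /inA_inj.
  - by move=> d d' /kAI /inA'_inj.
  - by [].
  - by [].
  - by split=> //; exists k.
pose z := jA (inA c1).
have zA : sides kA kB true (f2 z) by apply/hs; eexists.
have zB : sides kA kB false (f2 z) by apply/hs; rewrite /z jj; eexists.
(* The image of [c_1] lies in both vertex groups, hence in [C], and is central in the image of [A].
   Read through the twisted embedding, the only non-trivial candidate is [c_4]. *)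
have [d ed] : core_image inA' kA (f2 z) by apply: (side_inter str' (b := true) (b' := false)).
have f2I x y : f2 x = f2 y -> x = y by move=> E; rewrite -(k2f x) E k2f.
have dc : twist d = 1 \/ twist d = c1.
  apply: inA_central => a; apply: kAI; rewrite !kAM -[inA (twist d)]/(inA' d) ed.
  have [a' ea] : sides jA jB true (k2 (kA a)) by apply/hs; rewrite f2k; exists a.
  by rewrite -(f2k (kA a)) -ea -!f2M /z -!jAM inA_c1_central.
have {dc}ed4 : d = c4.
  case: dc => e; last by rewrite -(twistK d) e.
  have : f2 z = 1 by rewrite -ed /inA' e (hom1 inA_hom) (hom1 kAM).
  rewrite -(hom1 f2M) => /f2I; rewrite /z -(hom1 jAM) -(hom1 inA_hom) => /jAI /inA_inj.
  by [].
subst d; have [b eb] : sides kA kB false (f2 (jB five)) by apply/hs; exists five.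
have b1 : b = 1.
  apply: order5_centralizing_c4.
    by apply: kB1; rewrite (homX kBM) eb -(homX f2M) -(homX jBM) five5 (hom1 jBM) (hom1 f2M).
  by apply: kBI; rewrite !kBM eb -kk ed -!f2M /z jj -!jBM inB_c1_five.
apply: five_not1; apply: jB1; apply: f2I.
by rewrite -eb b1 (hom1 kBM) (hom1 f2M).
Qed.
End NotIsomorphic.

Theorem theorem1p7 :
  exists (C A1 B1 A2 B2 : group)
         (iA1 : C -> A1) (iB1 : C -> B1) (iA2 : C -> A2) (iB2 : C -> B2)
         (W W' : group)
         (jA1 : A1 -> W) (jB1 : B1 -> W) (jA2 : A2 -> W') (jB2 : B2 -> W'),
    finite_group C /\ is_coxeter C /\
    finite_group A1 /\ finite_group B1 /\ finite_group A2 /\ finite_group B2 /\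
    special_embedding C A1 iA1 /\ special_embedding C B1 iB1 /\
    special_embedding C A2 iA2 /\ special_embedding C B2 iB2 /\
    is_amalgam C A1 B1 W iA1 iB1 jA1 jB1 /\
    is_amalgam C A2 B2 W' iA2 iB2 jA2 jB2 /\
    is_coxeter W /\ is_coxeter W' /\
    AE_equivalent W W' /\ ~ isomorphic W W'.
Proof.
have [W [jA [jB [am [jA1 [jB1 str]]]]]] := amalgam_exists inA_hom inB_hom inA_inj inB_inj.
have [W' [kA [kB [am' [kA1 [kB1 str']]]]]] := amalgam_exists inA'_hom inB_hom inA'_inj inB_inj.
exists groupC, groupA, groupB, groupA, groupB, inA, inB, inA', inB, W, W', jA, jB, kA, kB.
have spB : special_embedding groupC groupB inB.
  exact: (special_image inB_hom inB_inj genC_generated coxB genB_emb).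
split; first exact: groupC_finite.
split; first by exists ixC, genC; eexists; exact: coxC.
do 2 (split; first exact: groupA_finite; split; first exact: groupB_finite).
split; first exact: (special_image inA_hom inA_inj genC_generated coxA genA_emb).
split=> //; split; first exact: (special_image inA'_hom inA'_inj genC_generated coxA genA_emb').
do 3 split=> //.
split.
  do 3 eexists; apply: (amalgam_coxeter am inA_hom inB_hom genC_generated coxA coxB
    embA_inj embB_inj genA_emb genB_emb).
  by move=> [[]|[[]|[[]|[]]]] [[]|[[]|[[]|[]]]].
split.
  do 3 eexists; apply: (amalgam_coxeter am' inA'_hom inB_hom genC_generated coxA coxB
    embA'_inj embB_inj genA_emb' genB_emb).
  by move=> [[]|[[]|[[]|[]]]] [[]|[[]|[[]|[]]]].
split; last exact: (twisted_not_isomorphic am am' jA1 jB1 kA1 kB1 str str').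
have [G [g [v ext]]] := central_extension_exists (coreG str).
have [G' [g' [v' ext']]] := central_extension_exists (coreG str').
have cl := vertex_letters (sigma := fun c => c) (fun c => eq_refl) am jA1 jB1.
have cl' := vertex_letters (sigma := twist) (fun c => eq_refl) am' kA1 kB1.
have [|n nE] := twist_conj (sigma := fun c => c) (fun c => eq_refl) am.
  by move=> d1 d2 d3 d4; exists d1, d4.
(* In the second amalgam [sigma] exchanges the outer coordinates, so the witnesses below are
   swapped. *)
have [|n' nE'] := twist_conj (sigma := twist) (fun c => eq_refl) am'.
  by move=> d1 d2 d3 d4; exists d4, d1.
apply: (AE_trans (AE_central_extension str cl ext)).
apply: AE_trans (AE_sym (AE_central_extension str' cl' ext')).
apply: AE_isomorphic.
exact: (twist_isomorphic (iA := inA) (iA' := inA') (iB := inB) (tau := twist)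
  (fun c => eq_refl) twistK am am' nE nE' ext ext').
Qed.
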